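(* Let $q$ be a fixed odd prime power. For all integers $g\ge 1$ and all integers $n>0$, $$ \left\langle \operatorname{tr}\Theta_Q^n\right\rangle = M_g(n) + \eta_n\frac{1}{q^{n/2}}\sum_{\substack{P \text{ prime}\\ \deg P\,\mid\, \frac n2}}\frac{\deg P}{|P|+1} + O_q\left(nq^{n/2-2g}+gq^{-g}\right), $$ where $$ M_g(n)=\begin{cases}-\eta_n, & 0<n<2g,\\ -1-\frac{1}{q-1}, & n=2g,\\ 0,& n>2g,\end{cases} $$ and the implied constant depends only on $q$. Here the sum is over all monic irreducible polynomials $P\in\mathbb{F}_q[x]$ whose degree divides $n/2$ (the term is absent when $n$ is odd, since then $\eta_n=0$).
   Context: $\mathbb{F}_q$ is a finite field with $q$ elements, $q$ odd. A ''prime'' is a monic irreducible polynomial in $\mathbb{F}_q[x]$, and $|f|:=q^{\deg f}$ for a nonzero $f\in\mathbb{F}_q[x]$. $\eta_n=1$ if $n$ is even and $\eta_n=0$ if $n$ is odd. $\mathcal{H}_{2g+1}$ is the set of square-free monic polynomials of degree $2g+1$ in $\mathbb{F}_q[x]$. For $Q\in\mathcal{H}_{2g+1}$, $C_Q$ is the nonsingular projective hyperelliptic curve of genus $g$ over $\mathbb{F}_q$ with affine equation $y^2=Q(x)$. Its zeta function is $Z_{C_Q}(u)=\exp\sum_{n\ge1}N_n(C_Q)\frac{u^n}{n}$, with $N_n(C_Q)$ the number of points of $C_Q$ over $\mathbb{F}_{q^n}$; it has the form $Z_{C_Q}(u)=\frac{P_{C_Q}(u)}{(1-u)(1-qu)}$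 with $P_{C_Q}\in\mathbb{Z}[u]$ of degree $2g$. By the Riemann Hypothesis for curves, $P_{C_Q}(u)=\det(I-u\sqrt{q}\,\Theta_Q)$ for a unitary $2g\times 2g$ matrix $\Theta_Q$ (well defined up to conjugacy), the unitarized Frobenius class of $C_Q$. For a function $F$ on $\mathcal{H}_{2g+1}$, $\langle F\rangle:=\frac{1}{\#\mathcal{H}_{2g+1}}\sum_{Q\in\mathcal{H}_{2g+1}}F(Q)$. *)

(* Defs.v *)
From HB Require Import structures.
From mathcomp Require Import all_boot all_order all_algebra all_field.
From mathcomp Require Import qpoly spectral.
From mathcomp Require Import complex.
From mathcomp Require Import boolp reals.

Set Implicit Arguments.
Unset Strict Implicit.
Unset Printing Implicit Defensive.

Import Order.TTheory GRing.Theory Num.Theory.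
Local Open Scope ring_scope.
Local Open Scope complex_scope.

Section Curve.
Variable F : finFieldType.

Lemma frobenius_poly_neq0 n : 'X^(#|F| ^ maxn 1 n) - 'X != 0 :> {poly F}.
Proof.
have q_gt1 : (1 < #|F| ^ maxn 1 n)%N.
  by rewrite -(expn0 #|F|) ltn_exp2l ?finNzRing_gt1 // leq_maxl.
rewrite -size_poly_gt0 size_polyDl ?size_polyXn //.
by rewrite size_polyN size_polyX ltnS.
Qed.

(* The extension of F of degree n > 0, as a splitting field of X^(q^n) - X;
   n = 0 is read as n = 1. *)
Definition Fext (n : nat) : splittingFieldType F :=
  sval (FinSplittingFieldFor (frobenius_poly_neq0 n)).

(* The nonsingular projective model of y^2 = Q(x), deg Q = 2g + 1, is obtained
   by gluing the affine charts y^2 = Q(x) and v^2 = t^(2g+2) Q(1/t) along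
   t = 1/x, v = y/x^(g+1); its points are those of the first chart together
   with those of the second one lying on t = 0. *)
Definition infinity_chart (g : nat) (Q : {poly F}) : {poly F} :=
  \poly_(i < (2 * g).+3) Q`_((2 * g).+2 - i).

Definition num_points (g : nat) (Q : {poly F}) (n : nat) : nat :=
  let E := finvect_type (Fext n) in
  let toE := map_poly (in_alg E) in
  #|[set a : E * E | a.2 ^+ 2 == (toE Q).[a.1]]|
  + #|[set a : E * E | (a.1 == 0)
                       && (a.2 ^+ 2 == (toE (infinity_chart g Q)).[a.1])]|.

(* Coefficient of u^m in exp (\sum_(n >= 1) N_n u^n / n); since the series in
   the exponent has no constant term, truncating it at u^m and the exponential
   at its m-th term is harmless. *)
Definition zeta_coef (g : nat) (Q : {poly F}) (m : nat) : rat :=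
  let S : {poly rat} :=
    \sum_(1 <= n < m.+1) ((num_points g Q n)%:R / n%:R) *: 'X^n in
  (\sum_(k < m.+1) (k`!%:R)^-1 *: S ^+ k)`_m.

(* Z(u) = P(u) / ((1 - u)(1 - q u)) as formal power series in u. *)
Definition zeta_numerator (g : nat) (Q : {poly F}) (P : {poly int}) : Prop :=
  size P = (2 * g).+1 /\
  forall m : nat,
    \sum_(i < m.+1)
      ((1 - 'X) * (1 - #|F|%:R *: 'X) : {poly rat})`_i * zeta_coef g Q (m - i)
    = (P`_m)%:~R.

Definition unitarized_Frobenius (R : realType) (g : nat) (Q : {poly F})
    (Theta : 'M[R[i]]_(2 * g)) : Prop :=
  Theta \is unitarymx /\
  exists P : {poly int}, zeta_numerator g Q P /\
    map_poly intr P =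
    \det (1%:M - 'X *: map_mx polyC ((Num.sqrt #|F|%:R)%:C *: Theta)).

Definition square_free (p : {poly F}) : Prop :=
  forall u : {poly F}, (size u != 1)%N -> ~~ (u ^+ 2 %| p).

Definition hyperelliptic (g : nat) : {set {poly_((2 * g).+2) F}} :=
  [set Q : {poly_((2 * g).+2) F} |
    [&& size Q == (2 * g).+2, (Q : {poly F}) \is monic & `[< square_free Q >]]].

Definition mean (R : realType) (g : nat) (f : {poly F} -> R[i]) : R[i] :=
  (\sum_(Q in hyperelliptic g) f Q) / #|hyperelliptic g|%:R.

Definition prime_poly (P : {poly F}) : Prop :=
  P \is monic /\ irreducible_poly P.

Definition deg (P : {poly F}) : nat := (size P).-1.

(* Primes of degree dividing m; for m > 0 they have degree at most m. *)
Definition prime_sum (R : realType) (m : nat) : R :=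
  \sum_(P : {poly_(m.+1) F} | `[< prime_poly P >] && (deg P %| m)%N)
    (deg P)%:R / ((#|F| ^ deg P)%:R + 1).

End Curve.

Definition even_ind (R : realType) (n : nat) : R := (~~ odd n)%:R.

Definition main_term (R : realType) (q g n : nat) : R :=
  if (n < 2 * g)%N then - even_ind R n
  else if n == (2 * g)%N then -1 - 1 / (q%:R - 1)
  else 0.

(* Main.v *)
(* Counting points gives q^(n/2) tr Theta_Q^n = - sum_x chi(Q(x)) over x in F_(q^n),
   so after exchanging sums one needs, for each x, the sum S(x) of chi(D(x)) over the
   square-free monic D of degree 2g + 1.  Writing monic polynomials as A^2 D yields a
   recurrence, with step twice the degree d of x, between S(x) and the sums W_k(x) of
   chi(B(x)) over all monic B of degree k.  If n/d is even then chi = 1 on F_q(x)^*,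
   and S(x) produces the sum over primes.  If n/d is odd then W_k(x) = 0 for k >= d,
   and S(x) is small unless d = n and 2g <= n.  For d = n the W_k(x) are the
   coefficients of an L-polynomial; its functional equation, whose sign is determined
   by evaluating W_k(x) modulo 4, exchanges k and n - 1 - k (for n even, k and
   n - 2 - k for the partial sums of the W_k).  On average over x, Weil's bound for
   y^2 = B(x), proved by Stepanov's method, leaves only the squares B. *)

Require Import Defs.
From HB Require Import structures.
From mathcomp Require Import all_boot all_order all_algebra all_field.
From mathcomp Require Import complex.
From mathcomp Require Import boolp reals.
From mathcomp Require Import qpoly spectral.
From mathcomp Require Import zify ring lra.

Import Order.TTheory GRing.Theory Num.Theory.
Local Open Scope ring_scope.
Local Open Scope complex_scope.

Set Implicit Arguments.
Unset Strict Implicit.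
Unset Printing Implicit Defensive.

(** What forces a functional equation is the range n > 2g. For the generators of the field with q^n
    elements, Weil's bound applied directly in degree k = 2g + 1 or 2g - 1 loses n q^k q^(n/2),
    which does not decay after division by q^(n/2) and by the number of curves. After reflection the
    loss is about n q^n whatever k is. The sign must be known exactly: it decides that the surviving
    squares cancel the -1 of the even case for n > 2g and give -1/(q - 1) at n = 2g. Arithmetic
    modulo 4 finds it because the square of the unknown number is a known power of the odd number q.
    The functional equation itself stays in the integers: in the Gauss sum behind it, the additive
    character is replaced by a function on F composed with a linear form from E to F, namely the
    indicator of 0 for n even and the quadratic character of F for n odd. *)

Definition chi (K : finFieldType) (x : K) : int :=
  if x == 0 then 0 else if x ^+ (#|K|.-1)./2 == 1 then 1 else -1.

(** * Stepanov's method *)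

Section Jets.
Variable K : fieldType.
Implicit Types (p f : {poly K}) (u v : {poly {poly K}}).

(* p(x + h), as a polynomial in h over K[x]. *)
Definition jet p : {poly {poly K}} := p^:P \Po ('X + 'X%:P).

Lemma jetB : {morph jet : p q / p - q}.
Proof. by move=> p q; rewrite /jet rmorphB /= comp_polyB. Qed.

Lemma map_jet p x0 : map_poly (horner_eval x0) (jet p) = p \Po ('X + x0%:P).
Proof.
rewrite /jet map_comp_poly rmorphD /= map_polyX map_polyC /= horner_evalE hornerX.
congr (_ \Po _); rewrite -map_poly_comp map_poly_id //.
by move=> a _ /=; rewrite horner_evalE hornerC.
Qed.

Lemma jet_coef0 p : (jet p)`_0 = p.
Proof.
rewrite -horner_coef0 /jet horner_comp hornerD hornerX hornerC add0r.
have : (p^:P).['X] = p \Po 'X by rewrite comp_polyE horner_coef size_map_polyC;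
  apply: eq_bigr => i _; rewrite coef_map /= mul_polyC.
by rewrite comp_polyXr.
Qed.

Lemma jet_split p : exists g, jet p = p%:P + 'X * g.
Proof.
have /factor_theorem [g Eg] : root (jet p - p%:P) 0.
  by rewrite /root hornerD hornerN hornerC horner_coef0 jet_coef0 subrr.
by exists g; rewrite mulrC -['X]subr0 -polyC0 -Eg addrC subrK.
Qed.

(** The outer variable is h, and x lives in the coefficients: this is a bound on the degree in x,
    uniform in h. It will count the linear conditions imposed on the auxiliary polynomial. *)
Definition xdeg (N : nat) u := forall i, (size (u`_i)%R <= N.+1)%N.

Lemma xdegW N M u : (N <= M)%N -> xdeg N u -> xdeg M u.
Proof. by move=> h H i; apply: leq_trans (H i) _. Qed.

Lemma xdegD N u v : xdeg N u -> xdeg N v -> xdeg N (u + v).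
Proof.
move=> hu hv i; rewrite coefD; apply: leq_trans (size_polyD _ _) _.
by rewrite geq_max hu hv.
Qed.

Lemma xdeg_sum N (I : Type) (r : seq I) (P : pred I) (G : I -> {poly {poly K}}) :
  (forall i, P i -> xdeg N (G i)) -> xdeg N (\sum_(i <- r | P i) G i).
Proof.
move=> H; elim/big_rec: _ => [i|i x Pi hx]; first by rewrite coef0 size_poly0.
by apply: xdegD => //; apply: H.
Qed.

Lemma size_mul_small N M p f :
  (size p <= N.+1 -> size f <= M.+1 -> size (p * f)%R <= (N + M).+1)%N.
Proof. by move=> h1 h2; apply: leq_trans (size_polyMleq _ _) _; lia. Qed.

Lemma xdegM N M u v : xdeg N u -> xdeg M v -> xdeg (N + M) (u * v).
Proof.
move=> hu hv i; rewrite coefM; apply: leq_trans (size_sum _ _ _) _.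
by apply/bigmax_leqP => j _; apply: size_mul_small.
Qed.

Lemma xdegC N p : (size p <= N.+1)%N -> xdeg N p%:P.
Proof. by move=> h i; rewrite coefC; case: eqP => // _; rewrite size_poly0. Qed.

Lemma xdegX0 : xdeg 0 'X.
Proof. by move=> i; rewrite coefX; case: eqP => _; rewrite ?size_poly1 ?size_poly0. Qed.

Lemma xdeg_exp N u k : xdeg N u -> xdeg (N * k) (u ^+ k).
Proof.
move=> h; elim: k => [|k IH]; first by rewrite muln0 expr0; apply: xdegC; rewrite size_poly1.
by rewrite exprS mulnS; apply: xdegM.
Qed.

Lemma xdeg_jet N p : (size p <= N.+1)%N -> xdeg N (jet p).
Proof.
move=> h; rewrite /jet comp_polyE; apply: xdeg_sum => i _.
rewrite -mul_polyC coef_map /=.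
have hi : (i <= N)%N by have : (i < size p)%N; [rewrite -(size_map_polyC p) | lia].
apply: xdegW hi _; rewrite -[nat_of_ord i]add0n -[X in xdeg (0 + X)]mul1n.
apply: xdegM; first by apply: xdegC; exact: size_polyC_leq1.
apply: xdeg_exp; apply: xdegD; first exact: xdegW xdegX0.
by apply: xdegC; rewrite size_polyX.
Qed.

Lemma xdeg_cofX N p g : xdeg N (p%:P + 'X * g) -> xdeg N g.
Proof.
move=> h i; have := h i.+1; rewrite coefD coefC /= add0r mulrC coefMX /=. by [].
Qed.

(* U is the truncation below h^l of f^l f(x + h)^c / f^c. *)
Lemma jet_exp f l c : (l <= c)%N -> exists U, xdeg ((size f).-1 * l) U /\
  exists W, (f ^+ l)%:P * jet f ^+ c = (f ^+ c)%:P * U + 'X^l * W.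
Proof.
move=> lec; have [g Eg] := jet_split f.
(* In the binomial expansion of (f + h g)^c the terms with k < l satisfy f^l f^(c - k) = f^c f^(l -
   k), so the degree in x of the truncation depends on l and not on c. *)
pose U := \sum_(k < l) (f ^+ (l - k))%:P * ('X * g) ^+ k *+ 'C(c, k).
have hf : (size f <= (size f).-1.+1)%N by lia.
exists U; split.
  apply: xdeg_sum => k _; rewrite -mulr_natr.
  have -> : ((size f).-1 * l = (size f).-1 * (l - k) + (size f).-1 * k + 0)%N.
    by rewrite addn0 -mulnDr subnK // ltnW.
  apply: xdegM; last by rewrite -polyC_natr; apply: xdegC; rewrite -polyC_natr size_polyC_leq1.
  apply: xdegM; first by rewrite rmorphXn /=; apply: xdeg_exp; apply: xdegC.
  apply: xdeg_exp; rewrite -[(size f).-1]add0n; apply: xdegM; first exact: xdegX0.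
  by apply: xdeg_cofX (f) _ _; rewrite -Eg; exact: xdeg_jet.
pose W := \sum_(l <= k < c.+1) (f ^+ l)%:P * ((f%:P) ^+ (c - k) * ('X ^+ (k - l) * g ^+ k)) *+ 'C(c, k).
exists W; rewrite Eg exprDn -(big_mkord xpredT (fun k => f%:P ^+ (c - k) * ('X * g) ^+ k *+ 'C(c, k))).
rewrite (big_cat_nat (n := l)) //=; last by lia.
rewrite mulrDr; congr (_ + _); rewrite mulr_sumr.
  rewrite big_mkord mulr_sumr; apply: eq_bigr => k _.
  have e : f ^+ l * f ^+ (c - k) = f ^+ c * f ^+ (l - k).
    by rewrite -2!exprD; congr (_ ^+ _); have := ltn_ord k; lia.
  by rewrite -rmorphXn !mulrnAr !mulrA -!polyCM e.
rewrite mulr_sumr big_nat_cond [RHS]big_nat_cond; apply: eq_bigr => k /andP [/andP [h1 h2] _].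
have -> : ('X * g) ^+ k = 'X^l * ('X^(k - l) * g ^+ k).
  by rewrite exprMn mulrA -exprD subnKC.
by rewrite !mulrnAr; congr (_ *+ _); rewrite !mulrA; congr (_ * _ * _); rewrite mulrC !mulrA.
Qed.

Lemma dvd_XsubC_shift p x l : ('X^l %| p \Po ('X + x%:P)) -> (('X - x%:P) ^+ l %| p).
Proof.
move=> h; have := dvdp_comp_poly ('X - x%:P) h.
rewrite rmorphXn /= comp_polyX -comp_polyA comp_polyD comp_polyX comp_polyC subrK.
by rewrite comp_polyXr.
Qed.

Lemma prod_XsubC_exp_dvd (s : seq K) l p : uniq s ->
  (forall x, x \in s -> ('X - x%:P) ^+ l %| p) -> (\prod_(x <- s) ('X - x%:P)) ^+ l %| p.
Proof.
elim: s => [|x s IH] /=; first by rewrite big_nil expr1n dvd1p.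
move=> /andP [xs us] h; rewrite big_cons exprMn Gauss_dvdp.
  rewrite h ?mem_head //= IH // => y ys; apply: h; by rewrite inE ys orbT.
apply: coprimep_expl; apply: coprimep_expr; rewrite coprimep_sym.
have : all (predC1 x) s by apply/allP => y ys /=; apply: contraNneq xs => <-.
elim: (s) => [|y r IHr] /=; first by rewrite big_nil coprime1p.
move=> /andP [yx hr]; rewrite big_cons coprimepMl IHr // andbT.
by rewrite coprimep_XsubC root_XsubC eq_sym.
Qed.

Lemma size_exp_roots (s : seq K) l p : uniq s -> p != 0 ->
  (forall x, x \in s -> 'X^l %| p \Po ('X + x%:P)) -> (l * size s < size p)%N.
Proof.
move=> us p0 h.
have : (\prod_(x <- s) ('X - x%:P)) ^+ l %| p.
  by apply: prod_XsubC_exp_dvd => // x xs; apply: dvd_XsubC_shift; apply: h.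
move=> /(dvdp_leq p0); have := size_exp (\prod_(x <- s) ('X - x%:P)) l.
rewrite size_prod_XsubC /= mulnC => <-.
by case: (size _) => [|k]; rewrite ?size_poly_gt0.
Qed.

End Jets.

Section FinField.
Variable K : finFieldType.
Local Notation Q := #|K|.

Lemma card_pchar_pow :
  exists p k, [/\ prime p, p \in [pchar K], (0 < k)%N & Q = (p ^ k)%N].
Proof.
have [p pr_p pK] := finPcharP K; exists p, (logn p Q).
have eQ : Q = (p ^ logn p Q)%N by rewrite -(card_pprimeChar pK).
by split=> //; rewrite lt0n; apply: contraTneq (finNzRing_gt1 K) => e; rewrite eQ e.
Qed.

Lemma card_pchar_nat (A : comNzRingType) : [pchar A] =i [pchar K] -> [pchar A].-nat Q.
Proof.
move=> eA; have [p [k [pr_p pK _ ->]]] := card_pchar_pow.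
by rewrite pnatX; apply/orP; left; rewrite pnatE // eA.
Qed.

Lemma poly_exprD_card (x y : {poly K}) : (x + y) ^+ Q = x ^+ Q + y ^+ Q.
Proof. by apply: exprDn_pchar; apply: card_pchar_nat => p; rewrite pchar_poly. Qed.

Lemma poly_expr_card (p : {poly K}) : p ^+ Q = p \Po 'X^Q.
Proof.
elim/poly_ind: p => [|p c IH]; first by rewrite comp_poly0 expr0n; case: #|K| (finNzRing_gt1 K).
by rewrite poly_exprD_card exprMn IH comp_polyD comp_polyM comp_polyX comp_polyC -polyC_exp expf_card.
Qed.

Section Aux.
Variables (f : {poly K}) (a : K) (c l B J : nat).
Local Notation m := (size f).-1.
Hypothesis Qc : Q = c.*2.+1.
Hypothesis f0 : f.[0] != 0.
Hypothesis nsq : forall (r s : {poly K}) (e : K), r ^+ 2 * f = e *: s ^+ 2 -> r = 0.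
Hypothesis a0 : a != 0.
Hypothesis lc : (l <= c)%N.
Hypothesis B0 : (0 < B)%N.
Hypothesis BQ : (B.*2 + m <= Q.+1)%N.
Hypothesis J0 : (0 < J)%N.
Hypothesis count : (l * (B.-1 + m * l + J.-1).+1 < J * B + J * B)%N.

Local Notation M := 'M[K]_(J, B).
Let rp (R : M) j : {poly K} := rVpoly (row j R).

Let size_rp R j : (size (rp R j) <= B)%N.
Proof. by rewrite /rp /rVpoly; exact: size_poly. Qed.

Let rpB R S j : rp (R - S) j = rp R j - rp S j.
Proof. by rewrite /rp linearB /= linearB. Qed.

(** Stepanov's auxiliary polynomial; the rows of [R] and [S] are unknown polynomials of degree < B.
    At the points considered f^c takes the value a and x^Q the value x, so that vanishing to high
    order costs few conditions. *)
Let P (R S : M) : {poly K} :=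
  \sum_(j < J) (rp R j + rp S j * f ^+ c) * 'X^(j * Q).

(** If all blocks before j vanish, x^Q divides r_j + s_j f^c. Multiplying by (r_j - s_j f^c) f turns
    the powers of f into f^Q, which is f(0) modulo x^Q. The degree of r_j^2 f - f(0) s_j^2 is below
    Q, so this polynomial is zero and [nsq] gives r_j = 0. *)
Lemma aux_poly_eq0 R S : P R S = 0 -> (R = 0) /\ (S = 0).
Proof.
move=> P0.
suff H j : rp R j = 0 /\ rp S j = 0.
  by split; apply/row_matrixP => j; rewrite row0; apply: (can_inj rVpolyK);
     rewrite linear0; case: (H j).
have [k] := ubnP (nat_of_ord j); elim: k j => // k IH j; rewrite ltnS => jk.
have {}IH (i : 'I_J) : (i < j)%N -> rp R i = 0 /\ rp S i = 0.
  by move=> ij; apply: IH; apply: leq_trans ij jk.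
have dv : 'X^Q %| rp R j + rp S j * f ^+ c.
  have X0 : 'X^(j * Q) != 0 :> {poly K} by rewrite -size_poly_gt0 size_polyXn.
  rewrite -(dvdp_mul2r _ _ X0) -exprD.
  have : P R S = 0 by [].
  rewrite /P (bigD1 j) //= => /eqP; rewrite addr_eq0 => /eqP ->.
  rewrite dvdpNr; apply: (big_ind (fun p => 'X^(Q + j * Q) %| p)) => [|x y|i ij]; [exact: dvdp0|exact: dvdp_add|].
  case: (ltnP i j) => [/IH [-> ->]|ji]; first by rewrite mul0r addr0 mul0r dvdp0.
  apply: dvdp_mull; apply: dvdp_exp2l.
  have : (j < i)%N by rewrite ltn_neqAle ji andbT; apply: contraNneq ij => e; apply/eqP/val_inj.
  by rewrite -[(Q + _)%N]mulSn; move=> h; rewrite leq_mul2r h orbT.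
have X1 : 'X^Q %| f ^+ Q - (f.[0])%:P.
  have -> : f ^+ Q - (f.[0])%:P = (f - (f.[0])%:P) \Po 'X^Q.
    by rewrite comp_polyB comp_polyC poly_expr_card.
  rewrite -[X in X %| _]comp_polyX.
  apply: dvdp_comp_poly; rewrite -['X]subr0 -polyC0 dvdp_XsubCl /root.
  by rewrite hornerD hornerN hornerC subrr.
have X2 : 'X^Q %| rp R j ^+ 2 * f - f.[0] *: rp S j ^+ 2.
  have -> : rp R j ^+ 2 * f - f.[0] *: rp S j ^+ 2 =
    (rp R j + rp S j * f ^+ c) * ((rp R j - rp S j * f ^+ c) * f) +
    (f ^+ Q - (f.[0])%:P) * rp S j ^+ 2.
    have -> : f ^+ Q = f * (f ^+ c * f ^+ c) by rewrite Qc -addnn exprS exprD.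
    by rewrite -mul_polyC; ring.
  by apply: dvdp_add; apply: dvdp_mulr.
have szf : (size f <= m.+1)%N by lia.
have e : rp R j ^+ 2 * f - f.[0] *: rp S j ^+ 2 = 0.
  apply/eqP; apply: contraTT X2 => nz; apply/negP => /(dvdp_leq nz).
  rewrite size_polyXn; apply/negP; rewrite -ltnNge ltnS.
  have sq (p : {poly K}) : (size p <= B -> size (p ^+ 2) <= (B.-1 + B.-1).+1)%N.
    by move=> h; rewrite expr2; apply: size_mul_small; rewrite prednK.
  apply: leq_trans (size_polyD _ _) _; rewrite geq_max size_polyN; apply/andP; split.
    apply: leq_trans (size_mul_small (sq _ (size_rp R j)) szf) _; lia.
  apply: leq_trans (size_scale_leq _ _) _.
  by apply: leq_trans (sq _ (size_rp S j)) _; lia.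
have r0 : rp R j = 0.
  by move/eqP: e; rewrite subr_eq0 => /eqP /nsq.
split=> //; move/eqP: e; rewrite r0 expr0n mul0r sub0r oppr_eq0 scaler_eq0 (negbTE f0) /=.
by rewrite expf_eq0 /= => /eqP.
Qed.

Lemma size_aux_poly R S : (size (P R S) <= (B.-1 + m * c + J.-1 * Q).+1)%N.
Proof.
have szf : (size f <= m.+1)%N by lia.
have szfc : (size (f ^+ c) <= (m * c).+1)%N by rewrite -size_exp leqSpred.
apply: leq_trans (size_sum _ _ _) _; apply/bigmax_leqP => j _.
apply: (@size_mul_small _ (B.-1 + m * c) (J.-1 * Q)); last first.
  by rewrite size_polyXn ltnS leq_mul2r; apply/orP; right; have := ltn_ord j; lia.
apply: leq_trans (size_polyD _ _) _; rewrite geq_max; apply/andP; split.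
  by apply: leq_trans (size_rp _ _) _; rewrite -addSn prednK // leq_addr.
by apply: size_mul_small => //; rewrite prednK.
Qed.

(** At a point x with f(x)^c = a, f(x)^l P(x + h) agrees modulo h^l with [Psi]: by [jet_exp] the
    power f^c becomes a, and (x + h)^(jQ) = (x + h^Q)^j becomes x^j. Killing the l lowest
    coefficients of [Psi], which have small degree in x, makes P vanish to order l at all these
    points at once. *)
Lemma stepanov_count :
  (l * #|[set x : K | f.[x] ^+ c == a]| <= B.-1 + m * c + J.-1 * Q)%N.
Proof.
have [U [dU [W EW]]] := jet_exp f lc.
pose Psi (R S : M) : {poly {poly K}} := \sum_(j < J)
  ((f ^+ l)%:P * jet (rp R j) + a%:P%:P * jet (rp S j) * U) * ('X^j)%:P.
pose N := (B.-1 + m * l + J.-1).+1.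
have szf : (size f <= m.+1)%N by lia.
have dPsi R S : xdeg (B.-1 + m * l + J.-1) (Psi R S).
  have dj T (j : 'I_J) : xdeg B.-1 (jet (rp T j)).
    by apply: xdeg_jet; rewrite prednK.
  apply: xdeg_sum => j _; apply: xdegM; last first.
    by apply: xdegC; rewrite size_polyXn; have := ltn_ord j; lia.
  apply: xdegD.
    rewrite addnC; apply: xdegM => //; apply: xdegC.
    by rewrite -size_exp leqSpred.
  apply: xdegM => //; rewrite -[B.-1]add0n; apply: xdegM => //.
  by apply: xdegC; exact: size_polyC_leq1.
have PsiB R S R' S' : Psi (R - R') (S - S') = Psi R S - Psi R' S'.
  rewrite /Psi -sumrB; apply: eq_bigr => j _; rewrite !rpB !jetB; ring.
pose phi (T : M * M) : 'M[K]_(l, N) := \matrix_(t < l, i < N) (Psi T.1 T.2)`_t`_i.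
have phiB : {morph phi : x y / x - y}.
  by move=> x y; apply/matrixP => t i; rewrite !mxE /= PsiB !coefB.
(* Pigeonhole in place of linear algebra: by [count] the 2JB unknown coefficients outnumber the lN
   conditions, so two pairs of matrices have the same image under [phi]. *)
have cN : (#|{: 'M[K]_(l, N)}| < #|{: M * M}|)%N.
  by rewrite card_prod !card_mx -expnD ltn_exp2l // finNzRing_gt1.
have /injectivePn [x [y xy phixy]] : ~~ injectiveb phi.
  by apply/negP => /injectiveP /leq_card; rewrite leqNgt cN.
have {phixy}phi0 : phi (x - y) = 0 by rewrite phiB phixy subrr.
have {xy} : x - y != 0 by rewrite subr_eq0.
case: (x - y) phi0 => R S phi0 RS0 {x y}.
have Psi0 t : (t < l)%N -> (Psi R S)`_t = 0.
  move=> tl; apply/polyP => i; rewrite coef0.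
  case: (ltnP i N) => iN; last by rewrite nth_default // (leq_trans (dPsi R S t)).
  by have := congr1 (fun Z : 'M_(l, N) => Z (Ordinal tl) (Ordinal iN)) phi0; rewrite !mxE.
have P0 : P R S != 0.
  apply: contraNneq RS0 => /aux_poly_eq0 [-> ->]; by apply/eqP.
have [XPsi EPsi] : exists Z, Psi R S = 'X^l * Z.
  exists (drop_poly l (Psi R S)).
  rewrite -{1}(poly_take_drop l (Psi R S)) mulrC.
  suff -> : take_poly l (Psi R S) = 0 by rewrite add0r.
  by apply/polyP => i; rewrite coef_take_poly coef0; case: ltnP => // /Psi0.
rewrite -ltnS cardE.
apply: leq_trans (size_aux_poly R S).
apply: size_exp_roots => //; first exact: enum_uniq.
move=> x; rewrite mem_enum inE => /eqP fxa.
have fx0 : f.[x] ^+ l != 0.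
  rewrite expf_eq0 negb_and; apply/orP; right; apply: contraNneq a0 => e.
  move: fxa; rewrite e => <-; rewrite expr0n; case: (posnP c) => // c0.
  by have := finNzRing_gt1 K; rewrite Qc c0.
rewrite -(dvdpZr _ _ fx0).
pose ev := map_poly (horner_eval x).
have evC (p : {poly K}) : ev p%:P = (p.[x])%:P by rewrite /ev map_polyC.
have evX : ev 'X = 'X by rewrite /ev map_polyX.
have evf : (f.[x] ^+ l)%:P * (f \Po ('X + x%:P)) ^+ c = a%:P * ev U + 'X^l * ev W.
  have := congr1 ev EW; rewrite /ev !(rmorphM, rmorphD, rmorphXn) /= map_jet -/ev.
  by rewrite !evC evX -!polyC_exp fxa.
have XQx j : ('X + x%:P) ^+ (j * Q) = ('X^Q + x%:P) ^+ j :> {poly K}.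
  by rewrite mulnC exprM poly_exprD_card -polyC_exp expf_card.
have lQ : (l <= Q)%N by rewrite Qc; lia.
have cong j : 'X^l %| ('X^Q + x%:P) ^+ j - (x ^+ j)%:P.
  rewrite polyC_exp subrXX addrK; apply: dvdp_mulr; exact: dvdp_exp2l.
suff : 'X^l %| f.[x] ^+ l *: (P R S \Po ('X + x%:P)) - ev (Psi R S).
  move=> h; rewrite -(dvdp_addl _ (n := - ev (Psi R S))) //.
  by rewrite dvdpNr EPsi /ev rmorphM /= rmorphXn /= map_polyX dvdp_mulIl.
rewrite /P /Psi /ev !(raddf_sum (comp_poly _)) (raddf_sum (map_poly (horner_eval x))) /=.
rewrite scaler_sumr -sumrB; apply: (big_ind (fun p => 'X^l %| p)) => [|u v|j _]; [exact: dvdp0|exact: dvdp_add|].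
rewrite !(comp_polyM, comp_polyD, rmorphM, rmorphD, rmorphXn) /= !map_jet -/ev !evC.
rewrite comp_polyX XQx !hornerE.
set A := rp R j \Po _; set C := rp S j \Po _; set G := (f \Po _) ^+ c.
set Y := (_ + _) ^+ j.
have -> : f.[x] ^+ l *: ((A + C * G) * Y) - ((f.[x])%:P ^+ l * A + a%:P * C * ev U) * x%:P ^+ j
  = (f.[x] ^+ l)%:P * (A + C * G) * (Y - (x ^+ j)%:P) + 'X^l * (C * ev W * (x ^+ j)%:P).
  rewrite -mul_polyC !polyC_exp.
  have -> : a%:P * C * ev U = C * ((f.[x])%:P ^+ l * G - 'X^l * ev W).
    by rewrite -polyC_exp evf; ring.
  ring.
by apply: dvdp_add; [apply: dvdp_mull; exact: cong | exact: dvdp_mulIl].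
Qed.

End Aux.

Section Bound.
Hypothesis Q_odd : odd Q.
Local Notation c := (Q.-1)./2.

Lemma half_card : Q = c.*2.+1.
Proof.
have g : (1 < Q)%N := finNzRing_gt1 K.
by rewrite -[LHS](odd_double_half) ; move: Q_odd g; case: #|K| => //= n; lia.
Qed.

Lemma half_card_gt0 : (0 < c)%N.
Proof.
have g : (1 < Q)%N := finNzRing_gt1 K.
by move: half_card g; case: (_./2) => // ->.
Qed.

Lemma two_neq0 : 2%:R != 0 :> K.
Proof.
have [p [k [pr_p pK k0 eQ]]] := card_pchar_pow.
have p_odd : odd p by move: Q_odd; rewrite eQ oddX eqn0Ngt k0.
apply/negP => e2; have h2 : 2 \in [pchar K] by rewrite inE e2.
by move: h2; rewrite (pcharf_eq pK) => /eqP e; move: p_odd; rewrite -e.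
Qed.

Lemma oneN1 : (1 : K) != -1.
Proof. by rewrite -subr_eq0 opprK; exact: two_neq0. Qed.

Lemma chi_pm1 (x : K) : x != 0 -> (x ^+ c == 1) || (x ^+ c == -1).
Proof.
move=> x0; rewrite -eqf_sqr expr1n -exprM muln2.
by have /eqP := expf_card x; rewrite {1}half_card exprS -subr_eq0 -{3}[x]mulr1 -mulrBr mulf_eq0 (negbTE x0) subr_eq0.
Qed.

Lemma chi_ind (x : K) : chi x = (x ^+ c == 1)%:R - (x ^+ c == -1)%:R.
Proof.
rewrite /chi; case: eqP => [->|/eqP x0].
  by rewrite expr0n gtn_eqF ?half_card_gt0 // eq_sym oner_eq0 eq_sym oppr_eq0 oner_eq0.
case/orP: (chi_pm1 x0) => /eqP ->; rewrite ?eqxx ?(negbTE oneN1) //.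
by rewrite eq_sym (negbTE oneN1).
Qed.

(** This is the hypothesis [count] for l = 2 lam and J = lam + 2m. After cancelling 2 lam B, the
    right side keeps 4mB, about 2mN, and the left side about 4 m lam^2 + 2 lam^2 + 4 m lam, at most
    mN + N/2 + N/4. *)
Lemma stepanov_arith (N m lam B : nat) : (0 < m)%N -> (64 * m ^ 2 <= N)%N ->
  (4 * lam ^ 2 <= N)%N -> (N <= B.*2 + m)%N -> (0 < B)%N ->
  (lam.*2 * (B.-1 + m * lam.*2 + (lam + m.*2).-1).+1 < (lam + m.*2) * B + (lam + m.*2) * B)%N.
Proof.
move=> m0 mN lN NB B0.
have h : (16 * (lam * m) <= N)%N.
  rewrite -leq_sqr; apply: (@leq_trans ((4 * lam ^ 2) * (64 * m ^ 2))); last by rewrite -mulnn leq_mul.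
  by rewrite !expnMn; lia.
have h2 : (4 * lam ^ 2 * m <= N * m)%N by rewrite leq_mul2r lN orbT.
have h3 : (N * m <= (B.*2 + m) * m)%N by rewrite leq_mul2r NB orbT.
have h4 : (N <= N * m)%N by rewrite leq_pmulr.
have h5 : (0 < N)%N by lia.
nia.
Qed.

(** The count is at most Q/2 + 3mQ/(2 lam), hence Q/2 + O(m sqrt Q) once lam has the order of sqrt
    Q. *)
Lemma card_value_bound (f : {poly K}) (a : K) (lam : nat) (m := (size f).-1) :
  (0 < m)%N -> (64 * m ^ 2 <= Q)%N -> (0 < lam)%N -> (4 * lam ^ 2 <= Q)%N -> f.[0] != 0 ->
  (forall (r s : {poly K}) (e : K), r ^+ 2 * f = e *: s ^+ 2 -> r = 0) -> a != 0 ->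
  (lam * #|[set x : K | f.[x] ^+ c == a]|.*2 <= lam * Q + 3 * m * Q)%N.
Proof.
move=> m0 mQ l0 lQ f0 nsq a0.
have Qc := half_card.
pose B := ((Q.+1 - m)./2)%N.
have mQ' : (64 * m <= Q)%N by apply: leq_trans mQ; rewrite leq_mul2l /= -mulnn leq_pmulr.
have lQ' : (lam.*2 <= c)%N.
  have : (8 <= Q)%N by lia.
  by case: (lam) l0 lQ => [|[|[|k]]] // _; rewrite Qc; nia.
have BQ : (B.*2 + m <= Q.+1)%N by rewrite /B; move: mQ'; generalize (Q); lia.
have BQ2 : (Q <= B.*2 + m)%N by rewrite /B; move: mQ'; generalize (Q); lia.
have B0 : (0 < B)%N by rewrite /B; move: mQ'; generalize (Q); lia.
have J0 : (0 < lam + m.*2)%N by lia.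
have cnt := stepanov_arith m0 mQ lQ BQ2 B0.
have := stepanov_count Qc f0 nsq a0 lQ' B0 BQ J0 cnt.
rewrite -/m; set S := #|[set x | _]|; move: S Qc BQ B0 => S Qc BQ B0.
have -> : ((lam + m.*2).-1 * Q = lam * Q + 2 * m * Q - Q)%N by rewrite -subn1 mulnBl mul1n mulnDl -mul2n.
have h1 : ((m * c).*2 <= m * Q)%N by rewrite doubleMr leq_mul2l [in X in (_ <= X)%N]Qc leqnSn orbT.
have h2 : (Q <= m * Q)%N by rewrite leq_pmull.
move: mQ' h1 h2 BQ B0; generalize (m * c)%N; rewrite -!mulnA.
have -> : (lam.*2 * S = lam * S.*2)%N by rewrite -doubleMl doubleMr.
generalize (m * Q)%N (lam * S.*2)%N (lam * Q)%N; lia.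
Qed.

Lemma abs_chi_le1 (x : K) : `|chi x| <= 1.
Proof. by rewrite /chi; case: eqP => // _; case: eqP. Qed.

Lemma sum_chi_ind (f : {poly K}) : \sum_x chi f.[x] =
  #|[set x | (f.[x] ^+ c == 1)%R]|%:R - #|[set x | (f.[x] ^+ c == -1)%R]|%:R.
Proof.
have h a : #|[set x | f.[x] ^+ c == a]|%:R = \sum_x (f.[x] ^+ c == a)%:R :> int.
  by rewrite -sum1dep_card natr_sum big_mkcond; apply: eq_bigr => x _; case: eqP.
by rewrite !h -sumrB; apply: eq_bigr => x _; rewrite chi_ind.
Qed.

(** Every x that is not a root of f takes one of the two values. This turns the upper bound for one
    value into a lower bound for the other. *)
Lemma card_value_lower (f : {poly K}) : f != 0 ->
  (Q <= #|[set x | (f.[x] ^+ c == 1)%R]| + #|[set x | (f.[x] ^+ c == -1)%R]| + (size f).-1)%N.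
Proof.
move=> f0; set A := [set x | _]; set A' := [set x | f.[x] ^+ c == -1].
pose Z := [set x | root f x].
have : [set: K] \subset A :|: A' :|: Z.
  apply/subsetP => x _; rewrite !inE rootE.
  by case: (altP (f.[x] =P 0)) => [_|/chi_pm1 ->]; rewrite ?orbT.
move/subset_leq_card; rewrite cardsT => h; apply: (leq_trans h).
apply: leq_trans (leq_card_setU _ _) _; apply: leq_add; first exact: leq_card_setU.
rewrite cardE.
have := @max_poly_roots _ f (enum Z) f0.
rewrite enum_uniq => H; have {}H := H _ isT.
have : (size (enum Z) < size f)%N by apply: H; apply/allP => x; rewrite mem_enum inE.
by case: (size f).
Qed.

Lemma sqrt_quarter (N : nat) : (4 <= N)%N ->
  exists2 lam, (0 < lam)%N & (4 * lam ^ 2 <= N)%N /\ (N <= 16 * lam ^ 2)%N.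
Proof.
move=> N4; have ex : exists lam, (4 * lam ^ 2 <= N)%N by exists 1.
have bd lam : (4 * lam ^ 2 <= N)%N -> (lam <= N)%N.
  by apply: leq_trans; case: lam => // k; rewrite -mulnn; nia.
case: (ex_maxnP ex bd) => lam h1 h2; exists lam; first exact: h2.
split=> //; have l0 : (0 < lam)%N by apply: h2.
have : (N < 4 * lam.+1 ^ 2)%N by rewrite ltnNge; apply/negP => /h2; rewrite ltnn.
rewrite -!mulnn; nia.
Qed.

(** From S1 - S2 <= 2 S1 - N + m one gets 16 lam (S1 - S2) <= 49 m N. With N <= 16 lam^2 this yields
    (S1 - S2)^2 <= (49/4)^2 m^2 N, and 13 is 49/4 rounded up. *)
Lemma stepanov_combine (S1 S2 N m lam : nat) : (0 < m)%N -> (64 * m ^ 2 <= N)%N ->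
  (0 < lam)%N -> (4 * lam ^ 2 <= N)%N -> (N <= 16 * lam ^ 2)%N ->
  (lam * S1.*2 <= lam * N + 3 * m * N)%N -> (N <= S1 + S2 + m)%N ->
  (S2 <= S1)%N -> ((S1 - S2) ^ 2 <= 169 * (m ^ 2 * N))%N.
Proof.
move=> m0 mN l0 lN Nl h1 h2 h12; set D := (S1 - S2)%N.
have h : (16 * (lam * m) <= N)%N.
  rewrite -leq_sqr; apply: (@leq_trans ((4 * lam ^ 2) * (64 * m ^ 2))); last by rewrite -mulnn leq_mul.
  by rewrite !expnMn; lia.
have hD : (lam * D <= 3 * m * N + lam * m)%N.
  have : (lam * (D + N) <= lam * (S1.*2 + m))%N by rewrite leq_mul2l; apply/orP; right; rewrite /D; lia.
  by move: h1; rewrite !mulnDr; lia.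
have hN : (N <= m * N)%N by rewrite leq_pmull.
have hD2 : (16 * (lam * D) <= 49 * (m * N))%N by lia.
have : ((16 * (lam * D)) ^ 2 <= (49 * (m * N)) ^ 2)%N by rewrite leq_sqr.
have : ((m * N) ^ 2 <= m ^ 2 * N * (16 * lam ^ 2))%N.
  by rewrite expnMn -[(N ^ 2)%N]mulnn mulnA leq_mul2l Nl orbT.
rewrite !expnMn => e1 e2.
have : (lam ^ 2 * (16 * D ^ 2) <= lam ^ 2 * (2401 * (m ^ 2 * N)))%N by lia.
rewrite leq_pmul2l ?expn_gt0 ?l0 // => e3; lia.
Qed.

Lemma stepanov_neq0 (f : {poly K}) (m := (size f).-1) :
  (0 < m)%N -> (64 * m ^ 2 <= Q)%N -> f.[0] != 0 ->
  (forall (r s : {poly K}) (e : K), r ^+ 2 * f = e *: s ^+ 2 -> r = 0) ->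
  (\sum_x chi f.[x]) ^+ 2 <= 169 * (m ^ 2)%:R * Q%:R.
Proof.
move=> m0 mQ f0 nsq; have [|lam l0 [l1 l2]] := @sqrt_quarter Q.
  by apply: leq_trans mQ; case: (m) m0 => // k _; rewrite -mulnn; lia.
have fn0 : f != 0 by apply: contraNneq f0 => ->; rewrite horner0.
have b1 := card_value_bound m0 mQ l0 l1 f0 nsq (oner_neq0 K).
have N10 : (-1 : K) != 0 by rewrite oppr_eq0 oner_eq0.
have b2 := card_value_bound m0 mQ l0 l1 f0 nsq N10.
have b3 := card_value_lower fn0.
rewrite sum_chi_ind; move: b1 b2 b3; rewrite -/m.
set S1 := #|_|; set S2 := #|_| => b1 b2 b3.
wlog h : S1 S2 b1 b2 b3 / (S2 <= S1)%N.
  move=> H; case: (leqP S2 S1) => h; first exact: H.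
  rewrite -sqrrN opprB; apply: H => //; [by rewrite (addnC S2) | exact: ltnW].
have := stepanov_combine m0 mQ l0 l1 l2 b1 b3 h.
by rewrite -(ler_nat int) natrX natrB // natrM [X in _ * X]natrM mulrA.
Qed.

(* Weil's bound for y^2 = f(x), up to the constant. *)
Lemma stepanov (f : {poly K}) (m := (size f).-1) : (0 < m)%N ->
  (forall (r s : {poly K}) (e : K), r ^+ 2 * f = e *: s ^+ 2 -> r = 0) ->
  (\sum_x chi f.[x]) ^+ 2 <= 169 * (m ^ 2)%:R * Q%:R.
Proof.
move=> m0 nsq; case: (leqP (64 * m ^ 2) Q) => [mQ|Qm]; last first.
  (* Here Q < 64 m^2, and the trivial bound Q for the sum suffices. *)
  have h : `|\sum_x chi f.[x]| <= Q%:R.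
    apply: le_trans (ler_norm_sum _ _ _) _.
    by rewrite -sum1_card natr_sum; apply: ler_sum => x _; exact: abs_chi_le1.
  rewrite -real_normK ?num_real //.
  have : `|\sum_x chi f.[x]| ^+ 2 <= Q%:R ^+ 2 by rewrite lerXn2r ?nnegrE // ler0n.
  move/le_trans; apply; rewrite expr2 ler_wpM2r ?ler0n //.
  by rewrite -natrM ler_nat; apply: leq_trans (ltnW Qm) _; rewrite leq_mul2r orbT.
have fn0 : f != 0 by apply: contraTneq m0 => e; rewrite /m e size_poly0.
(* Since Q exceeds the degree of f, some point is not a root; a translation moves it to 0. *)
have [b fb] : exists b, f.[b] != 0.
  case: (pickP (fun b => f.[b] != 0)) => [b fb|H]; first by exists b.
  have := @max_poly_roots _ f (enum K) fn0; rewrite enum_uniq => H'; have {}H' := H' _ isT.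
  have : (size (enum K) < size f)%N.
    by apply: H'; apply/allP => x _; rewrite rootE; have /negbFE := H x.
  rewrite -cardE => h; have : (64 * m ^ 2 < m.+1)%N by apply: leq_ltn_trans mQ _; rewrite /m prednK // lt0n size_poly_eq0.
  rewrite -mulnn; nia.
pose g := f \Po ('X + b%:P).
have sg : size g = size f by rewrite /g size_comp_poly2 // size_XaddC.
have -> : \sum_x chi f.[x] = \sum_x chi g.[x].
  rewrite (reindex (fun x => x + b)); last first.
    by exists (fun x => x - b) => x _; rewrite ?addrK ?subrK.
  by apply: eq_bigr => x _; rewrite /g horner_comp !hornerE.
rewrite /m -sg; apply: stepanov_neq0; rewrite ?sg //.
  by rewrite /g horner_comp hornerD hornerX hornerC add0r.
move=> r s e E.
have : (r \Po ('X - b%:P)) ^+ 2 * f = e *: (s \Po ('X - b%:P)) ^+ 2.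
  have := congr1 (comp_poly ('X - b%:P)) E.
  rewrite /g rmorphM /= rmorphXn /= -comp_polyA comp_polyD comp_polyX comp_polyC subrK comp_polyXr.
  by move=> ->; rewrite comp_polyZ rmorphXn.
move=> /nsq r0.
have : (r \Po ('X - b%:P)) \Po ('X + b%:P) = 0 by rewrite r0 comp_poly0.
by rewrite -comp_polyA comp_polyB comp_polyX comp_polyC addrK comp_polyXr.
Qed.

End Bound.
End FinField.

(** * Cardinality of the extension of degree n *)

Section Extension.
Variables (F : finFieldType) (n : nat).
Hypothesis n_gt0 : (0 < n)%N.
Local Notation q := #|F|.
Local Notation E := (finvect_type (Fext F n)).

(** X^(q^n) - X has derivative -1, so its q^n roots are distinct. They are the fixed points of the
    n-th power of the Frobenius generator, hence form a subfield, and this is everything because the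
    roots generate. *)
Lemma card_Fext : #|E| = (q ^ n)%N.
Proof.
have q1 : (1 < q)%N := finNzRing_gt1 F.
have m1 : (1 < q ^ n)%N by rewrite -(expn0 q) ltn_exp2l.
pose L := Fext F n.
pose p (R : nzRingType) : {poly R} := 'X^(q ^ n) - 'X.
have splitLp : splittingFieldFor 1 (p L) {:L}.
  have := svalP (FinSplittingFieldFor (frobenius_poly_neq0 F n)).
  by rewrite -/(Fext F n) /= rmorphB rmorphXn /= map_polyX (maxn_idPr n_gt0).
have {splitLp} [zs DpL defL] := splitLp.
have qL : (q%:R : L) = 0.
  have [r [k [pr_r rF k0 ->]]] := card_pchar_pow F.
  have rL : r \in [pchar L] by rewrite pchar_lalg.
  by rewrite -(prednK k0) expnS natrM (pcharf0 rL) mul0r.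
have Uzs : uniq zs.
  rewrite -separable_prod_XsubC -(eqp_separable DpL) separable_poly.unlock.
  have mL : ((q ^ n)%:R : L) = 0 by rewrite natrX qL expr0n gtn_eqF.
  rewrite /p derivB derivXn derivX -mulr_natr -polyC_natr mL polyC0 mulr0 sub0r.
  by rewrite coprimep_sym -scaleN1r coprimepZl ?oppr_eq0 ?oner_eq0 // coprime1p.
have /finField_galois_generator [/= a _ Da] : (1 <= {:L})%VS by exact: sub1v.
pose Em := fixedSpace (a ^+ n)%g; rewrite dimv1 expn1 in Da.
have in_zs : zs =i Em.
  move=> z; rewrite -root_prod_XsubC -(eqp_root DpL) (sameP fixedSpaceP eqP).
  rewrite /root !hornerE subr_eq0 /=; congr (_ == z).
  elim: (n) => [|i IHi]; first by rewrite gal_id.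
  by rewrite expgSr expnSr exprM IHi galM ?Da ?memvf.
have defEm : Em = {:L}%VS.
  apply/eqP; rewrite eqEsubv subvf -defL -[Em]subfield_closed agenvS //.
  by rewrite subv_add sub1v; apply/span_subvP=> z; rewrite in_zs.
have -> : #|E| = size zs.
  have <- : #|(zs : seq E)| = size zs by exact/card_uniqP.
  by apply: eq_card => z; rewrite [RHS]in_zs defEm memvf.
apply: succn_inj.
rewrite -(size_prod_XsubC _ id) -(eqp_size DpL) size_polyDl size_polyXn //.
by rewrite size_polyN size_polyX ltnS.
Qed.

End Extension.

(** * Euler's criterion and the number of square roots *)

Section Squares.
Variable K : finFieldType.
Local Notation Q := #|K|.
Hypothesis Q_odd : odd Q.
Local Notation c := (Q.-1)./2.

Lemma card_expf_eq (a : K) : (#|[set x : K | x ^+ c == a]| <= c)%N.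
Proof.
have c0 := half_card_gt0 Q_odd.
have p0 : 'X^c - a%:P != 0 :> {poly K} by rewrite -size_poly_gt0 size_XnsubC.
have := @max_poly_roots _ _ (enum [set x : K | x ^+ c == a]) p0.
rewrite size_XnsubC // enum_uniq cardE => H; rewrite -ltnS; apply: H => //.
by apply/allP => x; rewrite mem_enum inE rootE !hornerE subr_eq0.
Qed.

Lemma card_sqrt_eq2 (y : K) : y != 0 -> #|[set z | z ^+ 2 == y ^+ 2]| = 2.
Proof.
move=> y0; have -> : [set z | z ^+ 2 == y ^+ 2] = [set y; - y].
  by apply/setP => z; rewrite !inE eqf_sqr.
have yN : y != - y by rewrite -subr_eq0 opprK -mulr2n -mulr_natl mulf_neq0 // two_neq0.
by rewrite cards2 yN.
Qed.

(** Squaring is two-to-one on the units, so there are c nonzero squares. All are roots of X^c - 1,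
    which has at most c roots; hence the roots are exactly the squares. *)
Lemma card_sqrt (a : K) : #|[set y | y ^+ 2 == a]|%:R = 1 + chi a.
Proof.
have c0 := half_card_gt0 Q_odd.
pose S := [set y ^+ 2 | y in [set~ (0 : K)]].
pose T := [set x : K | x ^+ c == 1].
have sST : S \subset T.
  apply/subsetP => x /imsetP [y]; rewrite !inE => y0 ->.
  rewrite -exprM mul2n; apply/eqP/(mulfI y0).
  by rewrite mulr1 -exprS -half_card // expf_card.
have cS : (#|S| = c)%N.
  have : (\sum_(x in S) 2 = Q.-1)%N.
    rewrite -(cardsC1 (0 : K)) -sum1_card.
    rewrite [RHS](partition_big_imset (fun y : K => y ^+ 2)) /= -/S.
    apply: eq_bigr => x /imsetP [y]; rewrite !inE => y0 ->.
    transitivity #|[set z | z ^+ 2 == y ^+ 2]|; first by rewrite card_sqrt_eq2.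
    rewrite -sum1dep_card; apply: eq_bigl => z.
    rewrite !inE andbC; case: eqP => [e|] //=; apply/esym.
    by apply: contraNneq y0 => z0; move: e; rewrite z0 expr0n => /esym/eqP; rewrite expf_eq0.
  by rewrite sum_nat_const muln2 => <-; rewrite doubleK.
have ST : S = T.
  by apply/eqP; rewrite eqEcard sST cS card_expf_eq.
rewrite /chi; case: eqP => [->|/eqP a0].
  rewrite addr0 (_ : [set y | _] = [set 0]) ?cards1 //.
  by apply/setP => y; rewrite !inE expf_eq0.
have : (a \in S) = (a ^+ c == 1) by rewrite ST inE.
case: (a ^+ c == 1) => [/idP/imsetP [y]|].
  by rewrite !inE => y0 ->; rewrite card_sqrt_eq2.
move=> /negbT aS; rewrite (_ : [set y | _] = set0) ?cards0 //.
apply/setP => y; rewrite !inE; apply/eqP => e; case/negP: aS.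
apply/imsetP; exists y => //; rewrite !inE; apply: contraNneq a0 => y0.
by rewrite -e y0 expr0n.
Qed.

End Squares.

(** * Traces of Frobenius as character sums *)

Section LogDeriv.
Variable C : numFieldType.
Implicit Types (f g s t h : {poly C}).

(* Modulo X^M, s is the logarithmic derivative X f'/f. *)
Definition logderiv M f s : Prop := 'X^M %| 'X * f^`() - s * f.

Lemma logderiv1 M : logderiv M 1 0.
Proof. by rewrite /logderiv derivC mulr0 mul0r subrr dvdp0. Qed.

Lemma logderivM M f g s t :
  logderiv M f s -> logderiv M g t -> logderiv M (f * g) (s + t).
Proof.
move=> hf hg; rewrite /logderiv derivM.
have -> : 'X * (f^`() * g + f * g^`()) - (s + t) * (f * g) =
  ('X * f^`() - s * f) * g + f * ('X * g^`() - t * g) by ring.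
by apply: dvdp_add; [apply: dvdp_mulr | apply: dvdp_mull].
Qed.

Lemma logderiv_prod M (I : Type) (r : seq I) (f s : I -> {poly C}) :
  (forall i, logderiv M (f i) (s i)) ->
  logderiv M (\prod_(i <- r) f i) (\sum_(i <- r) s i).
Proof.
move=> H; elim: r => [|i r IH]; first by rewrite !big_nil; exact: logderiv1.
by rewrite !big_cons; apply: logderivM.
Qed.

Lemma logderiv_1sub M (a : C) : (0 < M)%N ->
  logderiv M (1 - a *: 'X) (- \sum_(1 <= k < M) a ^+ k *: 'X^k).
Proof.
move=> M0; rewrite /logderiv.
have e : (\sum_(1 <= k < M) a ^+ k *: 'X^k) * (1 - a *: 'X) = a *: 'X - a ^+ M *: 'X^M.
  case: M M0 => // M _; elim: M => [|M IH].
    by rewrite big_geq // mul0r expr1 subrr.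
  rewrite big_nat_recr //= mulrDl IH !mulrBr !mulr1 -scalerAl -scalerAr scalerA -exprSr -exprSr.
  by rewrite addrA subrK.
have -> : 'X * (1 - a *: 'X)^`() - (- \sum_(1 <= k < M) a ^+ k *: 'X^k) * (1 - a *: 'X) = - a ^+ M *: 'X^M.
  rewrite mulNr opprK e derivB derivC derivZ derivX sub0r mulrN -scalerAr mulr1.
  by rewrite addrA addNr add0r scaleNr.
by rewrite -mul_polyC dvdp_mull.
Qed.

Lemma logderiv_congr M f g s : 'X^M %| f - g -> logderiv M f s -> logderiv M g s.
Proof.
move=> /dvdpP [h eh] hf; rewrite /logderiv.
have -> : g = f - h * 'X^M by rewrite -eh; ring.
have -> : 'X * (f - h * 'X^M)^`() - s * (f - h * 'X^M) =
  ('X * f^`() - s * f) - ('X * h^`() * 'X^M + h * ('X * ('X^M)^`()) - s * h * 'X^M).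
  rewrite derivB derivM; ring.
apply: dvdp_sub => //; apply: dvdp_sub; last exact: dvdp_mull.
apply: dvdp_add; apply: dvdp_mull => //.
by case: M {eh hf} => [|M]; rewrite ?dvd1p // derivXn mulrnAr -exprS -scaler_nat -mul_polyC dvdp_mull.
Qed.

(** A polynomial with nonzero constant coefficient is invertible modulo X^M. *)
Lemma logderiv_unique M f s t i : f`_0 != 0 -> logderiv M f s -> logderiv M f t ->
  (i < M)%N -> s`_i = t`_i.
Proof.
move=> f0 hs ht iM.
have : 'X^M %| (s - t) * f.
  have -> : (s - t) * f = ('X * f^`() - t * f) - ('X * f^`() - s * f) by ring.
  exact: dvdp_sub.
rewrite Gauss_dvdpl; last first.
  by apply: coprimep_expl; rewrite -['X]subr0 -polyC0 coprimep_sym coprimep_XsubC rootE horner_coef0.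
move=> /dvdpP [h /(congr1 (fun p : {poly C} => p`_i))].
by rewrite coefB coefMXn iM => /eqP; rewrite subr_eq0 => /eqP.
Qed.

Definition exp_trunc M (S : {poly C}) : {poly C} := \sum_(k < M) (k`!%:R)^-1 *: S ^+ k.

(** Differentiation loses only the last term of the truncated series, and X times that term is
    divisible by X^M because X divides S. *)
Lemma logderiv_exp M S : 'X %| S -> logderiv M (exp_trunc M S) ('X * S^`()).
Proof.
move=> XS; rewrite /logderiv /exp_trunc.
have -> : (\sum_(k < M) (k`!%:R)^-1 *: S ^+ k)^`() =
    S^`() * (\sum_(k < M.-1) (k`!%:R)^-1 *: S ^+ k).
  rewrite raddf_sum /=; case: M => [|M]; first by rewrite !big_ord0 mulr0.
  rewrite big_ord_recl /= expr0 derivZ derivC scaler0 add0r mulr_sumr.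
  apply: eq_bigr => k _; rewrite derivZ deriv_exp /bump /= add1n.
  rewrite -scaler_nat scalerA -scalerAr; congr (_ *: _).
  by rewrite factS natrM invfM mulrAC mulVf ?pnatr_eq0 // mul1r.
case: M => [|M]; first by rewrite dvd1p.
rewrite big_ord_recr /=; set T := \sum_(_ < _) _.
have -> : 'X * (S^`() * T) - 'X * S^`() * (T + (M`!%:R)^-1 *: S ^+ M) =
  - (M`!%:R)^-1%:P * S^`() * ('X * S ^+ M) by rewrite -mul_polyC; ring.
by apply: dvdp_mull; rewrite exprS dvdp_mul // dvdp_exp2r.
Qed.

End LogDeriv.

Section Diagonal.
Variables (C : fieldType) (m : nat) (U A : 'M[C]_m) (d : 'rV[C]_m).
Hypothesis unitU : U \in unitmx.
Hypothesis defA : A = invmx U *m diag_mx d *m U.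

Lemma trace_expr_diag k : \tr (A ^+ k) = \sum_i d 0 i ^+ k.
Proof.
have -> : A ^+ k = invmx U *m diag_mx (\row_i d 0 i ^+ k) *m U.
  elim: k => [|k IH].
    rewrite (_ : diag_mx _ = 1%:M) ?mulmx1 ?mulVmx // -diag_const_mx; congr diag_mx.
    by apply/rowP => i; rewrite !mxE.
  rewrite exprS IH {1}defA -[_ * _]/(_ *m _) !mulmxA mulmxK //; congr (_ *m _).
  rewrite -!mulmxA; congr (_ *m _); rewrite mulmx_diag; congr diag_mx.
  by apply/rowP => i; rewrite !mxE exprS.
rewrite mxtrace_mulC mulmxA mulmxV // mul1mx mxtrace_diag.
by apply: eq_bigr => i _; rewrite mxE.
Qed.

Lemma det_1sub_diag :
  \det (1%:M - 'X *: map_mx polyC A) = \prod_i (1 - d 0 i *: 'X).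
Proof.
pose V := map_mx polyC U.
have uV : map_mx polyC (invmx U) *m V = 1%:M by rewrite -map_mxM mulVmx // map_mx1.
have -> : 1%:M - 'X *: map_mx polyC A =
  map_mx polyC (invmx U) *m diag_mx (\row_i (1 - d 0 i *: 'X)) *m V.
  have -> : diag_mx (\row_i (1 - d 0 i *: 'X)) = 1%:M - 'X *: map_mx polyC (diag_mx d).
    apply/matrixP => i j; rewrite !mxE; case: eqP => [->|] /=; rewrite ?mulr1n ?mulr0n.
      by rewrite mulrC mul_polyC.
    by rewrite polyC0 mulr0 subr0.
  rewrite mulmxBr mulmxBl mulmx1 uV; congr (_ - _).
  by rewrite -scalemxAr -scalemxAl; congr (_ *: _); rewrite defA !map_mxM.
rewrite !det_mulmx mulrAC -det_mulmx uV det1 mul1r det_diag.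
by apply: eq_bigr => i _; rewrite mxE.
Qed.

End Diagonal.

Lemma scale_diag (C : fieldType) m (U T : 'M[C]_m) (d : 'rV[C]_m) (s : C) :
  T = invmx U *m diag_mx d *m U -> s *: T = invmx U *m diag_mx (s *: d) *m U.
Proof.
move=> ->; rewrite scalemxAl scalemxAr; congr (_ *m _).
by congr (_ *m _); apply/matrixP => i j; rewrite !mxE mulrnAr.
Qed.

Section Trace.
Variable F : finFieldType.
Local Notation q := #|F|.
Local Notation ext n := (finvect_type (Fext F n)).

Definition char_sum (n : nat) (Q : {poly F}) : int :=
  \sum_(x : ext n) chi (map_poly (in_alg (ext n)) Q).[x].

(** There is a single point at infinity: [Q] has degree 2g + 1, so its coefficient of degree 2g + 2,
    which is the value of the second chart at t = 0, is zero. *)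
Lemma num_pointsE g (Q : {poly F}) n : odd q -> size Q = (2 * g).+2 -> (0 < n)%N ->
  (num_points g Q n)%:R = 1 + (q ^ n)%:R + char_sum n Q :> int.
Proof.
move=> q_odd sQ n0; pose E := ext n; have cE : #|E| = (q ^ n)%N := card_Fext F n0.
have E_odd : odd #|E| by rewrite cE oddX q_odd orbT.
rewrite /num_points natrD; set toE := map_poly _.
have -> : #|[set a : E * E | (a.1 == 0) && (a.2 ^+ 2 == (toE (infinity_chart g Q)).[a.1])]| = 1.
  apply/eqP/cards1P; exists (0, 0); apply/setP => -[a b]; rewrite !inE /= xpair_eqE.
  case: eqP => //= ->; rewrite horner_coef0 /toE coef_map /= /infinity_chart coef_poly /= subn0.
  by rewrite nth_default ?sQ // scale0r expf_eq0.
rewrite addrC -addrA; congr (_ + _).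
transitivity (\sum_(x : E) (#|[set y : E | y ^+ 2 == (toE Q).[x]]|%:R : int)).
  rewrite -sum1dep_card natr_sum -(pair_big_dep xpredT (fun x y => y ^+ 2 == (toE Q).[x]) (fun _ _ => 1%:R)) /=.
  by apply: eq_bigr => x _; rewrite -sum1dep_card natr_sum.
rewrite -cE -sum1_card natr_sum -big_split /=.
by apply: eq_bigr => x _; rewrite card_sqrt.
Qed.

Section Zeta.
Variables (g : nat) (Q : {poly F}).

Definition log_zeta N : {poly rat} :=
  \sum_(1 <= n < N.+1) ((num_points g Q n)%:R / n%:R) *: 'X^n.

Lemma dvdX_log_zeta N : 'X %| log_zeta N.
Proof.
rewrite /log_zeta big_nat; apply: (big_ind (fun p => 'X %| p)) => [|p r|n /andP [n0 _]].
- exact: dvdp0.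
- exact: dvdp_add.
by rewrite -mul_polyC -(prednK n0) exprS dvdp_mull // dvdp_mulr.
Qed.

Lemma deriv_log_zeta N :
  'X * (log_zeta N)^`() = \sum_(1 <= n < N.+1) (num_points g Q n)%:R *: 'X^n.
Proof.
rewrite /log_zeta raddf_sum /= mulr_sumr !big_nat; apply: eq_bigr => n /andP [n0 _].
rewrite derivZ derivXn -scaler_nat scalerA -scalerAr -exprS prednK //.
by rewrite divfK // pnatr_eq0 -lt0n.
Qed.

Lemma zeta_coefE N m : (m <= N)%N -> zeta_coef g Q m = (exp_trunc N.+1 (log_zeta N))`_m.
Proof.
move=> mN; rewrite /zeta_coef -/(log_zeta m) -/(exp_trunc m.+1 (log_zeta m)).
suff : 'X^(m.+1) %| exp_trunc N.+1 (log_zeta N) - exp_trunc m.+1 (log_zeta m).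
  move=> /dvdpP [h /(congr1 (fun p : {poly rat} => p`_m))].
  by rewrite coefB coefMXn ltnSn => /eqP; rewrite subr_eq0 => /eqP.
have dS : 'X^(m.+1) %| log_zeta N - log_zeta m.
  rewrite /log_zeta (@big_cat_nat _ _ _ m.+1) //= addrAC subrr add0r big_nat.
  apply: (big_ind (fun p => 'X^(m.+1) %| p)) => [|p r|n /andP [n0 _]].
  - exact: dvdp0.
  - exact: dvdp_add.
  by rewrite -mul_polyC dvdp_mull // dvdp_exp2l.
rewrite /exp_trunc -(big_mkord xpredT (fun k => (k`!%:R)^-1 *: log_zeta N ^+ k)).
rewrite (@big_cat_nat _ _ _ m.+1) //= big_mkord addrAC.
apply: dvdp_add.
  rewrite -sumrB; apply: (big_ind (fun p => 'X^(m.+1) %| p)) => [|p r|n _].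
  - exact: dvdp0.
  - exact: dvdp_add.
  by rewrite -scalerBr subrXX -mul_polyC dvdp_mull // dvdp_mulr.
rewrite big_nat; apply: (big_ind (fun p => 'X^(m.+1) %| p)) => [|p r|n /andP [n0 _]].
- exact: dvdp0.
- exact: dvdp_add.
rewrite -mul_polyC dvdp_mull //; apply: (dvdp_trans (dvdp_exp2l 'X n0)).
by apply: dvdp_exp2r; exact: dvdX_log_zeta.
Qed.

(** The logarithmic derivative undoes the exponential: the zeta function contributes the point
    counts, and the factors 1 - u and 1 - q u contribute -1 and -q^n. *)
Lemma logderiv_zeta_numerator (P : {poly int}) N : zeta_numerator g Q P ->
  logderiv N.+1 (map_poly intr P : {poly rat})
    (\sum_(1 <= n < N.+1) ((num_points g Q n)%:R - 1 - q%:R ^+ n) *: 'X^n).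
Proof.
move=> [_ HP].
apply: (@logderiv_congr _ _ ((1 - 1 *: 'X) * (1 - q%:R *: 'X) * exp_trunc N.+1 (log_zeta N))).
  set D := _ - _.
  have -> : D = drop_poly N.+1 D * 'X^(N.+1).
    rewrite -[LHS](poly_take_drop N.+1).
    suff -> : take_poly N.+1 D = 0 by rewrite add0r.
    apply/polyP => m; rewrite coef_take_poly coef0; case: ltnP => // mN.
    rewrite /D coefB coefM coef_map /= scale1r -HP; apply/eqP; rewrite subr_eq0; apply/eqP.
    apply: eq_bigr => i _; congr (_ * _); rewrite (zeta_coefE (N := N)) //.
    by apply: leq_trans (leq_subr _ _) _.
  exact: dvdp_mulIr.
have -> : \sum_(1 <= n < N.+1) ((num_points g Q n)%:R - 1 - q%:R ^+ n) *: 'X^n =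
  - \sum_(1 <= n < N.+1) 1 ^+ n *: 'X^n + - \sum_(1 <= n < N.+1) q%:R ^+ n *: 'X^n +
  'X * (log_zeta N)^`() :> {poly rat}.
  rewrite deriv_log_zeta -!sumrN -!big_split /=; apply: eq_bigr => n _.
  by rewrite !scalerBl expr1n; ring.
apply: logderivM; first by apply: logderivM; exact: logderiv_1sub.
by apply: logderiv_exp; exact: dvdX_log_zeta.
Qed.

End Zeta.

(** Two logarithmic derivatives of P are compared: one from the eigenvalues of sqrt(q) [Theta],
    which is diagonalizable because [Theta] is unitary, and one from the point counts. *)
Lemma trace_char_sum (R : realType) g (Q : {poly F}) (Theta : 'M[R[i]]_(2 * g)) n :
  odd q -> size Q = (2 * g).+2 -> (0 < n)%N -> unitarized_Frobenius Q Theta ->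
  (Num.sqrt q%:R)%:C ^+ n * \tr (Theta ^+ n) = - (char_sum n Q)%:~R.
Proof.
move=> q_odd sQ n0 [uTheta [P [HP detP]]].
set s := (Num.sqrt q%:R)%:C.
have nTheta : Theta \is normalmx.
  by apply/normalmxP; have := unitarymxP uTheta; rewrite -invmx_unitary // => _;
     rewrite mulmxV ?mulVmx // unitarymx_unit.
have defT := orthomx_spectralP nTheta.
have := spectral_unit Theta; move: defT.
move: (spectralmx Theta) (spectral_diag Theta) => U sp defT uU.
have defA := scale_diag s defT; rewrite -/s in detP.
set d := s *: sp in defA.
have -> : s ^+ n * \tr (Theta ^+ n) = \sum_i d 0 i ^+ n.
  rewrite (trace_expr_diag uU defT) mulr_sumr; apply: eq_bigr => i _.
  by rewrite /d mxE exprMn.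
have L1 : logderiv n.+1 (map_poly intr P : {poly R[i]})
    (\sum_i - \sum_(1 <= k < n.+1) d 0 i ^+ k *: 'X^k).
  rewrite detP (det_1sub_diag uU defA); apply: logderiv_prod => i; exact: logderiv_1sub.
have L2 := logderiv_zeta_numerator n HP.
set S := \sum_(1 <= k < n.+1) _ in L2.
have {}L2 : logderiv n.+1 (map_poly intr P : {poly R[i]}) (map_poly ratr S).
  move: L2; rewrite /logderiv -(dvdp_map (ratr : rat -> R[i])) map_polyXn rmorphB !rmorphM /=.
  rewrite map_polyX -deriv_map -map_poly_comp.
  by rewrite (eq_map_poly (g := intr)) // => z /=; rewrite ratr_int.
have P0 : (map_poly intr P : {poly R[i]})`_0 != 0.
  rewrite detP (det_1sub_diag uU defA) -horner_coef0 horner_prod.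
  by apply/prodf_neq0 => i _; rewrite horner_coef0 coefB coef1 coefZ coefX mulr0 subr0 oner_eq0.
have := logderiv_unique P0 L1 L2 (ltnSn n).
have cf (V : nzRingType) (h : nat -> V) : (\sum_(1 <= k < n.+1) h k *: 'X^k)`_n = h n.
  rewrite coef_sum (bigD1_seq n) ?mem_index_iota ?iota_uniq ?n0 ?ltnSn //=.
  rewrite coefZ coefXn eqxx mulr1 big1_seq ?addr0 // => k /andP [kn _].
  by rewrite coefZ coefXn eq_sym (negbTE kn) mulr0.
have -> : (\sum_i - \sum_(1 <= k < n.+1) d 0 i ^+ k *: 'X^k)`_n = - \sum_i d 0 i ^+ n.
  by rewrite coef_sum -sumrN; apply: eq_bigr => i _; rewrite coefN cf.
rewrite coef_map /= cf.
move/eqP; rewrite eqr_oppLR => /eqP ->; congr (- _).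
rewrite -(ratr_int _ (char_sum n Q)); congr ratr.
have E := num_pointsE q_odd sQ n0; move: (num_points g Q n) E => np E.
rewrite -(@rmorph_nat int rat intr np) E !rmorphD rmorph1 rmorph_nat natrX; ring.
Qed.

End Trace.

(** * Square-free and monic polynomials at a point *)

Section Monics.
Variable F : finFieldType.
Local Notation q := #|F|.
Implicit Types (A B D p r : {poly F}).

Definition polys k : seq {poly F} := [seq val v | v <- enum {: {poly_k F}}].

Lemma mem_polys k p : (p \in polys k) = (size p <= k)%N.
Proof.
apply/mapP/idP => [[v _ ->]|h]; first exact: size_npoly.
by exists (npolyp k p); rewrite ?mem_enum // [RHS]npolypK.
Qed.

Lemma polys_uniq k : uniq (polys k).
Proof. by rewrite map_inj_uniq ?enum_uniq //; exact: val_inj. Qed.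

Lemma size_polys k : size (polys k) = (q ^ k)%N.
Proof. by rewrite size_map -cardE card_npoly. Qed.

Definition monics k : seq {poly F} := [seq 'X^k + p | p <- polys k].

Lemma mem_monics k p : (p \in monics k) = (p \is monic) && (size p == k.+1).
Proof.
apply/mapP/andP => [[r]|[pm /eqP sp]].
  rewrite mem_polys => sr ->.
  have s : size ('X^k + r) = k.+1 by rewrite size_polyDl size_polyXn.
  by rewrite monicE lead_coefDl ?size_polyXn // lead_coefXn s !eqxx.
exists (p - 'X^k); last by rewrite addrC subrK.
rewrite mem_polys; apply/leq_sizeP => j kj; rewrite coefB coefXn.
case: (ltngtP k j) kj => // [kj|<-] _; first by rewrite nth_default ?sp // subrr.
by move: pm; rewrite monicE lead_coefE sp => /eqP ->; rewrite subrr.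
Qed.

Lemma monics_uniq k : uniq (monics k).
Proof. by rewrite map_inj_uniq ?polys_uniq //; exact: addrI. Qed.

Lemma size_monics k : size (monics k) = (q ^ k)%N.
Proof. by rewrite size_map size_polys. Qed.

Lemma polys_shift (V : nmodType) k r (f : {poly F} -> V) : (size r <= k)%N ->
  \sum_(p <- polys k) f (p + r) = \sum_(p <- polys k) f p.
Proof.
move=> sr; rewrite -(big_map (fun p => p + r) xpredT f); apply: perm_big.
apply: uniq_perm; rewrite ?polys_uniq //.
  by rewrite map_inj_uniq ?polys_uniq //; exact: addIr.
move=> p; rewrite mem_polys; apply/mapP/idP => [[s]|sp].
  by rewrite mem_polys => h ->; rewrite (leq_trans (size_polyD _ _)) // geq_max h.
exists (p - r); last by rewrite subrK.
by rewrite mem_polys (leq_trans (size_polyD _ _)) // geq_max size_polyN sp.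
Qed.

Lemma monics_shift (V : nmodType) k r (f : {poly F} -> V) : (size r <= k)%N ->
  \sum_(p <- monics k) f (p + r) = \sum_(p <- monics k) f p.
Proof.
move=> sr; rewrite /monics [LHS]big_map [RHS]big_map.
rewrite -[RHS](polys_shift (fun p => f ('X^k + p)) sr).
by apply: eq_bigr => p _; rewrite addrA.
Qed.

Definition sqf k := [seq D <- monics k | `[< square_free D >]].

Lemma mem_sqf k D : (D \in sqf k) = `[< square_free D >] && (D \in monics k).
Proof. by rewrite mem_filter. Qed.

Lemma sqf_uniq k : uniq (sqf k).
Proof. by rewrite filter_uniq // monics_uniq. Qed.

Lemma monic_sqf_decomposition k B : B \in monics k ->
  exists a A D, [/\ (a.*2 <= k)%N, A \in monics a, D \in sqf (k - a.*2) & B = A ^+ 2 * D].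
Proof.
rewrite mem_monics => /andP [Bm /eqP sB].
have [m] := ubnP k; elim: m k B Bm sB => // m IH k B Bm sB; rewrite ltnS => km.
case: (asboolP (square_free B)) => [sf|nsf].
  exists 0, 1, B; rewrite subn0 expr1n mul1r; split=> //.
    by rewrite mem_monics monic1 size_poly1.
  by rewrite mem_sqf mem_monics Bm sB eqxx asboolT.
have [u su uB] : exists2 u : {poly F}, size u != 1 & u ^+ 2 %| B.
  have /existsNP [u /not_implyP [su /negP/negPn uB]] := nsf; by exists u.
have B0 : B != 0 by exact: monic_neq0.
have u0 : u != 0 by apply: contraNneq B0 => u0; move: uB; rewrite u0 expr0n dvd0p.
pose v := (lead_coef u)^-1 *: u.
have l0 : lead_coef u != 0 by rewrite lead_coef_eq0.
have vm : v \is monic by rewrite monicE lead_coefZ mulVf.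
have sv : size v = size u by rewrite size_scale // invr_eq0.
have vB : v ^+ 2 %| B by rewrite exprZn dvdpZl // expf_neq0 // invr_eq0.
have /dvdpP [C eC] := vB.
have v2m : v ^+ 2 \is monic by rewrite rpredX.
have Cm : C \is monic by rewrite -(monicMr _ v2m) -eC.
have su2 : (1 < size u)%N by move: su u0; rewrite -size_poly_eq0; case: (size u) => [|[]].
have sv2 : size (v ^+ 2) = ((size u).-1.*2).+1.
  have := size_exp v 2; rewrite sv muln2 => <-; rewrite prednK //.
  by rewrite size_poly_gt0 monic_neq0.
have sC : size C = (k - (size u).-1.*2).+1.
  have : size B = (size C + size (v ^+ 2)).-1 by rewrite eC size_mul ?monic_neq0.
  have : (0 < size C)%N by rewrite size_poly_gt0 monic_neq0.
  by rewrite sB sv2; move: (size C) ((size u).-1.*2) => x y; clear; lia.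
have h2 : ((size u).-1.*2 <= k)%N.
  by have := dvdp_leq B0 vB; rewrite sB sv2 ltnS.
have [|a [A [D [ak Am Dm eqC]]]] := IH _ C Cm sC.
  by move: km su2 h2; move: (size u) => x; clear; lia.
exists (a + (size u).-1)%N, (A * v), D; split.
- by move: ak h2; move: (size u) => x; clear; lia.
- move: Am; rewrite !mem_monics => /andP [Am /eqP sA]; rewrite rpredM //=.
  by by rewrite size_mul ?monic_neq0 // sA sv; apply/eqP; move: su2; move: (size u) => x; clear; lia.
- by rewrite doubleD addnC subnDA.
by rewrite eC eqC exprMn; ring.
Qed.

(** Let x and x' be the cofactors of the gcd of X and X'. Then x^2 divides x'^2 Y' and is prime to
    x', so it divides the square-free Y'. Hence x is constant and X divides X'; by symmetry A and A'
    divide each other. *)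
Lemma sqf_decomposition_unique A A' D D' : A \is monic -> A' \is monic ->
  D \is monic -> D' \is monic -> square_free D -> square_free D' ->
  A ^+ 2 * D = A' ^+ 2 * D' -> A = A' /\ D = D'.
Proof.
move=> Am A'm Dm D'm sD sD' e.
have dv (X X' Y Y' : {poly F}) : X \is monic -> X' \is monic -> square_free Y' ->
    X ^+ 2 * Y = X' ^+ 2 * Y' -> X %| X'.
  move=> Xm X'm sY e'.
  have X0 := monic_neq0 Xm; have g0 : gcdp X X' != 0 by rewrite gcdp_eq0 negb_and X0.
  pose g := gcdp X X'; pose x := X %/ g; pose x' := X' %/ g.
  have eX : X = x * g by rewrite divpK ?dvdp_gcdl.
  have eX' : X' = x' * g by rewrite divpK ?dvdp_gcdr.
  have cop : coprimep x x' by rewrite coprimep_div_gcd // X0.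
  have : x ^+ 2 %| Y'.
    have : x ^+ 2 * Y = x' ^+ 2 * Y'.
      have e1 : (x * g) ^+ 2 * Y = (x' * g) ^+ 2 * Y' by rewrite -eX -eX'.
      apply: (mulfI (expf_neq0 2 g0)); transitivity ((x * g) ^+ 2 * Y); first by rewrite /g; ring.
      by rewrite e1 /g; ring.
    move=> e2; have : x ^+ 2 %| x' ^+ 2 * Y' by rewrite -e2 dvdp_mulIl.
    by rewrite Gauss_dvdpr // coprimep_expl // coprimep_expr.
  case: (eqVneq (size x) 1) => [sx _|/sY/negP //].
  move/eqP: sx; rewrite size_poly_eq1 => /eqp_dvdl x1.
  rewrite eX; have := dvdp_gcdr X X'; rewrite -/g; apply: dvdp_trans.
  rewrite -[X in _ %| X]mul1r dvdp_mul2r //. by rewrite x1 dvdpp.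
have AA' : A = A'.
  have : A %= A' by rewrite /eqp (dv A A' D D') // (dv A' A D' D).
  by rewrite eqp_monic // => /eqP.
split=> //; move: e; rewrite AA' => /mulfI; apply.
by rewrite expf_neq0 // monic_neq0.
Qed.

Lemma sum_sqf_decomposition (V : nmodType) k (f : {poly F} -> V) :
  \sum_(B <- monics k) f B =
  \sum_(a < k./2.+1) \sum_(A <- monics a) \sum_(D <- sqf (k - a.*2)) f (A ^+ 2 * D).
Proof.
pose sA : seq {poly F} := [seq A | a <- iota 0 k./2.+1, A <- monics a].
pose s := [seq (A, D) | A <- sA, D <- sqf (k - (size A).-1.*2)].
pose m (x : {poly F} * {poly F}) := x.1 ^+ 2 * x.2.
have mem_sA A : (A \in sA) = (A \is monic) && ((size A).-1.*2 <= k)%N.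
  apply/allpairsPdep/andP => [[a [A' [ha hA ->]]]|[Am hA]].
    move: ha hA; rewrite mem_iota mem_monics /= => ha /andP [-> /eqP ->]; split=> //=.
    by rewrite -geq_half_double.
  exists (size A).-1, A; rewrite mem_iota mem_monics Am /= add0n ltnS geq_half_double hA.
  by split=> //; rewrite prednK // size_poly_gt0 monic_neq0.
have mem_s A D : ((A, D) \in s) = (A \in sA) && (D \in sqf (k - (size A).-1.*2)).
  apply/allpairsPdep/andP => [[A' [D' [hA hD [-> ->]]]] //|[hA hD]].
  by exists A, D.
have perm : perm_eq (monics k) [seq m x | x <- s].
  apply: uniq_perm; first exact: monics_uniq.
    rewrite map_inj_in_uniq.
      apply: allpairs_uniq_dep.
      - apply: allpairs_uniq_dep => [|a _|]; [exact: iota_uniq|exact: monics_uniq|].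
        move=> [a A] [a' A'] /allpairsPdep [a1 [A1 [_ h1 [-> ->]]]].
        move=> /allpairsPdep [a2 [A2 [_ h2 [-> ->]]]] /= e.
        move: h1 h2; rewrite !mem_monics e => /andP [_ /eqP ->] /andP [_ /eqP [->]] //.
      - by move=> A _; exact: sqf_uniq.
      by move=> [A D] [A' D'] _ _ [-> ->].
    move=> [A D] [A' D']; rewrite !mem_s !mem_sA !mem_sqf !mem_monics.
    move=> /andP [/andP [Am _] /andP [/asboolP sD /andP [Dm _]]].
    move=> /andP [/andP [A'm _] /andP [/asboolP sD' /andP [D'm _]]].
    by move=> /(sqf_decomposition_unique Am A'm Dm D'm sD sD') [-> ->].
  move=> B; apply/idP/mapP => [/monic_sqf_decomposition [a [A [D [ak hA hD ->]]]]|].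
    exists (A, D) => //; move: (hA); rewrite mem_s mem_sA mem_monics => /andP [-> /eqP ->].
    by rewrite /= ak.
  move=> [[A D]]; rewrite mem_s mem_sA mem_sqf !mem_monics /m /=.
  move=> /andP [/andP [Am ak] /andP [_ /andP [Dm /eqP sD]]] ->.
  rewrite rpredM ?rpredX //=.
  have s2 : size (A ^+ 2) = ((size A).-1.*2).+1.
    have := size_exp A 2; rewrite muln2 => <-; rewrite prednK //.
    by rewrite size_poly_gt0 expf_neq0 // monic_neq0.
  rewrite size_mul ?expf_neq0 ?monic_neq0 // s2 sD; apply/eqP; move: ak; move: (size A) => x; clear; lia.
rewrite (perm_big _ perm) big_map big_allpairs_dep big_allpairs_dep /=.
rewrite -(big_mkord xpredT (fun a => \sum_(A <- monics a) \sum_(D <- sqf (k - a.*2)) f (A ^+ 2 * D))).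
rewrite /index_iota subn0; apply: eq_bigr => a _.
by apply: eq_big_seq => A; rewrite mem_monics => /andP [_ /eqP ->].
Qed.

End Monics.

(** * Evaluation of polynomials at a point of a finite extension *)

Section Evaluation.
Variables (F E : finFieldType) (iota : {rmorphism F -> E}) (n : nat).
Local Notation q := #|F|.
Hypothesis n_gt0 : (0 < n)%N.
Hypothesis card_E : #|E| = (q ^ n)%N.
Implicit Types (A B P p r : {poly F}) (x y theta : E).

Definition ev theta B : E := (map_poly iota B).[theta].

Lemma evD theta : {morph ev theta : p r / p + r}.
Proof. by move=> p r; rewrite /ev rmorphD hornerD. Qed.

Lemma evB theta : {morph ev theta : p r / p - r}.
Proof. by move=> p r; rewrite /ev rmorphB !hornerE. Qed.

Lemma evM theta : {morph ev theta : p r / p * r}.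
Proof. by move=> p r; rewrite /ev rmorphM hornerM. Qed.

Lemma ev_exp theta p k : ev theta (p ^+ k) = ev theta p ^+ k.
Proof. by rewrite /ev rmorphXn horner_exp. Qed.

Lemma ev0 theta : ev theta 0 = 0.
Proof. by rewrite /ev rmorph0 horner0. Qed.

Lemma ev1 theta : ev theta 1 = 1.
Proof. by rewrite /ev rmorph1 hornerC. Qed.

Lemma evC theta a : ev theta a%:P = iota a.
Proof. by rewrite /ev map_polyC hornerC. Qed.

Lemma evX theta : ev theta 'X = theta.
Proof. by rewrite /ev map_polyX hornerX. Qed.

Lemma evZ theta a p : ev theta (a *: p) = iota a * ev theta p.
Proof. by rewrite -mul_polyC evM evC. Qed.

Lemma card_F_gt1 : (1 < q)%N.
Proof. exact: finNzRing_gt1. Qed.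

Lemma card_F_exp_gt1 k : (0 < k)%N -> (1 < q ^ k)%N.
Proof. by move=> k0; rewrite -[1%N](expn0 q) ltn_exp2l // card_F_gt1. Qed.

Lemma expD_cardF k x y : (x + y) ^+ (q ^ k) = x ^+ (q ^ k) + y ^+ (q ^ k).
Proof.
elim: k => [|k IH]; first by rewrite expn0 !expr1.
rewrite expnSr !exprM IH exprDn_pchar //.
by apply: card_pchar_nat => p; rewrite (fmorph_pchar iota).
Qed.

Lemma ev_frob theta B k : ev theta B ^+ (q ^ k) = ev (theta ^+ (q ^ k)) B.
Proof.
elim/poly_ind: B => [|B c IH].
  by rewrite !ev0 expr0n gtn_eqF // expn_gt0 ltnW ?card_F_gt1.
rewrite !evD !evM !evX !evC expD_cardF exprMn IH; congr (_ + _).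
elim: k {IH} => [|k IH]; first by rewrite expn0 expr1.
by rewrite expnSr exprM IH -rmorphXn expf_card.
Qed.

Lemma frobE_inj k : injective (fun x => x ^+ (q ^ k)).
Proof.
move=> x y e; apply/eqP; rewrite -subr_eq0; apply/eqP.
have h : (x - y) ^+ (q ^ k) + y ^+ (q ^ k) = x ^+ (q ^ k) by rewrite -expD_cardF subrK.
have : (x - y) ^+ (q ^ k) == 0 by rewrite -subr_eq0 subr0 -(addrK (y ^+ (q ^ k)) (_ ^+ _)) h e subrr.
by rewrite expf_eq0 => /andP [_ /eqP].
Qed.

Lemma frobE_n x : x ^+ (q ^ n) = x.
Proof. by rewrite -card_E expf_card. Qed.

Lemma fdeg_exists theta : exists d, (0 < d)%N && (theta ^+ (q ^ d) == theta).
Proof. by exists n; rewrite n_gt0 frobE_n eqxx. Qed.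

(* The degree of theta over F, as the period of theta under Frobenius. *)
Definition fdeg theta := ex_minn (fdeg_exists theta).

Lemma fdeg_gt0 theta : (0 < fdeg theta)%N.
Proof. by rewrite /fdeg; case: ex_minnP => d /andP []. Qed.

Lemma frob_fdeg theta : theta ^+ (q ^ fdeg theta) = theta.
Proof. by rewrite /fdeg; case: ex_minnP => d /andP [_ /eqP]. Qed.

Lemma fdeg_min theta k : (0 < k)%N -> theta ^+ (q ^ k) = theta -> (fdeg theta <= k)%N.
Proof. by rewrite /fdeg; case: ex_minnP => d _ H k0 e; apply: H; rewrite k0 e eqxx. Qed.

Lemma frob_mul theta d k : theta ^+ (q ^ d) = theta -> theta ^+ (q ^ (d * k)) = theta.
Proof. by move=> e; elim: k => [|k IH]; rewrite ?muln0 ?expr1 // mulnS expnD exprM e. Qed.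

Lemma fdeg_dvd theta k : (theta ^+ (q ^ k) == theta) = (fdeg theta %| k)%N.
Proof.
apply/eqP/idP => [e|/dvdnP [m ->]]; last by rewrite mulnC frob_mul // frob_fdeg.
have := e; rewrite {1}(divn_eq k (fdeg theta)) expnD exprM [(_ * fdeg _)%N]mulnC.
rewrite (frob_mul _ (frob_fdeg theta)) => e'.
rewrite /dvdn; case: posnP => // h.
by have := fdeg_min h e'; rewrite leqNgt ltn_mod fdeg_gt0.
Qed.

Lemma fdeg_dvd_n theta : (fdeg theta %| n)%N.
Proof. by rewrite -fdeg_dvd frobE_n. Qed.

Lemma card_roots_XqX k : (0 < k)%N -> (#|[set x : E | x ^+ (q ^ k) == x]| <= q ^ k)%N.
Proof.
move=> k0; have q1 := card_F_gt1.
have s : size ('X^(q ^ k) - 'X : {poly E}) = (q ^ k).+1.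
  by rewrite size_polyDl size_polyXn // size_polyN size_polyX ltnS card_F_exp_gt1.
have p0 : ('X^(q ^ k) - 'X : {poly E}) != 0 by rewrite -size_poly_gt0 s.
have := @max_poly_roots _ _ (enum [set x : E | x ^+ (q ^ k) == x]) p0.
rewrite s enum_uniq cardE => H; rewrite -ltnS; apply: H => //.
by apply/allP => x; rewrite mem_enum inE rootE !hornerE subr_eq0.
Qed.

(** Let k be the least degree of a monic polynomial vanishing at theta. Evaluation is injective in
    degrees < k and its values are fixed by the Frobenius power of exponent [fdeg theta], which
    gives k <= fdeg theta. Conversely the [fdeg theta] distinct conjugates of theta are roots. *)
Lemma minpoly_exists theta : exists P, [/\ P \is monic, size P = (fdeg theta).+1 &
  forall B, (ev theta B == 0) = (P %| B)].
Proof.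
have q1 := card_F_gt1.
have ex : exists k, has (fun B => ev theta B == 0) (monics F k).
  exists (q ^ n)%N; apply/hasP; exists ('X^(q ^ n) - 'X).
    rewrite mem_monics; have s : (size (- 'X : {poly F}) < size ('X^(q ^ n) : {poly F}))%N.
      by rewrite size_polyN size_polyX size_polyXn ltnS card_F_exp_gt1.
    by rewrite monicE lead_coefDl // lead_coefXn size_polyDl // size_polyXn !eqxx.
  by rewrite evB ev_exp evX frobE_n subrr.
case: (ex_minnP ex) => k /hasP [P]; rewrite mem_monics => /andP [Pm /eqP sP] /eqP P0 kmin.
have Pmin B : ev theta B = 0 -> (size B <= k)%N -> B = 0.
  move=> B0 sB; apply/eqP; apply: contraLR sB => nz; rewrite -ltnNge.
  have l0 : lead_coef B != 0 by rewrite lead_coef_eq0.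
  have := kmin (size B).-1; rewrite -ltnS prednK ?size_poly_gt0 //; apply.
  apply/hasP; exists ((lead_coef B)^-1 *: B); last by rewrite evZ B0 mulr0.
  rewrite mem_monics monicE lead_coefZ mulVf // size_scale ?invr_eq0 // prednK ?size_poly_gt0 //.
  by rewrite !eqxx.
have PB B : (ev theta B == 0) = (P %| B).
  apply/eqP/idP => [B0|/dvdpP [r ->]]; last by rewrite evM P0 mulr0.
  rewrite /dvdp; apply/eqP; apply: Pmin.
    have := B0; rewrite {1}(divp_eq B P) evD evM P0 mulr0 add0r //.
  by rewrite -ltnS -sP ltn_modp monic_neq0.
exists P; split=> //; rewrite sP; congr _.+1; apply/eqP; rewrite eqn_leq; apply/andP; split.
  rewrite -(@leq_exp2l q) // -(size_polys F k).
  have inj : {in polys F k &, injective (ev theta)}.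
    move=> A B; rewrite !mem_polys => sA sB e; apply/eqP; rewrite -subr_eq0; apply/eqP/Pmin.
      by rewrite evB e subrr.
    by rewrite (leq_trans (size_polyD _ _)) // geq_max size_polyN sA.
  apply: leq_trans (card_roots_XqX (fdeg_gt0 theta)).
  rewrite -(size_map (ev theta)) cardE; apply: uniq_leq_size.
    by rewrite map_inj_in_uniq // polys_uniq.
  move=> y /mapP [B _ ->]; rewrite mem_enum inE.
  by rewrite ev_frob frob_fdeg.
have pn0 : map_poly iota P != 0 by rewrite map_poly_eq0 monic_neq0.
have := @max_poly_roots _ _ [seq theta ^+ (q ^ i) | i <- index_iota 0 (fdeg theta)] pn0.
rewrite size_map_poly sP size_map size_iota subn0 ltnS; apply.
  apply/allP => y /mapP [i _ ->]; rewrite rootE -/(ev _ P) -ev_frob P0 expr0n gtn_eqF //.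
  by rewrite expn_gt0 ltnW.
rewrite map_inj_in_uniq ?iota_uniq //.
have key i j : (i < j < fdeg theta)%N -> theta ^+ (q ^ i) = theta ^+ (q ^ j) -> False.
  move=> /andP [ij jd]; rewrite -(subnK (ltnW ij)) expnD exprM => /frobE_inj e.
  have := fdeg_min _ (esym e); rewrite subn_gt0 => /(_ ij); lia.
move=> i j; rewrite !mem_index_iota /= => hi hj e; case: (ltngtP i j) => // h.
  by case: (key i j); rewrite ?h ?hj.
by case: (key j i); rewrite ?h ?hi.
Qed.

Lemma ev_eq0_small theta p : (size p <= fdeg theta)%N -> ev theta p = 0 -> p = 0.
Proof.
have [P [Pm sP PB]] := minpoly_exists theta.
move=> sp /eqP; rewrite PB => Pp; apply/eqP; apply: contraTT Pp => p0.
by apply/negP => /(dvdp_leq p0); rewrite sP ltnNge sp.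
Qed.

Lemma ev_inj theta : {in polys F (fdeg theta) &, injective (ev theta)}.
Proof.
move=> A B; rewrite !mem_polys => sA sB e; apply/eqP; rewrite -subr_eq0; apply/eqP.
apply: (@ev_eq0_small theta); last by rewrite evB e subrr.
by rewrite (leq_trans (size_polyD _ _)) // geq_max size_polyN sA.
Qed.

Lemma ev_mod theta B : exists2 r : {poly F}, (size r <= fdeg theta)%N & ev theta B = ev theta r.
Proof.
have [P [Pm sP PB]] := minpoly_exists theta.
exists (B %% P); first by rewrite -ltnS -sP ltn_modp monic_neq0.
have /eqP P0 : ev theta P == 0 by rewrite PB.
by rewrite {1}(divp_eq B P) evD evM P0 mulr0 add0r.
Qed.

(** Evaluation is injective on these q^(fdeg theta) polynomials, and the fixed points in which it
    takes its values are no more numerous, so it is a bijection onto them. *)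
Lemma sum_ev_polys (V : nmodType) theta (f : E -> V) :
  \sum_(p <- polys F (fdeg theta)) f (ev theta p) =
  \sum_(y | y ^+ (q ^ fdeg theta) == y) f y.
Proof.
rewrite -(big_map (ev theta) xpredT f) -[RHS]big_filter; apply: perm_big.
have us : uniq [seq ev theta p | p <- polys F (fdeg theta)].
  by rewrite map_inj_in_uniq ?polys_uniq //; exact: ev_inj.
have sub : {subset [seq ev theta p | p <- polys F (fdeg theta)] <=
                   [seq y <- index_enum E | y ^+ (q ^ fdeg theta) == y]}.
  move=> y /mapP [p _ ->]; rewrite mem_filter mem_index_enum andbT.
  by rewrite ev_frob frob_fdeg.
apply: uniq_perm => //; first by rewrite filter_uniq // index_enum_uniq.
case: (uniq_min_size us sub) => //.
rewrite size_map size_polys -sum1_size big_filter sum1dep_card.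
exact: card_roots_XqX (fdeg_gt0 theta).
Qed.

(** Adding all p of degree < fdeg theta to the monic B of degree k permutes these B, and for each B
    it moves the value at theta through the whole field generated by theta. *)
Lemma equidistribution (V : comNzRingType) theta k (f : E -> V) : (fdeg theta <= k)%N ->
  (q ^ fdeg theta)%:R * (\sum_(B <- monics F k) f (ev theta B)) =
  (q ^ k)%:R * \sum_(y | y ^+ (q ^ fdeg theta) == y) f y.
Proof.
move=> dk.
transitivity (\sum_(p <- polys F (fdeg theta)) \sum_(B <- monics F k) f (ev theta (B + p))).
  transitivity (\sum_(p <- polys F (fdeg theta)) \sum_(B <- monics F k) f (ev theta B)).
    by rewrite big_const_seq count_predT size_polys iter_addr_0 mulr_natl.
  apply: eq_big_seq => p; rewrite mem_polys => sp.
  by rewrite (monics_shift (fun B => f (ev theta B))) // (leq_trans sp).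
rewrite exchange_big /=.
transitivity (\sum_(B <- monics F k) \sum_(y | y ^+ (q ^ fdeg theta) == y) f y).
  apply: eq_bigr => B _; have [r sr e] := ev_mod theta B.
  rewrite -sum_ev_polys -(polys_shift (fun p => f (ev theta p)) sr).
  by apply: eq_bigr => p _; rewrite !evD e addrC.
by rewrite big_const_seq count_predT size_monics iter_addr_0 mulr_natl.
Qed.

Definition nonzero_count theta k : int := \sum_(A <- monics F k) (ev theta A != 0)%:R.

Lemma nonzero_countE theta k :
  nonzero_count theta k = (q ^ k)%:R - (if (fdeg theta <= k)%N then (q ^ (k - fdeg theta))%:R else 0).
Proof.
have -> : nonzero_count theta k = (q ^ k)%:R - \sum_(A <- monics F k) (ev theta A == 0)%:R.
  apply/eqP; rewrite eq_sym subr_eq /nonzero_count -big_split /=; apply/eqP.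
  rewrite (eq_bigr (fun _ => 1)) => [|A _]; last by case: eqP.
  by rewrite big_const_seq count_predT size_monics iter_addr_0.
congr (_ - _); case: leqP => h.
  have := equidistribution (fun y => (y == 0)%:R : int) h.
  rewrite [in RHS](bigD1 0) /=; last by rewrite expr0n gtn_eqF // expn_gt0 ltnW ?card_F_gt1.
  have -> : \sum_(y : E | (y ^+ (q ^ fdeg theta) == y) && (y != 0%R)) ((y == 0%R)%:R : int) = 0.
    by rewrite big1 // => y /andP [_ /negbTE ->].
  rewrite eqxx addr0 mulr1.
  rewrite -{2}(subnK h) expnD mulnC natrM => /mulfI; apply.
  by rewrite pnatr_eq0 -lt0n expn_gt0 ltnW ?card_F_gt1.
rewrite big1_seq // => A /andP [_]; rewrite mem_monics => /andP [Am /eqP sA].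
case: eqP => // /(@ev_eq0_small theta) e; move: Am; rewrite e ?sA //.
by rewrite monicE lead_coef0 eq_sym oner_eq0.
Qed.

(** The generating series is (1 - u^d)/(1 - q u): the zeta function of F[x] without the Euler factor
    at the minimal polynomial of theta. *)
Lemma nonzero_count_rec theta k :
  nonzero_count theta k.+1 - q%:R * nonzero_count theta k = - (k.+1 == fdeg theta)%:R.
Proof.
rewrite !nonzero_countE; have d0 := fdeg_gt0 theta.
rewrite expnS natrM; case: (ltngtP k.+1 (fdeg theta)) => h.
- rewrite leqNgt (ltn_trans (ltnSn _) h) /=; ring.
- have h' : (fdeg theta <= k)%N by lia.
  rewrite h' subSn // expnS natrM /=. ring.
by rewrite -h ltnn subnn expn0 /=; ring.
Qed.

End Evaluation.

Section Character.
Variable K : finFieldType.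
Hypothesis K_odd : odd #|K|.
Local Notation c := ((#|K|.-1)./2).

Lemma chi0 : chi (0 : K) = 0.
Proof. by rewrite /chi eqxx. Qed.

Lemma chi_expE (x : K) : x != 0 -> chi x = if x ^+ c == 1 then 1 else -1.
Proof. by rewrite /chi => /negbTE ->. Qed.

Lemma chiM : {morph @chi K : x y / x * y}.
Proof.
move=> x y; case: (eqVneq x 0) => [->|x0]; first by rewrite mul0r chi0 mul0r.
case: (eqVneq y 0) => [->|y0]; first by rewrite mulr0 chi0 mulr0.
rewrite !chi_expE ?mulf_neq0 // exprMn.
have N1 := negbTE (oneN1 K_odd).
by case/orP: (chi_pm1 K_odd x0) => /eqP ->; case/orP: (chi_pm1 K_odd y0) => /eqP ->;
  rewrite ?mulr1 ?mul1r ?mulrNN ?mulr1 ?eqxx // eq_sym N1.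
Qed.

Lemma chi_sqr (x : K) : chi (x ^+ 2) = (x != 0)%:R.
Proof.
case: eqP => [->|/eqP x0]; first by rewrite expr0n chi0.
rewrite expr2 chiM chi_expE //; by case: eqP.
Qed.

Lemma chi_sqr1 (x : K) : x != 0 -> chi x * chi x = 1.
Proof. by move=> x0; rewrite -chiM -expr2 chi_sqr x0. Qed.

End Character.

(** * Recurrence between all monic and square-free sums *)

Section Recurrence.
Variables (q d : nat) (N W h : nat -> int).
Hypothesis d_gt0 : (0 < d)%N.
Hypothesis W_sum : forall k, W k = \sum_(a < k./2.+1) N a * h (k - a.*2).
Hypothesis N0 : N 0 = 1.

Lemma sieve_step (u : nat -> int) k : (forall a, N a.+1 - q%:R * N a = u a) ->
  W k.+2 - q%:R * W k = h k.+2 + \sum_(a < k./2.+1) u a * h (k - a.*2).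
Proof.
move=> Nu; rewrite !W_sum /= big_ord_recl N0 mul1r subn0 -addrA; congr (_ + _).
rewrite mulr_sumr -sumrB; apply: eq_bigr => a _.
rewrite -Nu /bump /= ?add1n ?doubleS ?subSS; ring.
Qed.

(** In generating series W(u) = N(u^2) h(u) with N(u) = (1 - u^d)/(1 - q u), so that (1 - u^(2d))
    h(u) = (1 - q u^2) W(u). *)
Lemma sieve_rec k : (forall a, N a.+1 - q%:R * N a = - (a.+1 == d)%:R) ->
  h k.+2 = W k.+2 - q%:R * W k + (if (d.*2 <= k.+2)%N then h (k.+2 - d.*2) else 0).
Proof.
move=> Nu; rewrite (sieve_step _ Nu) -addrA -[LHS]addr0; congr (_ + _).
case: d d_gt0 => // d' _; rewrite doubleS !subSS !ltnS.
have -> : (d'.*2 <= k)%N = (d' < k./2.+1)%N by rewrite ltnS geq_half_double.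
case: ltnP => h1.
  rewrite (bigD1 (Ordinal h1)) //= eqxx big1 => [|a /eqP ne]; first by rewrite /= addr0 mulN1r addNr.
  rewrite eqSS; case: eqP => [e|]; last by rewrite oppr0 mul0r.
  by case: ne; apply: val_inj.
rewrite big1 ?addr0 // => a _; rewrite eqSS ltn_eqF ?oppr0 ?mul0r //.
exact: leq_trans (ltn_ord a) h1.
Qed.

(** Above d + 1 the two W-terms vanish, so h k is h (k - 2d), or 0 if k < 2d. The number j counts
    the descents made before the trivial bound q^(k - 2jd) is used; the first conclusion says that
    the descent went as far as it could. *)
Lemma sieve_bound k : (forall a, N a.+1 - q%:R * N a = - (a.+1 == d)%:R) ->
  (forall j, (d <= j)%N -> W j = 0) -> (forall j, `|h j| <= (q ^ j)%:R) ->
  exists j, (k <= (j.*2.+1 * d).+1)%N /\ `|h k| * (q ^ (j.*2 * d))%:R <= (q ^ k)%:R.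
Proof.
move=> Nu W0 hb; have [m] := ubnP k; elim: m k => // m IH k; rewrite ltnS => km.
case: (leqP k d.+1) => kd.
  by exists 0%N; rewrite mul1n mul0n expn0 mulr1.
case: k km kd => [|[|k]] // km kd.
rewrite (sieve_rec _ Nu) !W0; [|lia|lia].
rewrite mulr0 subr0 add0r; case: leqP => h1; last first.
  (* The value is zero, and any large j serves. *)
  exists k.+2; rewrite normr0 mul0r ler0n; split=> //; nia.
have [|j [j1 j2]] := IH (k.+2 - d.*2)%N; first by lia.
exists j.+1; split; first by nia.
have -> : (j.+1.*2 * d = d.*2 + j.*2 * d)%N by rewrite doubleS -addn2 mulnDl mul2n addnC.
rewrite -{2}(subnK h1) !expnD !natrM mulrCA mulrC ler_wpM2r ?ler0n //.
Qed.

(** The sequence q^d/(q^d + 1) (q^k - q^(k-1)) solves the recurrence for these W, so the deviation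
    from it is unchanged when k drops by 2d. Multiplying by q^d + 1 avoids fractions. As k is odd,
    the descent never reaches index 0, where the predecessor would be truncated. *)
Lemma sieve_even_bound k : odd k -> (0 < q)%N ->
  (forall a, N a.+1 - q%:R * N a = - (a.+1 == d)%:R) ->
  (forall j, (d <= j)%N -> W j = (q ^ j)%:R - (q ^ (j - d))%:R) ->
  (forall j, 0 <= h j <= (q ^ j)%:R) ->
  exists j, (k <= (j.*2.+1 * d).+1)%N /\
   `|((q ^ d)%:R + 1) * h k - (q ^ d)%:R * ((q ^ k)%:R - (q ^ k.-1)%:R)| * (q ^ (j.*2 * d))%:R
     <= ((q ^ d)%:R + 1) * (q ^ k)%:R.
Proof.
move=> k_odd q0 Nu Wj hb; have [m] := ubnP k; elim: m k k_odd => // m IH k k_odd; rewrite ltnS => km.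
have mono a b : (a <= b)%N -> (q ^ a)%:R <= (q ^ b)%:R :> int.
  by move=> ab; rewrite ler_nat leq_pexp2l.
case: (leqP k d.+1) => kd.
  exists 0%N; rewrite mul1n mul0n expn0 mulr1; split=> //.
  have /andP [h0 h1] := hb k; have qk := mono _ _ (leq_pred k).
  have p0 : (0 : int) <= (q ^ k.-1)%:R by rewrite ler0n.
  have d0 : (0 : int) <= (q ^ d)%:R by rewrite ler0n.
  by rewrite ler_norml; apply/andP; split; nia.
case: k k_odd km kd => [|[|k]] // k_odd km kd.
rewrite (sieve_rec _ Nu) !Wj; [|lia|lia].
case: leqP => h1; last first.
  (* For d + 1 < k < 2d no earlier value of h enters: the scaled deviation is exactly q^(k-d-1) -
     q^(k-d), small enough for j = 1. *)
  exists 1%N; split; first by lia.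
  rewrite addr0 /=.
  have [x ek] : exists x, k = (x + d)%N by exists (k - d)%N; lia.
  rewrite {}ek in h1 kd km k_odd *.
  have -> : ((x + d).+2 - d = x.+2)%N by lia.
  have -> : (1.*2 * d = d + d)%N by lia.
  rewrite addnK.
  have -> : ((q ^ d)%:R + 1) * ((q ^ (x + d).+2)%:R - (q ^ x.+2)%:R - q%:R * ((q ^ (x + d))%:R - (q ^ x)%:R)) - (q ^ d)%:R * ((q ^ (x + d).+2)%:R - (q ^ (x + d).+1)%:R) = (q ^ x.+1)%:R - (q ^ x.+2)%:R :> int.
    by rewrite !expnS !expnD !natrM; ring.
  have x1 : (q ^ x.+1)%:R <= (q ^ x.+2)%:R :> int by apply: mono.
  rewrite ler0_norm ?subr_le0 // opprB.
  have p0 : (0 : int) <= (q ^ x.+1)%:R by rewrite ler0n.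
  have d0 : (0 : int) <= (q ^ d)%:R by rewrite ler0n.
  have -> : ((q ^ (x + d).+2)%:R = (q ^ x.+2)%:R * (q ^ d)%:R :> int) by rewrite -natrM -expnD.
  rewrite expnD natrM; nia.
have [||j [j1 j2]] := IH (k.+2 - d.*2)%N.
- by rewrite oddB // odd_double addbF.
- by lia.
exists j.+1; split; first by nia.
have lt : (d.*2 < k.+2)%N.
  by rewrite ltn_neqAle h1 andbT; apply: contraTneq k_odd => <-; rewrite odd_double.
have [x ex] : exists x, k.+1 = (x + d + d)%N by exists (k.+1 - d.*2)%N; lia.
have e2 : k.+2 = (x + d + d).+1 by rewrite ex.
have ed : (k.+2 - d.*2 = x.+1)%N by lia.
have ed2 : (k.+2 - d = (x + d).+1)%N by lia.
have ed1 : (k - d).+1 = (x + d)%N by lia.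
have ejd : (j.+1.*2 * d = d + d + j.*2 * d)%N by rewrite doubleS -addn2 mulnDl mul2n addnC addnn.
rewrite /= ed ed2 ejd mulrBr -!natrM -!expnS ed1 ex.
move: j2; rewrite ed /= => j2.
have -> : ((q ^ d)%:R + 1) * ((q ^ (x + d + d).+1)%:R - (q ^ (x + d).+1)%:R -
    ((q ^ (x + d + d))%:R - (q ^ (x + d))%:R) + h x.+1) -
    (q ^ d)%:R * ((q ^ (x + d + d).+1)%:R - (q ^ (x + d + d))%:R) =
   ((q ^ d)%:R + 1) * h x.+1 - (q ^ d)%:R * ((q ^ x.+1)%:R - (q ^ x)%:R).
  by rewrite !expnS !expnD !natrM; ring.
have -> : (q ^ (d + d + j.*2 * d))%:R = (q ^ (j.*2 * d))%:R * (q ^ (d + d))%:R :> int.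
  by rewrite -natrM -expnD addnC.
have -> : (q ^ (x + d + d).+1)%:R = (q ^ x.+1)%:R * (q ^ (d + d))%:R :> int.
  by rewrite -natrM -expnD addSn addnA.
by rewrite !mulrA ler_wpM2r ?ler0n.
Qed.

End Recurrence.

Section CharSums.
Variables (F E : finFieldType) (iota : {rmorphism F -> E}) (n : nat).
Local Notation q := #|F|.
Hypothesis n_gt0 : (0 < n)%N.
Hypothesis card_E : #|E| = (q ^ n)%N.
Hypothesis q_odd : odd q.
Local Notation ev := (ev iota).
Local Notation fdeg := (fdeg n_gt0 card_E).

Lemma E_odd : odd #|E|.
Proof. by rewrite card_E oddX q_odd orbT. Qed.

(** Equivalently n / fdeg theta is even: theta lies in the subfield with q^(n/2) elements, all of
    which are squares in E. *)
Definition even_type (theta : E) := ~~ odd n && (fdeg theta %| n./2)%N.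

(** Half of q^n - 1 is q^(n/2) - 1 times the integer (q^(n/2) + 1)/2, and the first factor already
    kills the units of the subfield. *)
Lemma chi_even_type (y : E) : ~~ odd n -> y ^+ (q ^ n./2) = y -> chi y = (y != 0)%:R.
Proof.
move=> n_even e; case: eqP => [->|/eqP y0]; first by rewrite chi0.
rewrite chi_expE //; suff -> : y ^+ (#|E|.-1)./2 = 1 by rewrite eqxx.
have qm : odd (q ^ n./2)%N by rewrite oddX q_odd orbT.
have -> : ((#|E|.-1)./2 = (q ^ n./2).-1 * ((q ^ n./2).+1)./2)%N.
  have -> : #|E| = (q ^ n./2 * q ^ n./2)%N.
    by rewrite card_E -expnD addnn even_halfK.
  move: qm; move: (q ^ n./2)%N => x; case: x => // x x_odd.
  have [k ek] : exists k, x = k.*2 by exists x./2; rewrite even_halfK //; move: x_odd.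
  rewrite ek {x_odd}; have -> : ((k.*2.+1 * k.*2.+1).-1 = (k.*2 * k.+1).*2)%N by nia.
  by rewrite doubleK -doubleS doubleK.
rewrite exprM (_ : y ^+ _ = 1) ?expr1n //.
apply: (mulfI y0); rewrite mulr1 -exprS prednK // expn_gt0.
by rewrite ltnW // (card_F_gt1 F).
Qed.

Lemma odd_geom (x e : nat) : odd x -> odd (\sum_(i < e) x ^ i)%N = odd e.
Proof.
move=> x_odd; elim: e => [|e IH]; first by rewrite big_ord0.
by rewrite big_ord_recr oddD IH /= oddX x_odd orbT addbT.
Qed.

(** (q^n - 1)/2 is (q^d - 1)/2 times a sum of n/d powers of q^d, which is odd along with n/d. Thus
    chi restricts to the quadratic character of the subfield, whose values 1 and -1 are equally
    frequent. *)
Lemma sum_chi_subfield theta (d := fdeg theta) : odd (n %/ d) ->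
  \sum_(y : E | y ^+ (q ^ d) == y) chi y = 0.
Proof.
have d0 : (0 < d)%N by exact: fdeg_gt0.
have dn : (d %| n)%N by exact: fdeg_dvd_n.
move=> e_odd.
have qd_odd : odd (q ^ d)%N by rewrite oddX q_odd orbT.
pose c := ((q ^ d).-1)./2.
have qdc : (q ^ d = c.*2.+1)%N.
  by move: qd_odd; rewrite /c; move: (q ^ d)%N; case=> // x /= h; rewrite even_halfK.
have c0 : (0 < c)%N.
  by have := card_F_exp_gt1 F d0; rewrite qdc; case: (c).
pose s := (\sum_(i < n %/ d) (q ^ d) ^ i)%N.
have cE : ((#|E|.-1)./2 = c * s)%N.
  have -> : (#|E|.-1 = (c * s).*2)%N.
    rewrite card_E -{1}(divnK dn) mulnC expnM predn_exp /s qdc /=.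
    by rewrite doubleMl.
  by rewrite doubleK.
have s_odd : odd s by rewrite odd_geom.
have EO := E_odd.
have N1 : ((1 : E) == -1) = false := negbTE (oneN1 EO).
have pm1 (y : E) : y ^+ (q ^ d) = y -> y != 0 -> (y ^+ c == 1) || (y ^+ c == -1).
  move=> e y0; rewrite -eqf_sqr expr1n -exprM muln2.
  by move/eqP: e; rewrite qdc exprS -subr_eq0 -{3}[y]mulr1 -mulrBr mulf_eq0 (negbTE y0) subr_eq0.
have chiE (y : E) : y ^+ (q ^ d) = y -> chi y = (y ^+ c == 1)%:R - (y ^+ c == -1)%:R.
  move=> e; case: (eqVneq y 0) => [->|y0].
    by rewrite chi0 expr0n gtn_eqF // eq_sym oner_eq0 eq_sym oppr_eq0 oner_eq0.
  rewrite chi_expE // cE exprM; case/orP: (pm1 y e y0) => /eqP ->.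
    by rewrite expr1n eqxx N1.
  by rewrite -signr_odd s_odd expr1 eqxx eq_sym N1.
pose S (a : E) := [set y : E | y ^+ c == a].
have cS (a : E) : (#|S a| <= c)%N.
  have p0 : 'X^c - a%:P != 0 :> {poly E} by rewrite -size_poly_gt0 size_XnsubC.
  have := @max_poly_roots _ _ (enum (S a)) p0.
  rewrite size_XnsubC // enum_uniq cardE => H; rewrite -ltnS; apply: H => //.
  by apply/allP => x; rewrite mem_enum inE rootE !hornerE subr_eq0.
pose T := [set y : E | y ^+ (q ^ d) == y].
have sT a : a ^+ 2 = 1 -> S a \subset T.
  move=> a2; apply/subsetP => y; rewrite !inE => /eqP e; apply/eqP.
  by rewrite qdc exprS -muln2 exprM e a2 mulr1.
have cT : (#|T| = c.*2.+1)%N.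
  have := sum_ev_polys iota n_gt0 card_E theta (fun _ => 1%N : nat).
  by rewrite sum1dep_card sum1_size size_polys -qdc => ->.
have sum_ind a : a ^+ 2 = 1 -> \sum_(y : E | y ^+ (q ^ d) == y) ((y ^+ c == a)%:R : int) = #|S a|%:R.
  move=> a2; rewrite -sum1_card natr_sum big_mkcond [RHS]big_mkcond /=; apply: eq_bigr => y _.
  have := subsetP (sT a a2) y; rewrite !inE; case: (_ == a) => [/(_ isT) ->|_] //.
  by case: ifP.
rewrite (eq_bigr (fun y : E => (y ^+ c == 1)%:R - (y ^+ c == -1)%:R)); last first.
  by move=> y /eqP /chiE.
rewrite sumrB !sum_ind ?sqrrN ?expr1n //.
set S1 := S 1; set S2 := S (-1).
have : (#|T| <= #|[set 0%R : E]| + (#|S1| + #|S2|))%N.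
  apply: (@leq_trans #|[set 0%R] :|: (S1 :|: S2)|).
    apply/subset_leq_card/subsetP => y; rewrite !inE => /eqP e.
    by case: (eqVneq y 0) => //= y0; exact: pm1.
  by apply: leq_trans (leq_card_setU _ _) _; rewrite leq_add2l leq_card_setU.
rewrite cards1 cT add1n ltnS => h.
have h1 : (#|S1| <= c)%N := cS 1; have h2 : (#|S2| <= c)%N := cS (-1).
have [-> ->] : #|S1| = c /\ #|S2| = c by move: h h1 h2; rewrite -addnn; clear; lia.
by rewrite subrr.
Qed.

Lemma odd_type_quotient theta : ~~ even_type theta -> odd (n %/ fdeg theta).
Proof.
apply: contraNT => e_even; have dn := fdeg_dvd_n n_gt0 card_E theta.
rewrite /even_type; move: (fdeg theta) dn e_even => d dn e_even.
have en : n = ((n %/ d)./2 * d).*2 by rewrite doubleMl even_halfK // divnK.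
by move: (_./2) en => k ->; rewrite odd_double doubleK dvdn_mull.
Qed.

Definition monic_sum theta k : int := \sum_(B <- monics F k) chi (ev theta B).
Definition sqf_sum theta k : int := \sum_(D <- sqf F k) chi (ev theta D).

(** A factor A^2 does not change chi unless A vanishes at theta, whence the weight
    [nonzero_count]. *)
Lemma monic_sum_sieve theta k :
  monic_sum theta k = \sum_(a < k./2.+1) nonzero_count iota theta a * sqf_sum theta (k - a.*2).
Proof.
rewrite /monic_sum (sum_sqf_decomposition k (fun B => chi (ev theta B))).
apply: eq_bigr => a _; rewrite /nonzero_count mulr_suml; apply: eq_bigr => A _.
rewrite /sqf_sum mulr_sumr; apply: eq_bigr => D _.
by rewrite evM ev_exp chiM ?E_odd // chi_sqr ?E_odd.
Qed.

Lemma size_sqf_le k : (size (sqf F k) <= q ^ k)%N.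
Proof. by rewrite size_filter -(size_monics F k) count_size. Qed.

Lemma sqf_sum_le theta k : `|sqf_sum theta k| <= (q ^ k)%:R.
Proof.
apply: le_trans (ler_norm_sum _ _ _) _.
apply: (@le_trans _ _ (\sum_(D <- sqf F k) 1)).
  by apply: ler_sum => D _; exact: abs_chi_le1.
by rewrite big_const_seq count_predT iter_addr_0 ler_nat size_sqf_le.
Qed.

Lemma nonzero_count0 theta : nonzero_count iota theta 0 = 1.
Proof.
by rewrite (nonzero_countE iota n_gt0 card_E) leqNgt fdeg_gt0 /= expn0 subr0.
Qed.

Lemma monic_sum_eq0 theta k : ~~ even_type theta -> (fdeg theta <= k)%N -> monic_sum theta k = 0.
Proof.
move=> ne dk; have := equidistribution iota (@chi E) dk.
rewrite sum_chi_subfield ?odd_type_quotient // mulr0 => /eqP; rewrite mulf_eq0.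
by rewrite pnatr_eq0 expn_eq0 -leqn0 leqNgt ltnW ?(card_F_gt1 F) //= => /eqP.
Qed.

Lemma sqf_sum_bound theta k : ~~ even_type theta -> exists j,
  (k <= (j.*2.+1 * fdeg theta).+1)%N /\
  `|sqf_sum theta k| * (q ^ (j.*2 * fdeg theta))%:R <= (q ^ k)%:R.
Proof.
move=> ne; apply: (sieve_bound (fdeg_gt0 n_gt0 card_E theta) (monic_sum_sieve theta) (nonzero_count0 theta)).
- exact: nonzero_count_rec.
- by move=> j; exact: monic_sum_eq0.
exact: sqf_sum_le.
Qed.

Lemma monic_sum_even_type theta k : even_type theta -> monic_sum theta k = nonzero_count iota theta k.
Proof.
move=> /andP [ne dn]; apply: eq_bigr => B _; apply: chi_even_type => //.
by rewrite ev_frob; congr (ev _ B); apply/eqP; rewrite (fdeg_dvd n_gt0 card_E).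
Qed.

Lemma sqf_sum_even_type theta k : even_type theta -> odd k -> exists j,
  (k <= (j.*2.+1 * fdeg theta).+1)%N /\
  `|((q ^ fdeg theta)%:R + 1) * sqf_sum theta k -
      (q ^ fdeg theta)%:R * ((q ^ k)%:R - (q ^ k.-1)%:R)| *
    (q ^ (j.*2 * fdeg theta))%:R <= ((q ^ fdeg theta)%:R + 1) * (q ^ k)%:R.
Proof.
move=> et k_odd.
apply: (sieve_even_bound (fdeg_gt0 n_gt0 card_E theta) (monic_sum_sieve theta) (nonzero_count0 theta)) => //.
- by rewrite ltnW // (card_F_gt1 F).
- exact: nonzero_count_rec.
- by move=> j dj; rewrite monic_sum_even_type // (nonzero_countE iota n_gt0 card_E) dj.
move=> j; rewrite (le_trans (ler_norm _) (sqf_sum_le theta j)) andbT.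
move: et => /andP [ne dn]; apply: sumr_ge0 => D _; rewrite chi_even_type ?ler0n //.
by rewrite ev_frob; congr (ev _ D); apply/eqP; rewrite (fdeg_dvd n_gt0 card_E).
Qed.

(** The same sieve with no point involved: the weights q^a satisfy the recurrence with zero
    correction. *)
Lemma size_sqfE k : (size (sqf F k.+2))%:R = (q ^ k.+2)%:R - (q ^ k.+1)%:R :> int.
Proof.
have sieve j : ((q ^ j)%:R : int) = \sum_(a < j./2.+1) (q ^ a)%:R * (size (sqf F (j - a.*2)))%:R.
  have cst (s : seq {poly F}) (x : int) : \sum_(i <- s) x = (size s)%:R * x.
    by rewrite big_const_seq count_predT iter_addr_0 mulr_natl.
  have := sum_sqf_decomposition j (fun _ : {poly F} => 1 : int).
  rewrite cst size_monics mulr1 => ->.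
  by apply: eq_bigr => a _; rewrite !cst size_monics mulr1.
have := @sieve_step q (fun a => (q ^ a)%:R) (fun j => (q ^ j)%:R) (fun j => (size (sqf F j))%:R)
  sieve (erefl _) (fun _ => 0) k.
rewrite big1 ?addr0 => [<-|a _]; last by rewrite mul0r.
  by rewrite -natrM -expnS.
by move=> a; rewrite -natrM -expnS subrr.
Qed.

End CharSums.

(** * Functional equation at a generator *)

Section SignAux.

(** The left-hand side is the k-th divided difference of p; Lagrange's formula is compared in degree
    k. *)
Lemma interpolation_lead (K : fieldType) k (x : 'I_k.+1 -> K) (p : {poly K}) :
  injective x -> (size p <= k.+1)%N ->
  \sum_j p.[x j] / (\prod_(i | i != j) (x j - x i)) = p`_k.
Proof.
move=> x_inj sp.
pose L j := \prod_(i | i != j) ('X - (x i)%:P).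
have sL j : size (L j) = k.+1.
  by rewrite /L -big_enum /= size_prod_XsubC -cardE cardC1 card_ord.
have Lm j : L j \is monic by rewrite /L; apply: monic_prod => i _; exact: monicXsubC.
have Lk j : (L j)`_k = 1 by have /monicP := Lm j; rewrite lead_coefE sL.
pose w j := \prod_(i | i != j) (x j - x i).
have w0 j : w j != 0.
  by apply/prodf_neq0 => i ij; rewrite subr_eq0 (inj_eq x_inj) eq_sym.
have Lx i j : (L j).[x i] = if i == j then w j else 0.
  rewrite /L horner_prod; case: eqP => [->|/eqP ij].
    by apply: eq_bigr => l _; rewrite hornerXsubC.
  by rewrite (bigD1 i) //= hornerXsubC subrr mul0r.
pose P := \sum_j (p.[x j] / w j) *: L j.
have -> : p = P.
  apply/eqP; rewrite -subr_eq0; apply/negPn/negP => nz.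
  have := @max_poly_roots _ _ [seq x i | i <- enum 'I_k.+1] nz.
  rewrite map_inj_uniq ?enum_uniq // size_map size_enum_ord => H.
  have : (k.+1 < size (p - P)%R)%N.
    apply: H => //; apply/allP => y /mapP [i _ ->]; rewrite rootE hornerD hornerN.
    rewrite /P horner_sum (bigD1 i) //= big1 => [|j ji].
      by rewrite hornerZ Lx eqxx divfK // addr0 subrr.
    by rewrite hornerZ Lx eq_sym (negbTE ji) mulr0.
  apply/negP; rewrite -leqNgt; apply: leq_trans (size_polyD _ _) _.
  rewrite geq_max sp size_polyN /=; apply: leq_trans (size_sum _ _ _) _.
  by apply/bigmax_leqP => j _; apply: leq_trans (size_scale_leq _ _) _; rewrite sL.
rewrite /P coef_sum; apply: eq_bigr => j _; rewrite coefZ Lk mulr1.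
congr (_ / _); rewrite horner_sum (bigD1 j) //= big1 => [|i ij].
  by rewrite hornerZ Lx eqxx divfK // addr0.
by rewrite hornerZ Lx eq_sym (negbTE ij) mulr0.
Qed.

(** With m signs equal to -1 the sum is the size minus 2m, the product is (-1)^m, and 2m = 1 -
    (-1)^m modulo 4. *)
Lemma sum_signs_mod4 (I : eqType) (r : seq I) (f : I -> int) :
  (forall i, i \in r -> f i * f i = 1) ->
  ((\sum_(i <- r) f i)%:~R : 'Z_4) = (size r)%:R - 1 + (\prod_(i <- r) f i)%:~R.
Proof.
have four0 : (4%:R : 'Z_4) = 0 by apply/val_inj.
move=> H; suff [] : ((\sum_(i <- r) f i)%:~R : 'Z_4) = (size r)%:R - 1 + (\prod_(i <- r) f i)%:~R /\
  (\prod_(i <- r) f i = 1 \/ \prod_(i <- r) f i = -1) by [].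
elim: r H => [|i r IH] H; first by rewrite !big_nil /=; split; [rewrite sub0r addNr | left].
rewrite !big_cons; have [|IH1 IH2] := IH; first by move=> j jr; apply: H; rewrite inE jr orbT.
have fi : f i = 1 \/ f i = -1.
  have /eqP : f i * f i = 1 by apply: H; rewrite mem_head.
  by rewrite -expr2 sqrf_eq1 => /orP [] /eqP; [left | right].
rewrite intrD IH1 /= -natr1.
case: fi => ->; case: IH2 => ->; split; rewrite ?mulN1r ?mul1r ?opprK;
  (try by [left | right]); rewrite ?mulrN1z ?mulr1z; try ring.
- apply/eqP; rewrite -subr_eq0; apply/eqP; rewrite -[RHS]oppr0 -four0; ring.
Qed.

(** Both sides record the parity of half of #|K| - 1. *)
Lemma card_mod4 (K : finFieldType) : odd #|K| -> (#|K|%:R : 'Z_4) = (chi (-1 : K))%:~R.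
Proof.
move=> K_odd; have four0 : (4%:R : 'Z_4) = 0 by apply/val_inj.
have qc := half_card K_odd.
have e : #|K|%:R = 2%:R * ((#|K|.-1)./2)%:R + 1 :> 'Z_4 by rewrite {1}qc -natr1 -mul2n natrM.
rewrite e chi_expE ?oppr_eq0 ?oner_eq0 // -signr_odd.
move: (_./2) => c; rewrite -{1}(odd_double_half c) natrD -muln2 natrM.
have -> (x y : 'Z_4) : 2%:R * (x + y * 2%:R) + 1 = 2%:R * x + 1 + 4%:R * y by ring.
rewrite four0 mul0r addr0.
case: (odd c); rewrite ?expr1 ?expr0 ?eqxx /=; last by rewrite mulr0 add0r.
rewrite eq_sym (negbTE (oneN1 K_odd)) mulr1 mulrN1z.
by apply/val_inj.
Qed.

End SignAux.

Section LeadingTerm.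
Variable F : finFieldType.
Local Notation q := #|F|.

Lemma sum_polys_lead (V : nmodType) k (f : {poly F} -> V) :
  \sum_(p <- polys F k.+1) f p =
  \sum_(p <- polys F k) f p + \sum_(a : F | a != 0) \sum_(p <- monics F k) f (a *: p).
Proof.
pose s := [seq a *: p | a <- [seq a <- enum F | a != 0], p <- monics F k].
have perm : perm_eq (polys F k.+1) (polys F k ++ s).
  apply: uniq_perm; first exact: polys_uniq.
    rewrite cat_uniq polys_uniq /=; apply/andP; split.
      apply/hasPn => p /allpairsP [[a r] /= []]; rewrite mem_filter mem_monics mem_polys.
      by move=> /andP [a0 _] /andP [_ /eqP sr] ->; rewrite size_scale // sr ltnn.
    apply: allpairs_uniq => [||[a p] [b r]]; first by rewrite filter_uniq // enum_uniq.
      exact: monics_uniq.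
    move=> /allpairsP [[a1 p1] [/= h1 h2 [-> ->]]] /allpairsP [[b1 r1] [/= h3 h4 [-> ->]]] /= e.
    have ab : a1 = b1.
      have := congr1 lead_coef e; rewrite !lead_coefZ.
      by move: h2 h4; rewrite !mem_monics => /andP [/monicP -> _] /andP [/monicP -> _]; rewrite !mulr1.
    move: e h1; rewrite ab mem_filter => e /andP [b0 _]; congr (_, _).
    by apply: (scalerI b0).
  move=> p; rewrite mem_cat !mem_polys; apply/idP/orP => [|[h|/allpairsP [[a r] /= []]]].
  - rewrite leq_eqVlt ltnS => /orP [/eqP sp|]; last by left.
    right; apply/allpairsP; exists (lead_coef p, (lead_coef p)^-1 *: p) => /=.
    have p0 : p != 0 by rewrite -size_poly_gt0 sp.
    have l0 : lead_coef p != 0 by rewrite lead_coef_eq0.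
    split; first by rewrite mem_filter l0 mem_enum.
      by rewrite mem_monics monicE lead_coefZ mulVf // size_scale ?invr_eq0 // sp !eqxx.
    by rewrite scalerA divff // scale1r.
  - exact: leqW.
  rewrite mem_filter mem_monics => /andP [a0 _] /andP [_ /eqP sr] ->.
  by rewrite size_scale // sr.
rewrite (perm_big _ perm) big_cat /=; congr (_ + _).
by rewrite big_allpairs_dep big_filter big_enum_cond.
Qed.

Lemma sum_polys_sub (V : nmodType) m k (f : {poly F} -> V) : (m <= k)%N ->
  \sum_(p <- polys F k | (size p <= m)%N) f p = \sum_(p <- polys F m) f p.
Proof.
move=> mk; rewrite -big_filter; apply: perm_big; apply: uniq_perm.
- by rewrite filter_uniq // polys_uniq.
- exact: polys_uniq.
move=> p; rewrite mem_filter !mem_polys.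
by apply/andP/idP => [[]|h] //; split=> //; exact: leq_trans h mk.
Qed.

(** Adding the multiples of v0 to v moves [L v] through all of F. *)
Lemma linear_form_uniform (V : comNzRingType) k (L : {poly F} -> F) (g : F -> V) (v0 : {poly F}) :
  (forall a u v, L (a *: u + v) = a * L u + L v) -> (size v0 <= k)%N -> L v0 != 0 ->
  q%:R * (\sum_(v <- polys F k) g (L v)) = (q ^ k)%:R * \sum_x g x.
Proof.
move=> Llin sv0 L0.
transitivity (\sum_(x : F) \sum_(v <- polys F k) g (L (v + (x / L v0) *: v0))).
  transitivity (\sum_(x : F) \sum_(v <- polys F k) g (L v)).
    by rewrite sumr_const mulr_natl cardE.
  apply: eq_bigr => x _; rewrite (polys_shift (fun v => g (L v))) //.
  by apply: leq_trans (size_scale_leq _ _) _.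
rewrite exchange_big /=.
transitivity (\sum_(v <- polys F k) \sum_x g x).
  apply: eq_bigr => v _; rewrite [RHS](reindex_inj (addIr (L v))).
  by apply: eq_bigr => x _; rewrite addrC Llin divfK.
by rewrite big_const_seq count_predT size_polys iter_addr_0 mulr_natl.
Qed.

End LeadingTerm.

Section Generator.
Variables (F E : finFieldType) (iota : {rmorphism F -> E}) (n : nat).
Local Notation q := #|F|.
Hypothesis n_gt0 : (0 < n)%N.
Hypothesis card_E : #|E| = (q ^ n)%N.
Hypothesis q_odd : odd q.
Variable theta : E.
Hypothesis theta_gen : fdeg n_gt0 card_E theta = n.
Local Notation ev := (ev iota theta).
Local Notation W := (monic_sum iota theta).
Let EO : odd #|E| := E_odd card_E q_odd.

Lemma sum_ev_gen (V : nmodType) (f : E -> V) :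
  \sum_(p <- polys F n) f (ev p) = \sum_y f y.
Proof.
have := sum_ev_polys iota n_gt0 card_E theta f; rewrite theta_gen => ->.
by apply: eq_bigl => y; rewrite (frobE_n card_E) eqxx.
Qed.

Lemma ev_gen_inj (p r : {poly F}) : (size p <= n)%N -> (size r <= n)%N -> ev p = ev r -> p = r.
Proof.
move=> sp sr; apply: (ev_inj (n_gt0 := n_gt0) (card_E := card_E) (theta := theta));
  by rewrite theta_gen mem_polys.
Qed.

Lemma ev_gen_surj y : exists2 p : {poly F}, (size p <= n)%N & ev p = y.
Proof.
case: (boolP (y \in [seq ev p | p <- polys F n])) => [/mapP [p]|yn].
  by rewrite mem_polys => sp ->; exists p.
have := sum_ev_gen (fun z => (z == y)%:R : int).
rewrite [RHS](bigD1 y) //= eqxx [X in _ + X]big1 => [|z /negbTE -> //].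
rewrite big1_seq // => p /andP [_ hp]; case: eqP => // e.
by case/negP: yn; rewrite -e map_f.
Qed.

Definition rep y : {poly F} := s2val (cid2 (ev_gen_surj y)).

Lemma size_rep y : (size (rep y) <= n)%N.
Proof. by rewrite /rep; case: cid2. Qed.

Lemma repK y : ev (rep y) = y.
Proof. by rewrite /rep; case: cid2. Qed.

Lemma evK (p : {poly F}) : (size p <= n)%N -> rep (ev p) = p.
Proof. by move=> sp; apply: ev_gen_inj; rewrite ?size_rep // repK. Qed.

Lemma rep_linear a y z : rep (iota a * y + z) = a *: rep y + rep z.
Proof.
apply: ev_gen_inj; rewrite ?size_rep //; last by rewrite repK evD evZ !repK.
apply: leq_trans (size_polyD _ _) _; rewrite geq_max size_rep andbT.
exact: leq_trans (size_scale_leq _ _) (size_rep _).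
Qed.

(** By Euler's formula this is the trace of y / P'(theta), with P the minimal polynomial of theta;
    unlike the plain trace it is adapted to the filtration by degree in theta. *)
Definition lam y : F := (rep y)`_n.-1.

Lemma lam_ev (p : {poly F}) : (size p <= n)%N -> lam (ev p) = p`_n.-1.
Proof. by move=> sp; rewrite /lam evK. Qed.

Lemma lam_form_linear c a u v : lam (ev (a *: u + v) * c) = a * lam (ev u * c) + lam (ev v * c).
Proof. by rewrite evD evZ mulrDl -mulrA /lam rep_linear coefD coefZ. Qed.

(** The product has degree at most n - 2, so no reduction modulo the minimal polynomial occurs and
    the coefficient of degree n - 1 is zero. *)
Lemma lam_orthogonal c k (v : {poly F}) : (size (rep c) <= n - k)%N -> (size v <= k)%N -> (k <= n)%N -> lam (ev v * c) = 0.
Proof.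
move=> sc sv kn; case: (posnP k) => [k0|k0].
  move: sv; rewrite k0 leqn0 size_poly_eq0 => /eqP ->; rewrite ev0 mul0r.
  by rewrite -(ev0 iota theta) lam_ev ?size_poly0 ?coef0.
have s : (size (v * rep c)%R <= n.-1)%N.
  by apply: leq_trans (size_polyMleq _ _) _; move: sc sv; generalize (size v) (size (rep c)); lia.
rewrite -[c]repK -evM lam_ev ?(leq_trans s) ?leq_pred //.
by rewrite nth_default.
Qed.

(** A power of X moves the leading coefficient of [rep c] to degree n - 1. *)
Lemma lam_nondegenerate c k : (k <= n)%N -> (n - k < size (rep c))%N ->
  exists2 v : {poly F}, (size v <= k)%N & lam (ev v * c) != 0.
Proof.
move=> kn sc; exists 'X^(n - size (rep c)).
  by rewrite size_polyXn; have := size_rep c; move: sc; generalize (size (rep c)); lia.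
have c0 : rep c != 0 by rewrite -size_poly_gt0; move: sc; generalize (size (rep c)); lia.
have s : size ('X^(n - size (rep c)) * rep c) = n.
  rewrite mulrC size_mulXn // subnK //; exact: size_rep.
rewrite -{2}[c]repK -evM lam_ev ?s //.
set p := _ * rep c in s *; have -> : p`_n.-1 = lead_coef p by rewrite lead_coefE s.
by rewrite lead_coefM lead_coefXn mul1r lead_coef_eq0.
Qed.

Lemma chiV (a : E) : a != 0 -> chi a^-1 = chi a.
Proof.
move=> a0; have := chi_sqr1 EO a0; rewrite -[in RHS](chi_sqr1 EO a0) => _.
have e : chi a * chi a^-1 = 1 by rewrite -chiM // divff // /chi oner_eq0 expr1n eqxx.
by rewrite -[RHS]mulr1 -e mulrA chi_sqr1 // mul1r.
Qed.

Lemma sum_chi_E : \sum_(y : E) chi y = 0.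
Proof.
have := @sum_chi_subfield F E iota n n_gt0 card_E q_odd theta.
rewrite /= theta_gen divnn n_gt0 => /(_ isT) h; rewrite -[RHS]h.
by apply: eq_bigl => y; rewrite (frobE_n card_E) eqxx.
Qed.

(** The substitution behind Gauss sums, for an arbitrary integer-valued g in place of an additive
    character. At a = 0 both sides vanish because chi sums to zero over E. *)
Lemma twisted_sum (g : F -> int) (a : E) :
  \sum_c chi c * g (lam (a * c)) = chi a * \sum_c chi c * g (lam c).
Proof.
case: (eqVneq a 0) => [->|a0].
  rewrite chi0 mul0r; under eq_bigr do rewrite mul0r.
  by rewrite -mulr_suml sum_chi_E mul0r.
rewrite (reindex_inj (mulfI (invr_neq0 a0))) mulr_sumr; apply: eq_bigr => c _.
by rewrite mulVKf // chiM // chiV // mulrA.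
Qed.

Definition poly_sum k : int := \sum_(v <- polys F k) chi (ev v).

(* For the pairing (y, z) |-> lam (y * z), the polynomials of degree < k in theta
   and those of degree < n - k are orthogonal complements. *)
Lemma poly_sum_functional k (h := \sum_c chi c * (lam c == 0)%:R) : (0 < k)%N -> (k <= n)%N ->
  h * poly_sum k = ((q ^ k)%:R - (q ^ k.-1)%:R) * poly_sum (n - k).
Proof.
move=> k0 kn.
have -> : h * poly_sum k = \sum_(v <- polys F k) \sum_c chi c * (lam (ev v * c) == 0)%:R.
  rewrite /poly_sum mulr_sumr; apply: eq_bigr => v _.
  by rewrite (twisted_sum (fun x => (x == 0)%:R)) mulrC.
rewrite exchange_big /=.
(* For fixed c, all q^k polynomials v satisfy the condition if [rep c] has degree < n - k, and
   q^(k-1) of them otherwise. *)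
transitivity (\sum_c (chi c * (q ^ k.-1)%:R +
   chi c * (size (rep c) <= n - k)%:R * ((q ^ k)%:R - (q ^ k.-1)%:R)))%R; last first.
  rewrite big_split /= -mulr_suml sum_chi_E mul0r add0r -mulr_suml mulrC; congr (_ * _).
  rewrite -sum_ev_gen /poly_sum -(sum_polys_sub _ (leq_subr k n)) [RHS]big_mkcond /=.
  apply: eq_big_seq => p; rewrite mem_polys => sp; rewrite evK //.
  by case: leqP => _; rewrite ?mulr1 ?mulr0.
apply: eq_bigr => c _; rewrite -mulr_sumr -mulrA -mulrDr; congr (_ * _).
case: leqP => sc.
  rewrite mul1r addrC subrK.
  transitivity (\sum_(v <- polys F k) (1 : int)).
    by apply: eq_big_seq => v; rewrite mem_polys => sv; rewrite (lam_orthogonal sc) // eqxx.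
  by rewrite big_const_seq count_predT size_polys iter_addr_0.
have [v0 sv0 L0] := lam_nondegenerate kn sc.
have := linear_form_uniform (fun x => (x == 0)%:R : int) (lam_form_linear c) sv0 L0.
rewrite [in RHS](bigD1 0) //= eqxx [X in _ + X]big1 => [|x /negbTE -> //].
rewrite addr0 mulr1 mul0r addr0 => e.
have q0 : (q%:R : int) != 0 by rewrite pnatr_eq0 -lt0n ltnW // card_F_gt1.
by apply: (mulfI q0); rewrite e -natrM -expnS prednK.
Qed.

Lemma chi_one : chi (1 : E) = 1.
Proof. by rewrite /chi oner_eq0 expr1n eqxx. Qed.

Lemma monic_sum0 : W 0 = 1.
Proof.
rewrite /monic_sum; have -> : monics F 0 = [:: 1].
  apply: perm_small_eq => //; apply: uniq_perm => //; first exact: monics_uniq.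
  move=> p; rewrite mem_monics inE; apply/andP/eqP => [[pm /eqP sp]|->]; last first.
    by rewrite monic1 size_poly1.
  by apply/eqP; rewrite -eqp_monic ?monic1 // -size_poly_eq1 sp.
by rewrite big_seq1 ev1 chi_one.
Qed.

(** The coefficients of L(u)/(1 - u), where L has coefficients [W]. For n even, L vanishes at u = 1
    because chi is trivial on the units of F, and the functional equation concerns the quotient. *)
Definition csum k : int := \sum_(j < k.+1) W j.

Lemma chi_iota_even a : ~~ odd n -> a != 0 -> chi (iota a) = 1.
Proof.
move=> n_even a0; rewrite (chi_even_type n_gt0 card_E q_odd n_even) ?fmorph_eq0 ?a0 //.
by have := ev_frob iota theta a%:P n./2; rewrite !evC.
Qed.

Lemma card_units_F : #|[pred a : F | a != 0]| = q.-1.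
Proof. by rewrite -(cardC1 (0 : F)); apply: eq_card => a; rewrite !inE. Qed.

Lemma poly_sum_step k : ~~ odd n -> poly_sum k.+1 = poly_sum k + (q.-1)%:R * W k.
Proof.
move=> n_even; rewrite /poly_sum sum_polys_lead; congr (_ + _).
rewrite (eq_bigr (fun _ => W k)) => [|a a0].
  by rewrite sumr_const card_units_F mulr_natl.
by apply: eq_bigr => B _; rewrite evZ chiM // chi_iota_even // mul1r.
Qed.

Lemma poly_sum0 : poly_sum 0 = 0.
Proof.
rewrite /poly_sum big1_seq // => p /andP [_]; rewrite mem_polys leqn0 size_poly_eq0 => /eqP ->.
by rewrite ev0 chi0.
Qed.

Lemma poly_sum_csum k : ~~ odd n -> poly_sum k.+1 = (q.-1)%:R * csum k.
Proof.
move=> n_even; elim: k => [|k IH].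
  by rewrite poly_sum_step // poly_sum0 add0r /csum big_ord1.
by rewrite poly_sum_step // IH /csum [in RHS]big_ord_recr mulrDr.
Qed.

Lemma q1_neq0 : (q.-1)%:R != 0 :> int.
Proof. by rewrite pnatr_eq0; have := card_F_gt1 F; case: #|F| => [|[]]. Qed.

Lemma csum_last : ~~ odd n -> csum n.-1 = 0.
Proof.
move=> n_even; have := poly_sum_csum n.-1 n_even; rewrite prednK // /poly_sum sum_ev_gen sum_chi_E.
by move/esym/eqP; rewrite mulf_eq0 (negbTE q1_neq0) => /eqP.
Qed.

(** The unknown factor h of [poly_sum_functional] is identified by its own case k = 0 as (q - 1)
    csum (n - 2). *)
Lemma csum_functional k : ~~ odd n -> (k <= n.-2)%N ->
  csum n.-2 * csum k = (q ^ k)%:R * csum (n.-2 - k).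
Proof.
move=> n_even kn; have n2 : (2 <= n)%N by move: n_even n_gt0; clear; case: (n) => [|[]].
set h := \sum_c chi c * (lam c == 0)%:R.
have main j : (j <= n.-2)%N -> h * csum j = (q ^ j)%:R * (q.-1)%:R * csum (n.-2 - j).
  move=> jn; have jn1 : (j.+1 <= n)%N by lia.
  have := poly_sum_functional (ltn0Sn j) jn1; rewrite -/h.
  have -> : (n - j.+1 = (n.-2 - j).+1)%N by lia.
  rewrite !poly_sum_csum // mulrCA [RHS]mulrCA => /(mulfI q1_neq0) ->; congr (_ * _).
  rewrite /= expnS -{1}[q](prednK (ltnW (card_F_gt1 F))) mulSn natrD natrM; ring.
have h0 : h = (q.-1)%:R * csum n.-2.
  have := main 0 (leq0n _); rewrite /csum big_ord1 monic_sum0 mulr1 expn0 mul1r subn0 //.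
by apply: (mulfI q1_neq0); rewrite mulrA -h0 main // -mulrA mulrCA.
Qed.

Lemma chi_iota_odd a : odd n -> chi (iota a) = chi a.
Proof.
move=> n_odd; case: (eqVneq a 0) => [->|a0]; first by rewrite rmorph0 !chi0.
rewrite !chi_expE ?fmorph_eq0 //.
pose s := (\sum_(i < n) q ^ i)%N.
have -> : ((#|E|.-1)./2 = (q.-1)./2 * s)%N.
  have qc := half_card q_odd.
  have -> : (#|E|.-1 = ((q.-1)./2 * s).*2)%N.
    by rewrite card_E predn_exp -/s {1}qc /= doubleMl.
  by rewrite doubleK.
have s_odd : odd s by rewrite odd_geom.
rewrite exprM -rmorphXn; case/orP: (chi_pm1 q_odd a0) => /eqP ->.
  by rewrite rmorph1 expr1n !eqxx.
rewrite rmorphN rmorph1 -signr_odd s_odd expr1.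
by rewrite eq_sym (negbTE (oneN1 EO)) eq_sym (negbTE (oneN1 q_odd)).
Qed.

Lemma sum_chi_F : \sum_(x : F) chi x = 0.
Proof.
have F_gt0 : (0 < 1)%N by [].
have card_F : #|F| = (#|F| ^ 1)%N by rewrite expn1.
have := @sum_chi_subfield F F idfun 1 F_gt0 card_F q_odd 0.
have -> /= : fdeg F_gt0 card_F 0 = 1%N.
  by apply/eqP; rewrite -dvdn1; exact: fdeg_dvd_n.
move=> /(_ isT) h; rewrite -[RHS]h.
by apply: eq_bigl => y; rewrite expn1 expf_card eqxx.
Qed.

(** For n odd chi restricts to the quadratic character of F, which takes the place of the indicator
    of 0. The inner sum over B of degree j vanishes unless [rep c] has degree at most n - 1 - j, and
    then depends on c only through chi c and the coefficient of that degree. *)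
Lemma monic_sum_functional k : odd n -> (k <= n.-1)%N ->
  W n.-1 * W k = (q ^ k)%:R * W (n.-1 - k).
Proof.
move=> n_odd kn.
set h := \sum_c chi c * chi (lam c).
have main j : (j <= n.-1)%N -> h * W j = (q ^ j)%:R * (q.-1)%:R * W (n.-1 - j).
  move=> jn; have jn1 : (j < n)%N by rewrite -(prednK n_gt0) ltnS.
  have -> : h * W j = \sum_(B <- monics F j) \sum_c chi c * chi (lam (ev B * c)).
    rewrite mulr_sumr; apply: eq_bigr => B _.
    by rewrite (twisted_sum (fun x => chi x)) mulrC.
  rewrite exchange_big /=.
  transitivity (\sum_(p <- polys F n | (size p <= n - j)%N)
      (q ^ j)%:R * (chi (ev p) * chi (p`_(n.-1 - j)))).
    rewrite -sum_ev_gen [RHS]big_mkcond /=; apply: eq_big_seq => p; rewrite mem_polys => sp.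
    rewrite -mulr_sumr /monics big_map.
    have split_lam v : lam (ev ('X^j + v) * ev p) = lam (ev v * ev p) + lam (ev 'X^j * ev p).
      by rewrite addrC -[v]scale1r lam_form_linear mul1r scale1r.
    under eq_bigr do rewrite split_lam.
    case: leqP => sp'.
      transitivity (chi (ev p) * \sum_(v <- polys F j) chi (p`_(n.-1 - j))).
        congr (_ * _); apply: eq_big_seq => v; rewrite mem_polys => sv.
        rewrite (lam_orthogonal _ sv) ?evK ?add0r ?(ltnW jn1) //.
        rewrite -evM lam_ev; last first.
          by apply: leq_trans (size_polyMleq _ _) _; rewrite size_polyXn; move: sp' jn1; move: (size p); clear; lia.
        by rewrite coefXnM ltnNge jn.
      by rewrite big_const_seq count_predT size_polys iter_addr_0 mulr_natl mulrnAr.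
    have srep : (n - j < size (rep (ev p)))%N by rewrite evK.
    have [v0 sv0 L0] := lam_nondegenerate (ltnW jn1) srep.
    have := linear_form_uniform (fun x => chi (x + lam (ev 'X^j * ev p))) (lam_form_linear (ev p)) sv0 L0.
    have -> : \sum_x chi (x + lam (ev 'X^j * ev p)) = 0.
      by rewrite -[RHS]sum_chi_F [RHS](reindex_inj (addIr (lam (ev 'X^j * ev p)))).
    rewrite mulr0.
    move/eqP; rewrite mulf_eq0 pnatr_eq0 eqn0Ngt ltnW ?card_F_gt1 //= => /eqP ->.
    by rewrite mulr0.
  rewrite sum_polys_sub ?leq_subr // -mulr_sumr -mulrA; congr (_ * _).
  have -> : (n - j = (n.-1 - j).+1)%N by move: jn1; clear; lia.
  set m := (n.-1 - j)%N.
  (* Only polynomials of exact degree m contribute, and their leading coefficient a enters through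
     chi (iota a) * chi a = 1. *)
  rewrite sum_polys_lead big1_seq ?add0r => [|p /andP [_]]; last first.
    by rewrite mem_polys => sp; rewrite nth_default // chi0 mulr0.
  rewrite (eq_bigr (fun _ => W m)) => [|a a0].
    by rewrite sumr_const card_units_F mulr_natl.
  apply: eq_big_seq => B; rewrite mem_monics => /andP [Bm /eqP sB].
  rewrite evZ chiM // chi_iota_odd // coefZ.
  have -> : B`_m = 1 by move/monicP: Bm; rewrite lead_coefE sB.
  by rewrite mulr1 mulrAC chi_sqr1 // mul1r.
have h0 : h = (q.-1)%:R * W n.-1.
  have := main 0%N (leq0n _); rewrite monic_sum0 mulr1 expn0 mul1r subn0 //.
by apply: (mulfI q1_neq0); rewrite mulrA -h0 main // -mulrA mulrCA.
Qed.

Local Notation th j := (theta ^+ (q ^ j)).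

Lemma frob_pow_inj i j : (i < n)%N -> (j < n)%N -> th i = th j -> i = j.
Proof.
have key i' j' : (i' < j' < n)%N -> th i' = th j' -> False.
  move=> /andP [ij jn]; rewrite -(subnK (ltnW ij)) expnD exprM => /(frobE_inj iota) e.
  have := fdeg_min n_gt0 card_E _ (esym e); rewrite subn_gt0 theta_gen => /(_ ij).
  by move: ij jn; clear; lia.
by move=> hi hj e; case: (ltngtP i j) => // h; [case: (key i j) | case: (key j i)]; rewrite ?h ?hi ?hj.
Qed.

(* Lagrange interpolation at the conjugates of theta yields an additive polynomial
   with value v_k at v(theta), deg v <= k; its roots are the v(theta) with deg v < k. *)
Lemma prod_monics k : (k < n)%N ->
  \prod_(B <- monics F k) ev B = \prod_(i < k) (th k - th i).
Proof.
move=> kn.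
pose x (j : 'I_k.+1) := th j.
have x_inj : injective x.
  by move=> i j e; apply/val_inj; apply: frob_pow_inj => //; apply: leq_trans (ltn_ord _) kn.
pose w j := (\prod_(i | i != j) (x j - x i))^-1.
pose e : {poly E} := \sum_(j < k.+1) w j *: 'X^(q ^ j).
have w0 j : w j != 0.
  rewrite invr_eq0; apply/prodf_neq0 => i ij.
  by rewrite subr_eq0 (inj_eq x_inj) eq_sym.
have q1 := card_F_gt1 F.
have se : size e = (q ^ k).+1 /\ lead_coef e = w ord_max.
  rewrite /e big_ord_recr /=.
  set u := \sum_(_ < _) _; set v := _ *: _.
  have sv : size v = (q ^ k).+1 by rewrite size_scale // size_polyXn.
  have su : (size u < size v)%N.
    rewrite sv ltnS; apply: leq_trans (size_sum _ _ _) _; apply/bigmax_leqP => j _.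
    apply: leq_trans (size_scale_leq _ _) _; rewrite size_polyXn.
    by rewrite ltn_exp2l.
  by rewrite addrC size_polyDl // lead_coefDl // lead_coefZ lead_coefXn mulr1.
case: se => se le.
have ee (v : {poly F}) : (size v <= k.+1)%N -> e.[ev v] = iota v`_k.
  move=> sv; have := @interpolation_lead E k x (map_poly iota v) x_inj.
  rewrite size_map_poly coef_map => /(_ sv) <-; rewrite /e horner_sum; apply: eq_bigr => j _.
  by rewrite hornerZ hornerXn ev_frob mulrC.
have := @all_roots_prod_XsubC _ e [seq ev v | v <- polys F k].
rewrite se size_map size_polys uniq_rootsE map_inj_in_uniq; last first.
  move=> a b; rewrite !mem_polys => sa sb; apply: ev_gen_inj; exact: leq_trans (ltnW kn).
rewrite polys_uniq => /(_ (erefl _)) H.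
have {}H := H _ isT.
have {}H : e = lead_coef e *: \prod_(z <- [seq ev v | v <- polys F k]) ('X - z%:P).
  apply: H; apply/allP => y /mapP [v]; rewrite mem_polys => sv ->.
  by rewrite rootE ee ?(leq_trans sv) // nth_default ?rmorph0.
(* At -theta^k the product over the roots of [e] becomes minus the product of the monic values,
   because the number q^k of roots is odd. *)
have : e.[ev (- 'X^k)] = -1.
  by rewrite ee ?size_polyN ?size_polyXn // coefN coefXn eqxx rmorphN rmorph1.
rewrite H le hornerZ horner_prod big_map.
have -> : \prod_(v <- polys F k) ('X - (ev v)%:P).[ev (- 'X^k)] = - \prod_(B <- monics F k) ev B.
  rewrite /monics [in RHS]big_map.
  rewrite (eq_bigr (fun v => -1 * ev ('X^k + v))) => [|v _]; last first.
    by rewrite hornerXsubC -evB -opprD -scaleN1r evZ rmorphN rmorph1.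
  rewrite big_split /= big_const_seq count_predT size_polys iter_mulr_1 -signr_odd.
  by rewrite oddX q_odd orbT expr1 mulN1r.
rewrite mulrN => /oppr_inj; rewrite /w => e1.
have d0 : \prod_(i | i != ord_max) (x ord_max - x i) != 0 by rewrite -invr_eq0; exact: w0.
transitivity (\prod_(i | i != ord_max) (x ord_max - x i)).
  by apply: (mulfI (w0 ord_max)); rewrite e1 mulVf.
rewrite big_mkcond big_ord_recr /= eqxx mulr1; apply: eq_bigr => i _.
by rewrite -(inj_eq val_inj) /= ltn_eqF.
Qed.

Lemma chiX (y : E) k : chi (y ^+ k) = chi y ^+ k.
Proof. by elim: k => [|k IH]; rewrite ?expr0 ?chi_one // !exprS chiM // IH. Qed.

Lemma chi_frob (y : E) k : chi (y ^+ (q ^ k)) = chi y.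
Proof.
rewrite chiX; case: (eqVneq y 0) => [->|y0].
  by rewrite chi0 expr0n gtn_eqF // expn_gt0 ltnW ?card_F_gt1.
rewrite chi_expE //; case: ifP => _; first by rewrite expr1n.
by rewrite -signr_odd oddX q_odd orbT.
Qed.

Definition frob_sign j : int := chi (th j - theta).
Definition monic_sign k : int := \prod_(B <- monics F k) chi (ev B).

Lemma th_neq j : (0 < j)%N -> (j < n)%N -> th j - theta != 0.
Proof.
move=> j0 jn; rewrite subr_eq0; apply: contraTneq j0 => e.
suff -> : j = 0%N by [].
by apply: frob_pow_inj => //; rewrite expn0 expr1.
Qed.

Lemma frob_sign_sqr j : (0 < j)%N -> (j < n)%N -> frob_sign j * frob_sign j = 1.
Proof. by move=> j0 jn; rewrite /frob_sign chi_sqr1 // th_neq. Qed.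

(** Each factor of [prod_monics] is a Frobenius power of some theta^(q^i) - theta, and chi is
    invariant under Frobenius. *)
Lemma monic_sign_prod k : (k < n)%N -> monic_sign k = \prod_(i < k) frob_sign i.+1.
Proof.
move=> kn.
have -> : monic_sign k = chi (\prod_(B <- monics F k) ev B).
  by rewrite /monic_sign (big_morph _ (chiM EO) chi_one).
rewrite prod_monics // (big_morph _ (chiM EO) chi_one).
rewrite (reindex_inj rev_ord_inj); apply: eq_bigr => i _ /=.
have -> : th k - th (k - i.+1) = (th i.+1 - theta) ^+ (q ^ (k - i.+1)).
  have -> : (th i.+1 - theta) ^+ (q ^ (k - i.+1)) = (th i.+1) ^+ (q ^ (k - i.+1)) - th (k - i.+1).
    by apply/eqP; rewrite eq_sym subr_eq -(expD_cardF iota) subrK.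
  by rewrite -exprM -expnD subnKC.
by rewrite chi_frob.
Qed.

(** Frobenius applied n - j times to theta - theta^(q^j) gives theta^(q^(n-j)) - theta. *)
Lemma frob_sign_sym j : (j <= n)%N -> frob_sign (n - j) = chi (-1 : E) * frob_sign j.
Proof.
move=> jn; rewrite -chiM // mulN1r opprB /frob_sign -(chi_frob (theta - _) (n - j)).
have -> : (theta - th j) ^+ (q ^ (n - j)) = th (n - j) - th j ^+ (q ^ (n - j)).
  by apply/eqP; rewrite eq_sym subr_eq -(expD_cardF iota) subrK.
by rewrite -exprM -expnD subnKC // (frobE_n card_E).
Qed.

Lemma monic_chi_sqr k B : (k < n)%N -> B \in monics F k -> chi (ev B) * chi (ev B) = 1.
Proof.
move=> kn; rewrite mem_monics => /andP [Bm /eqP sB]; apply: chi_sqr1 => //.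
apply: contraTneq Bm => /(@ev_eq0_small _ _ iota n n_gt0 card_E theta).
by rewrite theta_gen sB => -> //; rewrite monicE lead_coef0 eq_sym oner_eq0.
Qed.

Lemma monic_sum_mod4 k : (k < n)%N -> ((W k)%:~R : 'Z_4) = q%:R ^+ k - 1 + (monic_sign k)%:~R.
Proof.
move=> kn; rewrite /monic_sum sum_signs_mod4; last by move=> B; exact: monic_chi_sqr.
by rewrite size_monics natrX.
Qed.

Lemma four0 : (4%:R : 'Z_4) = 0. Proof. exact/val_inj. Qed.

Lemma q_mod4 : (q%:R : 'Z_4) = 1 \/ (q%:R : 'Z_4) = -1.
Proof.
rewrite card_mod4 // chi_expE ?oppr_eq0 ?oner_eq0 //.
by case: ifP; [left | right].
Qed.

(** The other root -q^k is excluded because q^k is 1 or -1 modulo 4, and these differ. *)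
Lemma sqrt_card_sign (x : int) k : x ^+ 2 = (q ^ k)%:R ^+ 2 ->
  (x%:~R : 'Z_4) = q%:R ^+ k -> x = (q ^ k)%:R.
Proof.
move/eqP; rewrite eqf_sqr => /orP [/eqP // |/eqP ->].
rewrite rmorphN /= natrX rmorphXn /= rmorph_nat => e; exfalso.
have : (q%:R : 'Z_4) ^+ k = 1 \/ (q%:R : 'Z_4) ^+ k = -1.
  case: q_mod4 => ->; first by left; rewrite expr1n.
  by rewrite -signr_odd; case: (odd k); [right; rewrite expr1 | left].
by case=> h; move: e; rewrite h.
Qed.

(** The functional equation at k = n - 1 gives the square. Modulo 4, pairing the signs of index j
    and n - j gives chi(-1)^((n-1)/2), and chi(-1) is congruent to q^n, that is to q. *)
Lemma monic_sum_last : odd n -> W n.-1 = (q ^ (n.-1)./2)%:R.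
Proof.
move=> n_odd; have n1 : (n.-1 < n)%N by rewrite prednK.
pose r := (n.-1)./2.
have er : n.-1 = r.*2 by rewrite even_halfK //; move: n_odd n_gt0; clear; case: (n).
apply: sqrt_card_sign.
  have := monic_sum_functional n_odd (leqnn _); rewrite subnn monic_sum0 mulr1 -expr2 => ->.
  by rewrite -/r er -natrX -expnM muln2.
rewrite monic_sum_mod4 // monic_sign_prod //.
have -> : \prod_(i < n.-1) frob_sign i.+1 = chi (-1 : E) ^+ r.
  rewrite er -addnn big_split_ord /=.
  rewrite [X in _ * X](reindex_inj rev_ord_inj) /= -big_split /=.
  rewrite (eq_bigr (fun _ => chi (-1 : E))) => [|i _]; first by rewrite prodr_const card_ord.
  have -> : (r + (r - i.+1)).+1 = (n - i.+1)%N by have := ltn_ord i; lia.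
  have hi : (i.+1 < n)%N by have := ltn_ord i; lia.
  by rewrite frob_sign_sym ?(ltnW hi) // mulrCA frob_sign_sqr // mulr1.
rewrite rmorphXn /= -card_mod4 // card_E -/r er -muln2 mulnC exprM natrX.
have q2 : (q%:R : 'Z_4) ^+ 2 = 1 by case: q_mod4 => ->; rewrite ?sqrrN expr1n.
have -> : (q%:R : 'Z_4) ^+ n = q%:R.
  by rewrite -(prednK n_gt0) er exprS -mul2n exprM q2 expr1n mulr1.
by rewrite q2 expr1n subrr add0r.
Qed.

(** Write n = 2(m + 1). Since chi(-1) = 1, the signs of index j and n - j cancel and only the middle
    one g survives. Modulo 4 the sum is m (1 + q) + g^m, so the value of g is needed only for m
    odd. *)
Lemma csum_pred2 : ~~ odd n -> csum n.-2 = (q ^ (n./2).-1)%:R.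
Proof.
move=> n_even.
have [m em] : exists m, n = m.+1.*2.
  by move: n_even n_gt0; clear; case: n => [|[|k]] // h _; exists k./2; rewrite doubleS even_halfK //; move: h; rewrite /= !negbK.
have en2 : n.-2 = m.*2 by rewrite em.
have en1 : n.-1 = m.*2.+1 by rewrite em.
have eh : (n./2).-1 = m by rewrite em doubleK.
have n1 : (n.-1 < n)%N by rewrite prednK.
rewrite eh; apply: sqrt_card_sign.
  have := csum_functional n_even (leqnn _).
  have -> : csum (n.-2 - n.-2) = 1 by rewrite subnn /csum big_ord1 monic_sum0.
  by rewrite mulr1 -expr2 en2 -natrX -expnM muln2 => ->.
have q2 : (q%:R : 'Z_4) ^+ 2 = 1 by case: q_mod4 => ->; rewrite ?sqrrN expr1n.
have chiN1 : chi (-1 : E) = 1.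
  have -> : (-1 : E) = iota (-1) by rewrite rmorphN rmorph1.
  by rewrite chi_iota_even // oppr_eq0 oner_eq0.
pose g := frob_sign m.+1.
have g2 : g * g = 1 by rewrite /g frob_sign_sqr // em; clear; lia.
have sig_last : monic_sign n.-1 = g.
  rewrite monic_sign_prod // en1 -addnn -addnS big_split_ord /= big_ord_recl /= addn0 mulrCA.
  rewrite [X in _ * (_ * X)](reindex_inj rev_ord_inj) /= -big_split /=.
  rewrite big1 ?mulr1 // => i _; rewrite /bump /= add1n.
  have hi : (i.+1 < n)%N by have := ltn_ord i; rewrite em; clear; lia.
  have -> : (m + (m - i.+1).+1).+1 = (n - i.+1)%N by have := ltn_ord i; rewrite em; clear; lia.
  by rewrite frob_sign_sym ?(ltnW hi) // chiN1 mul1r frob_sign_sqr.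
have sig_sym k : (k <= n.-1)%N -> monic_sign k * monic_sign (n.-1 - k) = g.
  move=> kn; have kn' : (k < n)%N by rewrite -(prednK n_gt0) ltnS.
  have kn2 : (n.-1 - k < n)%N by apply: leq_ltn_trans (leq_subr _ _) n1.
  rewrite -sig_last !monic_sign_prod //.
  have -> : \prod_(i < n.-1) frob_sign i.+1 = \prod_(i < k + (n.-1 - k)) frob_sign i.+1 by rewrite subnKC.
  rewrite big_split_ord /=; congr (_ * _).
  rewrite (reindex_inj rev_ord_inj) /=; apply: eq_bigr => i _.
  have -> : (n.-1 - k - i.+1).+1 = (n - (k + i).+1)%N.
    by have := ltn_ord i; move: n_gt0; clear; lia.
  rewrite frob_sign_sym ?chiN1 ?mul1r //.
  by have := ltn_ord i; move: n_gt0; clear; lia.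
(* Over all k < n the pairs k, n - 1 - k give g^(m+1), and the factor k = n - 1 is g itself. *)
have prod_sig : \prod_(k < n.-1) monic_sign k = g ^+ m.
  have gn0 : g != 0 by apply/eqP => e; move: g2; rewrite e mul0r.
  apply: (mulIf gn0); rewrite -exprSr.
  transitivity (\prod_(k < n.-1.+1) monic_sign k); first by rewrite big_ord_recr /= sig_last.
  rewrite prednK //.
  have -> : \prod_(k < n) monic_sign k = \prod_(k < m.+1 + m.+1) monic_sign k by rewrite addnn -em.
  rewrite big_split_ord /= [X in _ * X](reindex_inj rev_ord_inj) /= -big_split /=.
  rewrite (eq_bigr (fun _ => g)) => [|i _]; first by rewrite prodr_const card_ord.
  have -> : (m.+1 + (m.+1 - i.+1))%N = (n.-1 - i)%N by have := ltn_ord i; rewrite em; clear; lia.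
  by rewrite sig_sym // em; have := ltn_ord i; clear; lia.
have sig2 k : (k < n)%N -> monic_sign k * monic_sign k = 1.
  move=> kn; rewrite monic_sign_prod // -big_split big1 //= => i _.
  by rewrite frob_sign_sqr //; apply: leq_ltn_trans kn.
have -> : ((csum n.-2)%:~R : 'Z_4) = \sum_(k < n.-1) q%:R ^+ k - 1 + (g ^+ m)%:~R.
  have en : n.-2.+1 = n.-1 by rewrite en1.
  rewrite /csum en rmorph_sum /=.
  rewrite (eq_bigr (fun k : 'I_n.-1 => q%:R ^+ k - 1 + (monic_sign k)%:~R)) => [|k _]; last first.
    by rewrite monic_sum_mod4 // (ltn_trans (ltn_ord k)).
  rewrite big_split sumrB /= -rmorph_sum /=.
  have := @sum_signs_mod4 _ (enum 'I_n.-1) (fun k => monic_sign k).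
  rewrite big_enum /= big_enum /= size_enum_ord prod_sig => ->; last first.
    by move=> k _; apply: sig2; rewrite (ltn_trans (ltn_ord k)).
  rewrite sumr_const card_ord /=; ring.
have -> : \sum_(k < n.-1) (q%:R : 'Z_4) ^+ k = m%:R * (1 + q%:R) + 1.
  rewrite en1; elim: (m) => [|k IH]; first by rewrite big_ord1 expr0 mul0r add0r.
  rewrite doubleS big_ord_recr big_ord_recr /= IH.
  have -> : (q%:R : 'Z_4) ^+ k.*2.+1 = q%:R by rewrite exprS -mul2n exprM q2 expr1n mulr1.
  have -> : (q%:R : 'Z_4) ^+ k.*2.+2 = 1 by rewrite -doubleS -mul2n exprM q2 expr1n.
  by rewrite -natr1; ring.
have h4 (x : 'Z_4) : x + x + x + x = 0.
  by rewrite -[RHS](mul0r x) -four0; ring.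
rewrite addrK; case: (boolP (odd m)) => m_odd; last first.
  have [t et] : exists t, m = t.*2 by exists m./2; rewrite even_halfK.
  have -> : g ^+ m = 1 by rewrite et -mul2n exprM expr2 g2 expr1n.
  rewrite et -mul2n natrM exprM q2 expr1n.
  case: q_mod4 => ->; last by rewrite subrr mulr0 add0r.
  transitivity ((t%:R + t%:R + t%:R + t%:R : 'Z_4) + 1); first by ring.
  by rewrite h4 add0r.
have [t et] : exists t, m = t.*2.+1.
  by exists m./2; rewrite -{1}(odd_double_half m) m_odd.
(* The middle difference w = theta^r - theta with r = q^(m+1) satisfies w^r = -w, since r^2 = q^n.
   For m odd r is an odd square, hence 1 modulo 4, so (q^n - 1)/2 is r - 1 times an odd number and
   chi w = -1. *)
have g1 : g = -1.
  pose r := (q ^ m.+1)%N; pose w := th m.+1 - theta.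
  have w0 : w != 0 by apply: th_neq; rewrite // em; clear; lia.
  have wr : w ^+ r = - w.
    have -> : w ^+ r = (th m.+1) ^+ r - th m.+1.
      by apply/eqP; rewrite eq_sym subr_eq -(expD_cardF iota) subrK.
    by rewrite -exprM -expnD addnn -em (frobE_n card_E) opprB.
  have r1 : (1 < r)%N by rewrite card_F_exp_gt1.
  have wr1 : w ^+ r.-1 = -1.
    by apply: (mulfI w0); rewrite -exprS prednK ?(ltnW r1) // wr mulrN1.
  have [u eu] : exists u, r = (4 * u + 1)%N.
    have : odd (q ^ t.+1)%N by rewrite oddX q_odd orbT.
    have -> : r = ((q ^ t.+1) ^ 2)%N by rewrite /r et -doubleS -muln2 expnM.
    move: (q ^ t.+1)%N => x x_odd; have [y ->] : exists y, x = y.*2.+1.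
      by exists x./2; rewrite -{1}(odd_double_half x) x_odd.
    by exists (y * y.+1)%N; rewrite -mulnn; nia.
  rewrite /g /frob_sign -/w chi_expE //.
  have -> : ((#|E|.-1)./2 = r.-1 * (2 * u).+1)%N.
    have -> : #|E| = (r * r)%N by rewrite card_E em -addnn expnD.
    rewrite eu; have -> : ((4 * u + 1) * (4 * u + 1)).-1 = ((4 * u + 1).-1 * (2 * u).+1).*2 by nia.
    by rewrite doubleK.
  rewrite exprM wr1 -signr_odd mul2n /= odd_double expr1 eq_sym.
  by rewrite (negbTE (oneN1 EO)).
have -> : g ^+ m = -1 by rewrite g1 -signr_odd m_odd.
have -> : (q%:R : 'Z_4) ^+ m = q%:R by rewrite et exprS -mul2n exprM q2 expr1n mulr1.
have -> : m%:R = 2%:R * t%:R + 1 :> 'Z_4 by rewrite et -natr1 -mul2n natrM.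
rewrite mulrN1z; case: q_mod4 => ->.
  transitivity ((t%:R + t%:R + t%:R + t%:R : 'Z_4) + 1); first by ring.
  by rewrite h4 add0r.
by rewrite subrr mulr0 add0r.
Qed.

Lemma gen_not_even_type : ~~ even_type n_gt0 card_E theta.
Proof.
rewrite /even_type theta_gen negb_and negbK; case: (boolP (odd n)) => //= n_even.
apply/negP => /dvdn_leq; have := n_gt0; move: n_even; clear; lia.
Qed.

Lemma monic_sum_gen_eq0 k : (n <= k)%N -> W k = 0.
Proof.
move=> nk; apply: (@monic_sum_eq0 F E iota n n_gt0 card_E q_odd); first exact: gen_not_even_type.
by rewrite theta_gen.
Qed.

Lemma monic_sum_functional_odd k : odd n -> (k <= n.-1)%N ->
  (q ^ (n.-1)./2)%:R * W k = (q ^ k)%:R * W (n.-1 - k).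
Proof. by move=> n_odd kn; rewrite -monic_sum_last // monic_sum_functional. Qed.

Lemma csum_functional_even k : ~~ odd n -> (k <= n.-2)%N ->
  (q ^ (n./2).-1)%:R * csum k = (q ^ k)%:R * csum (n.-2 - k).
Proof. by move=> n_even kn; rewrite -csum_pred2 // csum_functional. Qed.

End Generator.

(** * Averages over the generators *)

Section Nonsquare.
Variables (F E : finFieldType) (iota : {rmorphism F -> E}).
Local Notation q := #|F|.
Hypothesis q_odd : odd q.

Lemma frob_fixed_iota (x : E) : x ^+ q = x -> exists a, x = iota a.
Proof.
move=> e.
have sub : [set iota a | a in F] \subset [set x : E | x ^+ (q ^ 1) == x].
  by apply/subsetP => y /imsetP [a _ ->]; rewrite inE expn1 -rmorphXn expf_card.
have /eqP eS : [set iota a | a in F] == [set x : E | x ^+ (q ^ 1) == x].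
  rewrite eqEcard sub card_imset; last exact: fmorph_inj.
  by apply: leq_trans (card_roots_XqX _ _ (ltn0Sn 0)) _; rewrite expn1.
have : x \in [set iota a | a in F] by rewrite eS inE expn1 e.
by move=> /imsetP [a _ ->]; exists a.
Qed.

Lemma poly_expD_cardF (x y : {poly E}) : (x + y) ^+ q = x ^+ q + y ^+ q.
Proof.
by apply: exprDn_pchar; apply: card_pchar_nat => p; rewrite pchar_poly (fmorph_pchar iota).
Qed.

Lemma coef_poly_frob (t : {poly E}) i : (t ^+ q)`_(i * q) = t`_i ^+ q.
Proof.
have q0 : (0 < q)%N by rewrite ltnW // card_F_gt1.
elim/poly_ind: t i => [|t c IH] i.
  by rewrite expr0n gtn_eqF // !coef0 expr0n gtn_eqF.
rewrite poly_expD_cardF exprMn -polyC_exp !coefD coefMXn !coefC !coefMX muln_eq0 (gtn_eqF q0) orbF.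
case: i => [|i] /=; first by rewrite mul0n q0 !add0r.
by rewrite !addr0 mulSn ltnNge leq_addr /= addKn IH.
Qed.

Lemma iota_poly_frob (B : {poly F}) : (map_poly iota B) ^+ q = map_poly iota B \Po 'X^q.
Proof. by rewrite -rmorphXn /= poly_expr_card map_comp_poly map_polyXn. Qed.

(** t^q and t(X^q) have the same square B(X^q) and the same leading coefficient, so they agree; the
    coefficients of t are then fixed by Frobenius and come from F. *)
Lemma monic_sqrt_descends (B : {poly F}) (t : {poly E}) :
  t \is monic -> map_poly iota B = t ^+ 2 -> exists2 t0, t0 \is monic & B = t0 ^+ 2.
Proof.
move=> tm e.
have q0 : (0 < q)%N by rewrite ltnW // card_F_gt1.
have tq : t ^+ q = t \Po 'X^q.
  have : (t ^+ q) ^+ 2 = (t \Po 'X^q) ^+ 2.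
    by rewrite -exprM mulnC exprM -e iota_poly_frob e rmorphXn.
  move/eqP; rewrite eqf_sqr => /orP [/eqP //|/eqP h].
  have := coef_poly_frob t (size t).-1.
  rewrite h coefN coef_comp_poly_Xn // dvdn_mull // mulnK // -lead_coefE (monicP tm) expr1n.
  move/eqP; rewrite eq_sym -subr_eq0 opprK => two0.
  have : iota 2%:R == 0 by rewrite rmorph_nat.
  by rewrite fmorph_eq0 (negbTE (two_neq0 q_odd)).
have fixed i : t`_i ^+ q = t`_i.
  by rewrite -coef_poly_frob tq coef_comp_poly_Xn // dvdn_mull // mulnK.
have [a ha] := choice (fun i => frob_fixed_iota (fixed i)).
have et : t = map_poly iota (\poly_(i < size t) a i).
  apply/polyP => i; rewrite coef_map coef_poly /=; case: ltnP => h; first by rewrite ha.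
  by rewrite nth_default // rmorph0.
exists (\poly_(i < size t) a i).
  by rewrite -(map_monic iota) -et.
by apply: (map_poly_inj iota); rewrite e {1}et rmorphXn.
Qed.

(* The hypothesis makes B a square over E, hence over F. *)
Lemma nonsquare_lift (B : {poly F}) : B \is monic ->
  (forall t, t \is monic -> B != t ^+ 2) ->
  forall (r s : {poly E}) (e : E), r ^+ 2 * map_poly iota B = e *: s ^+ 2 -> r = 0.
Proof.
move=> Bm nsq r s e h; apply/eqP/negPn/negP => r0.
have B0 : map_poly iota B != 0 by rewrite map_poly_eq0 monic_neq0.
have e0 : e != 0.
  apply: contraNneq r0 => e0; move/eqP: h.
  by rewrite e0 scale0r mulf_eq0 (negbTE B0) orbF expf_eq0.
have : r ^+ 2 %| s ^+ 2 by rewrite -(dvdpZr _ _ e0) -h dvdp_mulIl.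
rewrite dvdp_pexp2r // => /dvdpP [u eu].
have eB : map_poly iota B = e *: u ^+ 2.
  apply: (mulfI (expf_neq0 2 r0)); rewrite h eu exprMn -scalerAr; congr (_ *: _); exact: mulrC.
have lB : e * lead_coef u ^+ 2 = 1.
  by rewrite -lead_coef_exp -lead_coefZ -eB lead_coef_map (monicP Bm) rmorph1.
have l0 : lead_coef u != 0.
  by apply/eqP => l0; move/eqP: lB; rewrite l0 expr0n mulr0 eq_sym oner_eq0.
have [||t tm et] := @monic_sqrt_descends B ((lead_coef u)^-1 *: u).
- by rewrite monicE lead_coefZ mulVf.
- rewrite eB exprZn; congr (_ *: _).
  by rewrite exprVn -[RHS]mul1r -lB mulfK // expf_neq0.
by have := nsq t tm; rewrite et eqxx.
Qed.

End Nonsquare.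

Lemma proper_divisor_half d n : (0 < n)%N -> (d %| n)%N -> d != n -> (d <= n./2)%N.
Proof.
move=> n0 /dvdnP [[|[|k]] ek] dn; first by move: n0; rewrite ek.
  by move: dn; rewrite ek mul1n eqxx.
by rewrite geq_half_double ek -muln2 mulnC leq_mul2r orbT.
Qed.

Section GeneratorAverage.
Variables (R : realType) (F E : finFieldType) (iota : {rmorphism F -> E}) (n : nat).
Local Notation q := #|F|.
Hypothesis n_gt0 : (0 < n)%N.
Hypothesis card_E : #|E| = (q ^ n)%N.
Hypothesis q_odd : odd q.
Local Notation ev := (ev iota).
Local Notation fdeg := (fdeg n_gt0 card_E).
Local Notation W := (monic_sum iota).
Local Notation sq := (Num.sqrt (q%:R : R)).

Lemma q_ge1 : (1 : R) <= q%:R.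
Proof. by rewrite ler1n ltnW // card_F_gt1. Qed.

Lemma sq_ge1 : 1 <= sq.
Proof. by rewrite -[X in X <= _]sqrtr1 ler_sqrt ?q_ge1 // (le_trans ler01 q_ge1). Qed.

Lemma sq_ge0 : 0 <= sq. Proof. exact: sqrtr_ge0. Qed.

Lemma sq_sqr k : sq ^+ (k.*2) = q%:R ^+ k.
Proof. by rewrite -mul2n exprM sqr_sqrtr // ler0n. Qed.

Lemma sq_half k : q%:R ^+ k./2 <= sq ^+ k.
Proof.
rewrite -{2}(odd_double_half k) exprD sq_sqr ler_peMl ?exprn_ge0 ?ler0n //.
exact: exprn_ege1 sq_ge1.
Qed.

Definition gens : {set E} := [set theta | fdeg theta == n].

(** The degree of a non-generator is a proper divisor of n, hence some d <= n/2, and each such d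
    accounts for at most q^d points. *)
Lemma card_nongens : (#|~: gens| <= n * q ^ n./2)%N.
Proof.
have q1 := card_F_gt1 F.
pose S d := [set x : E | x ^+ (q ^ d) == x].
have sub : ~: gens \subset \bigcup_(d < (n./2).+1 | (0 < d)%N) S d.
  apply/subsetP => x; rewrite !inE => xn.
  have dn := fdeg_dvd_n n_gt0 card_E x; have d0 := fdeg_gt0 n_gt0 card_E x.
  have dh : (fdeg x < (n./2).+1)%N.
    by rewrite ltnS; exact: proper_divisor_half.
  apply/bigcupP; exists (Ordinal dh) => //.
  by rewrite inE /= frob_fdeg.
apply: leq_trans (subset_leq_card sub) _.
apply: (@leq_trans (\sum_(d < (n./2).+1 | (0 < d)%N) q ^ n./2)).
  elim/big_rec2: _ => [|d x A d0 IH]; first by rewrite cards0.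
  apply: leq_trans (leq_card_setU _ _) _; apply: leq_add => //.
  apply: leq_trans (card_roots_XqX _ _ d0) _.
  by rewrite leq_exp2l // -ltnS.
rewrite sum_nat_const leq_mul2r; apply/orP; right.
have -> : #|[pred d : 'I_(n./2).+1 | (0 < d)%N]| = n./2.
  rewrite (eq_card (B := predC1 ord0)) ?cardC1 ?card_ord // => d.
  by rewrite !inE lt0n.
by rewrite -{2}(odd_double_half n) -addnn addnA leq_addl.
Qed.

Lemma card_nongens_real : (#|~: gens|)%:R <= n%:R * sq ^+ n :> R.
Proof.
apply: (@le_trans _ _ (n * q ^ n./2)%:R); first by rewrite ler_nat card_nongens.
by rewrite natrM natrX ler_wpM2l ?ler0n // sq_half.
Qed.

Lemma card_gens : (#|gens|)%:R = q%:R ^+ n - (#|~: gens|)%:R :> R.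
Proof. by rewrite -natrX -card_E -(cardsC gens) natrD addrK. Qed.

Lemma full_sum_bound (B : {poly F}) j : (0 < j)%N -> B \in monics F j ->
  (forall t, t \is monic -> B != t ^+ 2) ->
  `|(\sum_(theta : E) chi (ev theta B))%:~R| <= 13 * j%:R * sq ^+ n :> R.
Proof.
move=> j0; rewrite mem_monics => /andP [Bm /eqP sB] nsq.
have sf : size (map_poly iota B) = j.+1 by rewrite size_map_poly.
have EO := E_odd card_E q_odd.
have := @stepanov E EO (map_poly iota B); rewrite sf /= => /(_ j0 (nonsquare_lift q_odd Bm nsq)).
set S := \sum_x _ => h.
have h0 : 0 <= 13 * j%:R * sq ^+ n by rewrite !mulr_ge0 ?ler0n // exprn_ge0 // sq_ge0.
rewrite -(@ler_pXn2r _ 2) ?nnegrE // real_normK ?num_real //.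
have -> : (13 * j%:R * sq ^+ n) ^+ 2 = (169 * (j ^ 2)%:R * #|E|%:R)%:~R :> R.
  have -> : 169 * (j ^ 2)%:R * #|E|%:R = (169 * (j ^ 2 * #|E|))%N%:R :> int.
    by move: (j ^ 2)%N => a; rewrite !natrM mulrA.
  rewrite rmorph_nat card_E !exprMn -exprM muln2 sq_sqr -!natrX -!natrM; congr _%:R.
  by rewrite mulnA.
by rewrite -rmorphXn ler_int.
Qed.

(** 14 = 13 + 1: 13 is the square root of the constant 169 in [stepanov], and discarding the
    non-generators costs at most n q^(n/2). *)
Lemma gens_sum_bound (B : {poly F}) j : (j <= n)%N -> B \in monics F j ->
  (forall t, t \is monic -> B != t ^+ 2) ->
  `|(\sum_(theta in gens) chi (ev theta B))%:~R| <= 14 * n%:R * sq ^+ n :> R.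
Proof.
move=> jn Bj nsq.
have j0 : (0 < j)%N.
  rewrite lt0n; apply/eqP => j0; move: Bj; rewrite j0 mem_monics => /andP [Bm /eqP sB].
  have := nsq 1 (monic1 _); rewrite expr1n => /eqP; case.
  by apply/eqP; rewrite -eqp_monic ?monic1 // -size_poly_eq1 sB.
have -> : \sum_(theta in gens) chi (ev theta B) =
   \sum_(theta : E) chi (ev theta B) - \sum_(theta in ~: gens) chi (ev theta B).
  rewrite [X in X - _](bigID (mem gens)) /=.
  rewrite [X in _ + X - _](eq_bigl (fun i => i \in ~: gens)) ?addrK // => i.
  by rewrite !inE.
rewrite rmorphB /=; apply: le_trans (ler_normB _ _) _.
have -> : 14 * n%:R * sq ^+ n = 13 * n%:R * sq ^+ n + n%:R * sq ^+ n :> R by ring.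
apply: lerD.
  apply: le_trans (full_sum_bound j0 Bj nsq) _.
  by rewrite ler_wpM2r ?exprn_ge0 ?sq_ge0 // ler_wpM2l ?ler0n // ler_nat.
apply: le_trans card_nongens_real.
rewrite rmorph_sum /=; apply: le_trans (ler_norm_sum _ _ _) _.
rewrite -sum1_card natr_sum; apply: ler_sum => theta _.
by rewrite -intr_norm -[X in _ <= X]mulr1z ler_int abs_chi_le1.
Qed.

(** The number of squares among the monic polynomials of degree j. *)
Definition even_weight j : R := if odd j then 0 else q%:R ^+ j./2.

(** At a generator t^2 has chi equal to 1, since t has degree < n and cannot vanish there. Each of
    the other B, at most q^j in number, is controlled by Weil's bound. *)
Lemma monic_sum_average j : (j < n)%N ->
  `|(\sum_(theta in gens) W theta j)%:~R - even_weight j * #|gens|%:R|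
    <= 14 * n%:R * q%:R ^+ j * sq ^+ n :> R.
Proof.
move=> jn.
pose sqs : seq {poly F} := if odd j then [::] else [seq t ^+ 2 | t <- monics F j./2].
have size_sq (t : {poly F}) : t \is monic -> size (t ^+ 2) = ((size t).-1.*2).+1.
  move=> tm; have := size_exp t 2; rewrite muln2 => <-; rewrite prednK //.
  by rewrite size_poly_gt0 expf_neq0 // monic_neq0.
have sqs_sub B : B \in sqs -> B \in monics F j.
  rewrite /sqs; case: (boolP (odd j)) => // j_even /mapP [t].
  rewrite !mem_monics => /andP [tm /eqP st] ->; rewrite rpredX //= size_sq // st /=.
  by rewrite even_halfK.
have sqs_uniq : uniq sqs.
  rewrite /sqs; case: ifP => // _; rewrite map_inj_in_uniq ?monics_uniq //.
  move=> t u; rewrite !mem_monics => /andP [tm _] /andP [um _] /eqP.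
  rewrite eqf_sqr => /orP [/eqP //|/eqP e]; exfalso.
  have := congr1 lead_coef e; rewrite lead_coefN (monicP tm) (monicP um) => /eqP.
  by rewrite (negbTE (oneN1 q_odd)).
have size_sqs : (size sqs)%:R = even_weight j.
  by rewrite /sqs /even_weight; case: ifP => // _; rewrite size_map size_monics natrX.
pose X B : R := (\sum_(theta in gens) chi (ev theta B))%:~R.
have -> : (\sum_(theta in gens) W theta j)%:~R = \sum_(B <- monics F j) X B.
  by rewrite /monic_sum exchange_big /= rmorph_sum.
have XS B : B \in sqs -> X B = #|gens|%:R.
  move=> Bs; rewrite /X -(rmorph_nat intr) -sum1_card natr_sum; congr (_%:~R).
  apply: eq_bigr => theta; rewrite inE => /eqP tg.
  move: Bs; rewrite /sqs; case: ifP => // _ /mapP [t].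
  rewrite mem_monics => /andP [tm /eqP st] ->.
  rewrite ev_exp chi_sqr ?(E_odd card_E) //; case: eqP => // e.
  have : t = 0.
    apply: (@ev_eq0_small F E iota n n_gt0 card_E theta) => //.
    by rewrite tg st; apply: leq_ltn_trans jn; rewrite -{2}(odd_double_half j) -addnn addnA leq_addl.
  by move=> t0; move: tm; rewrite t0 monicE lead_coef0 eq_sym oner_eq0.
rewrite (bigID (mem sqs)) /=.
have -> : \sum_(B <- monics F j | B \in sqs) X B = even_weight j * #|gens|%:R.
  rewrite -big_filter.
  have perm : perm_eq [seq B <- monics F j | B \in sqs] sqs.
    apply: uniq_perm => //; first by rewrite filter_uniq // monics_uniq.
    by move=> B; rewrite mem_filter; apply/andP/idP => [[]|h] //; split=> //; exact: sqs_sub.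
  rewrite (perm_big _ perm) /= (eq_big_seq (fun _ => #|gens|%:R)) //.
  by rewrite big_const_seq count_predT iter_addr_0 -size_sqs mulr_natl.
rewrite addrAC subrr add0r.
apply: le_trans (ler_norm_sum _ _ _) _.
apply: (@le_trans _ _ (\sum_(B <- monics F j) 14 * n%:R * sq ^+ n)).
  rewrite big_mkcond /= big_seq [X in _ <= X]big_seq; apply: ler_sum => B Bj.
  case: ifP => Bs; last by rewrite !mulr_ge0 ?ler0n // exprn_ge0 // sq_ge0.
  apply: (gens_sum_bound (ltnW jn) Bj) => t tm; apply: contraTneq Bs => eB; rewrite negbK.
  move: Bj; rewrite eB mem_monics size_sq // => /andP [_ /eqP [ej]].
  rewrite /sqs -ej odd_double doubleK; apply: map_f.
  by rewrite mem_monics tm prednK ?eqxx // size_poly_gt0 monic_neq0.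
rewrite big_const_seq count_predT size_monics iter_addr_0 -(mulr_natl _ (q ^ j)) natrX.
by rewrite mulrCA mulrA.
Qed.

End GeneratorAverage.

Lemma scaled_sum_le (R : realDomainType) (a b : R) : 0 <= b -> 2 <= a ->
  56 * b + a * (56 * b) + a * (a * b) <= 113 * (a * (a * b)).
Proof.
move=> b0 a2.
have h1 : 2 * b <= a * b by rewrite ler_wpM2r.
have h2 : 2 * (a * b) <= a * (a * b).
  by rewrite ler_wpM2r // mulr_ge0 // (le_trans _ a2) // ler0n.
by rewrite (_ : a * (56 * b) = 56 * (a * b)); [lra | ring].
Qed.

Section GeneratorTotal.
Variables (R : realType) (F E : finFieldType) (iota : {rmorphism F -> E}) (n : nat).
Local Notation q := #|F|.
Hypothesis n_gt0 : (0 < n)%N.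
Hypothesis card_E : #|E| = (q ^ n)%N.
Hypothesis q_odd : odd q.
Local Notation fdeg := (fdeg n_gt0 card_E).
Local Notation W := (monic_sum iota).
Local Notation sq := (Num.sqrt (q%:R : R)).
Local Notation gens := (gens n_gt0 card_E).
Local Notation N := (#|gens|%:R : R).
Local Notation Q := (q%:R : R).

Lemma natr_intrE k : (k%:R : R) = (k%:R : int)%:~R.
Proof. by rewrite rmorph_nat. Qed.

Definition gen_sum k : R := (\sum_(theta in gens) W theta k)%:~R.
Definition gen_csum k : R := \sum_(j < k.+1) gen_sum j.

Lemma Q_gt0 : 0 < Q. Proof. by rewrite ltr0n ltnW // card_F_gt1. Qed.

Lemma Q_ge0 : 0 <= Q. Proof. exact: ltW Q_gt0. Qed.

Lemma Q_ge2 : 2 <= Q. Proof. by rewrite ler_nat card_F_gt1. Qed.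

Lemma Qexp_gt0 k : 0 < Q ^+ k. Proof. by rewrite exprn_gt0 // Q_gt0. Qed.

Lemma Qexp_ge0 k : 0 <= Q ^+ k. Proof. exact: ltW (Qexp_gt0 k). Qed.

Lemma sq_le_Q : sq <= Q.
Proof.
rewrite -[X in _ <= X]sqr_sqrtr ?Q_ge0 // expr2 ler_peMl ?sqrtr_ge0 //.
exact: sq_ge1.
Qed.

Lemma gensP theta : (theta \in gens) = (fdeg theta == n).
Proof. by rewrite inE. Qed.

Lemma gen_sum_ge k : (n <= k)%N -> gen_sum k = 0.
Proof.
move=> nk; rewrite /gen_sum big1 ?mulr0z // => theta; rewrite gensP => /eqP tg.
by have := monic_sum_gen_eq0 iota q_odd tg nk.
Qed.

Lemma gen_sum0 : gen_sum 0 = N.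
Proof.
rewrite /gen_sum natr_intrE -sum1_card natr_sum; congr (_%:~R).
by apply: eq_bigr => theta _; rewrite monic_sum0.
Qed.

Lemma gen_csumE k : gen_csum k = (\sum_(theta in gens) csum iota theta k)%:~R.
Proof.
rewrite /gen_csum /gen_sum -rmorph_sum /=; congr (_%:~R).
by rewrite exchange_big; apply: eq_bigr.
Qed.

Lemma gen_sum_functional k : odd n -> (k <= n.-1)%N ->
  Q ^+ (n.-1)./2 * gen_sum k = Q ^+ k * gen_sum (n.-1 - k).
Proof.
move=> n_odd kn; rewrite /gen_sum -!natrX !natr_intrE -!rmorphM /=; congr (_%:~R).
rewrite !mulr_sumr; apply: eq_bigr => theta; rewrite gensP => /eqP tg.
exact: monic_sum_functional_odd tg k n_odd kn.
Qed.

Lemma gen_csum_functional k : ~~ odd n -> (k <= n.-2)%N ->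
  Q ^+ (n./2).-1 * gen_csum k = Q ^+ k * gen_csum (n.-2 - k).
Proof.
move=> n_even kn; rewrite !gen_csumE -!natrX !natr_intrE -!rmorphM /=; congr (_%:~R).
rewrite !mulr_sumr; apply: eq_bigr => theta; rewrite gensP => /eqP tg.
exact: csum_functional_even tg k n_even kn.
Qed.

Lemma gen_csum_last : ~~ odd n -> gen_csum n.-1 = 0.
Proof.
move=> n_even; rewrite gen_csumE big1 ?mulr0z // => theta; rewrite gensP => /eqP tg.
exact: csum_last tg n_even.
Qed.

Lemma gen_sum_bound j : (j < n)%N ->
  `|gen_sum j - even_weight R F j * N| <= 14 * n%:R * Q ^+ j * sq ^+ n.
Proof. exact: monic_sum_average. Qed.

(** The reflected degree n - 1 - k is odd, so no squares occur there, and the powers q^k and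
    q^(n-1-k) combine into a bound independent of k. *)
Lemma gen_sum_odd_bound k : odd n -> odd k -> `|gen_sum k| <= 14 * n%:R * Q ^+ n.
Proof.
move=> n_odd k_odd; have c0 : 0 <= 14 * n%:R * Q ^+ n.
  by rewrite !mulr_ge0 ?ler0n // Qexp_ge0.
case: (leqP n k) => nk; first by rewrite gen_sum_ge // normr0.
have kn : (k <= n.-1)%N by rewrite -ltnS prednK.
have jn : (n.-1 - k < n)%N by apply: leq_ltn_trans (leq_subr _ _) _; rewrite prednK.
have := gen_sum_bound jn.
have -> : even_weight R F (n.-1 - k) = 0.
  rewrite /even_weight oddB // k_odd; move: n_odd n_gt0; case: (n) => //= n' /negbTE -> //.
rewrite mul0r subr0 => bj.
have r0 : 0 < Q ^+ (n.-1)./2 by exact: Qexp_gt0.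
rewrite -(ler_pM2l r0) -{1}(ger0_norm (ltW r0)) -normrM gen_sum_functional // normrM ger0_norm ?Qexp_ge0 //.
apply: (@le_trans _ _ (Q ^+ k * (14 * n%:R * Q ^+ (n.-1 - k) * sq ^+ n))).
  by rewrite ler_wpM2l // Qexp_ge0.
have e1 : Q ^+ k * Q ^+ (n.-1 - k) = Q ^+ n.-1 by rewrite -exprD subnKC.
have e2 : sq ^+ n = sq * Q ^+ (n.-1)./2.
  rewrite -{1}(prednK n_gt0) exprS -(sq_sqr R F); congr (_ * _ ^+ _).
  by rewrite even_halfK //; move: n_odd n_gt0; case: (n).
have e3 : Q ^+ n = Q * Q ^+ n.-1 by rewrite -exprS prednK.
have -> : Q ^+ k * (14 * n%:R * Q ^+ (n.-1 - k) * sq ^+ n) =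
   Q ^+ (n.-1)./2 * (14 * n%:R * (sq * Q ^+ n.-1)) by rewrite -e1 e2; ring.
rewrite ler_wpM2l ?(ltW r0) // ler_wpM2l ?mulr_ge0 ?ler0n // e3.
by rewrite ler_wpM2r ?Qexp_ge0 // sq_le_Q.
Qed.

Definition geom i : R := \sum_(t < i) Q ^+ t.

Lemma geomS i : geom i.+1 = Q * geom i + 1.
Proof.
rewrite /geom big_ord_recl expr0 addrC mulr_sumr; congr (_ + _).
by apply: eq_bigr => t _; rewrite -exprS.
Qed.

Lemma sum_even_weight k : \sum_(j < k.+1) even_weight R F j = geom (k./2).+1.
Proof.
elim: k => [|k IH]; first by rewrite big_ord1 /geom big_ord1.
rewrite big_ord_recr IH /= /even_weight /=; case: (boolP (odd k)) => k_odd /=.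
  by rewrite uphalf_half k_odd add1n /geom [in RHS]big_ord_recr.
by rewrite addr0 uphalf_half (negbTE k_odd).
Qed.

(** 28 is twice 14, as the powers of q up to q^k sum to at most 2 q^k. *)
Lemma gen_csum_bound k : (k < n)%N ->
  `|gen_csum k - geom (k./2).+1 * N| <= 28 * n%:R * Q ^+ k * sq ^+ n.
Proof.
move=> kn; rewrite -sum_even_weight mulr_suml -sumrB.
apply: le_trans (ler_norm_sum _ _ _) _.
apply: (@le_trans _ _ (\sum_(j < k.+1) 14 * n%:R * Q ^+ j * sq ^+ n)).
  by apply: ler_sum => j _; apply: gen_sum_bound; apply: leq_trans (ltn_ord j) kn.
rewrite -mulr_suml -mulr_sumr ler_wpM2r ?exprn_ge0 ?sqrtr_ge0 //.
have -> : 28 * n%:R * Q ^+ k = 14 * n%:R * (2 * Q ^+ k) by ring.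
rewrite ler_wpM2l ?mulr_ge0 ?ler0n //.
elim: (k) => [|i IH]; first by rewrite big_ord1 expr0 mulr1 ler1n.
rewrite big_ord_recr /= exprS; have := Q_ge2; have := Qexp_ge0 i; nra.
Qed.

(** W_k is a difference of two partial sums, which reflect to degrees 2i - 1 and 2i with 2i = n - 1
    - k. The squares contribute q^k geom i - q^(k-1) geom (i + 1) = -q^(k-1) per generator. Each
    partial sum costs 28, whence 56. *)
Lemma gen_sum_even_bound k : ~~ odd n -> odd k -> (k < n)%N ->
  `|Q ^+ n./2 * gen_sum k + Q ^+ k * N| <= 56 * n%:R * Q ^+ n./2 * Q ^+ n.-1.
Proof.
move=> n_even k_odd kn.
have n2 : (2 <= n)%N by move: n_even n_gt0; case: (n) => [|[]].
have sqn : sq ^+ n = Q ^+ n./2 by rewrite -(sq_sqr R F) even_halfK.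
have k0 : (0 < k)%N by case: (k) k_odd.
have ak : gen_sum k = gen_csum k - gen_csum k.-1.
  case: (k) k0 => // k' _; rewrite /gen_csum [X in _ = X - _]big_ord_recr /=.
  by rewrite addrAC subrr add0r.
pose i := (n.-1 - k)./2.
have ei : (n.-1 - k = i.*2)%N.
  have kn1 : (k <= n.-1)%N by rewrite -ltnS prednK.
  rewrite even_halfK // oddB // k_odd; move: n_even n_gt0; case: (n) => //= n'.
  by rewrite negbK => ->.
have fk1 : Q ^+ (n./2).-1 * gen_csum k.-1 = Q ^+ k.-1 * gen_csum i.*2.
  rewrite gen_csum_functional //; last by move: kn k0; clear; lia.
  by congr (_ * gen_csum _); move: ei kn k0; clear; lia.
have b2 := @gen_csum_bound i.*2.
rewrite doubleK in b2.
have i2n : (i.*2 < n)%N by rewrite -ei; apply: leq_ltn_trans (leq_subr _ _) _; rewrite prednK.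
have {}b2 := b2 i2n.
have fk : `|Q ^+ (n./2).-1 * gen_csum k - Q ^+ k * (geom i * N)| <= 28 * n%:R * Q ^+ n./2 * Q ^+ n.-2.
  case: (posnP i) => [i0|i0].
    (* At k = n - 1 there is nothing to reflect: the complete sum vanishes, and so does [geom 0]. *)
    have -> : k = n.-1 by move: ei kn; rewrite i0; clear; lia.
    by rewrite gen_csum_last // i0 /geom big_ord0 mul0r !mulr0 subrr normr0 !mulr_ge0 ?ler0n ?Qexp_ge0.
  have kn2 : (k <= n.-2)%N by move: ei i0; clear; lia.
  have e : (n.-2 - k = (i.-1).*2.+1)%N by move: ei i0; clear; lia.
  rewrite gen_csum_functional // e -mulrBr normrM ger0_norm ?Qexp_ge0 //.
  have := @gen_csum_bound (i.-1).*2.+1; rewrite /= uphalf_double prednK // => b1.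
  have {}b1 := b1 (ltac:(move: ei i0 kn; clear; lia)).
  have -> : Q ^+ n.-2 = Q ^+ k * Q ^+ (i.-1).*2.+1 by rewrite -exprD -e subnKC.
  have -> : 28 * n%:R * Q ^+ n./2 * (Q ^+ k * Q ^+ (i.-1).*2.+1) =
     Q ^+ k * (28 * n%:R * Q ^+ (i.-1).*2.+1 * sq ^+ n) by rewrite sqn; ring.
  by rewrite ler_wpM2l // Qexp_ge0.
have b3 : `|Q ^+ (n./2).-1 * gen_csum k.-1 - Q ^+ k.-1 * (geom i.+1 * N)| <=
    28 * n%:R * Q ^+ n./2 * Q ^+ n.-2.
  rewrite fk1 -mulrBr normrM ger0_norm ?Qexp_ge0 //.
  have -> : Q ^+ n.-2 = Q ^+ k.-1 * Q ^+ i.*2.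
    by rewrite -exprD -ei; congr (_ ^+ _); move: kn k0; clear; lia.
  have -> : 28 * n%:R * Q ^+ n./2 * (Q ^+ k.-1 * Q ^+ i.*2) =
     Q ^+ k.-1 * (28 * n%:R * Q ^+ i.*2 * sq ^+ n) by rewrite sqn; ring.
  by rewrite ler_wpM2l // Qexp_ge0.
have eQm : Q ^+ n./2 = Q * Q ^+ (n./2).-1.
  by rewrite -exprS prednK // half_gt0.
have eQn : Q ^+ n.-1 = Q * Q ^+ n.-2 by rewrite -exprS; congr (_ ^+ _); move: n2; clear; lia.
have eQk : Q ^+ k = Q * Q ^+ k.-1 by rewrite -exprS prednK.
have -> : Q ^+ n./2 * gen_sum k + Q ^+ k * N =
  Q * ((Q ^+ (n./2).-1 * gen_csum k - Q ^+ k * (geom i * N)) -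
       (Q ^+ (n./2).-1 * gen_csum k.-1 - Q ^+ k.-1 * (geom i.+1 * N))).
  by rewrite ak geomS eQk {1}eQm; ring.
rewrite normrM ger0_norm ?Q_ge0 //.
have -> : 56 * n%:R * Q ^+ n./2 * Q ^+ n.-1 =
  Q * (28 * n%:R * Q ^+ n./2 * Q ^+ n.-2 + 28 * n%:R * Q ^+ n./2 * Q ^+ n.-2).
  by rewrite eQn; ring.
rewrite ler_wpM2l ?Q_ge0 //; apply: le_trans (ler_normB _ _) _; exact: lerD.
Qed.

(** Here d = n and 2g + 1 < 2n, so the recurrence has no descending term. *)
Lemma sqf_sum_gen theta g : theta \in gens -> (0 < g)%N -> (2 * g <= n)%N ->
  sqf_sum iota theta (2 * g).+1 = W theta (2 * g).+1 - q%:R * W theta (2 * g).-1.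
Proof.
rewrite gensP => /eqP tg g0 gn.
have e : (2 * g).+1 = (2 * g).-1.+2 by move: g0; clear; lia.
have d0 : (0 < fdeg theta)%N by exact: fdeg_gt0.
have Ws k : W theta k = \sum_(a < k./2.+1) nonzero_count iota theta a * sqf_sum iota theta (k - a.*2).
  exact: (monic_sum_sieve iota card_E q_odd).
have N0 : nonzero_count iota theta 0 = 1 by exact: (nonzero_count0 iota n_gt0 card_E).
have Nr a : nonzero_count iota theta a.+1 - q%:R * nonzero_count iota theta a = - (a.+1 == fdeg theta)%:R.
  exact: nonzero_count_rec.
rewrite e (sieve_rec d0 Ws N0 _ Nr).
by rewrite tg leqNgt (_ : (_ < _)%N) ?addr0 //; move: gn g0; clear; lia.
Qed.

(** For even n > 2g this is what [gen_sum_even_bound] leaves in degrees 2g + 1 and 2g - 1, with the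
    number of generators replaced by q^n. At n = 2g the first sum vanishes, and each generator gives
    -q W_(n-1) = q csum (n - 2) = q^(n/2). *)
Definition gen_main g : R :=
  if n == (2 * g)%N then sq ^+ n * Q ^+ n
  else if odd n then 0 else - (sq ^+ n * (Q ^+ (2 * g) * (Q - 1))).

(** 113 = 56 + 56 + 1 comes from the case n > 2g even: two uses of [gen_sum_even_bound] and one
    replacement of the number of generators by q^n. *)
Lemma gen_total g : (0 < g)%N -> (2 * g <= n)%N ->
  `|(\sum_(theta in gens) sqf_sum iota theta (2 * g).+1)%:~R - gen_main g| <=
    113 * n%:R * Q ^+ n.+1.
Proof.
move=> g0 gn.
have -> : (\sum_(theta in gens) sqf_sum iota theta (2 * g).+1)%:~R =
    gen_sum (2 * g).+1 - Q * gen_sum (2 * g).-1.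
  rewrite /gen_sum natr_intrE -rmorphM -rmorphB /=; congr (_%:~R).
  by rewrite mulr_sumr -sumrB; apply: eq_bigr => theta tg; exact: sqf_sum_gen.
have odd1 : odd (2 * g).+1 by rewrite /= mul2n odd_double.
have odd2 : odd (2 * g).-1 by case: (g) g0 => // g' _; rewrite mul2n doubleS /= odd_double.
have n1R : 1 <= n%:R :> R by rewrite ler1n.
have Qn0 := Qexp_ge0 n; have Q2 := Q_ge2.
have eQS : Q ^+ n.+1 = Q * Q ^+ n by rewrite exprS.
have hN : Q ^+ n - N = (#|~: gens|)%:R.
  by rewrite (card_gens R) opprB addrC subrK.
have hN0 : 0 <= Q ^+ n - N by rewrite hN ler0n.
have hN1 : Q ^+ n - N <= n%:R * sq ^+ n by rewrite hN; exact: card_nongens_real.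
have qnn : 0 <= n%:R * Q ^+ n by rewrite mulr_ge0 ?ler0n.
rewrite /gen_main; case: eqP => [en|/eqP ne].
  have n_even : ~~ odd n by rewrite en mul2n odd_double.
  have sqn : sq ^+ n = Q ^+ n./2 by rewrite -(sq_sqr R F) even_halfK.
  have n2 : (2 <= n)%N by rewrite en; move: g0; clear; lia.
  have e2 : (2 * g).-1 = n.-2.+1 by rewrite en; move: g0; clear; lia.
  have ea : Q ^+ (n./2).-1 * gen_sum (2 * g).-1 = - (Q ^+ n.-2 * N).
    have -> : gen_sum (2 * g).-1 = - gen_csum n.-2.
      have : gen_csum n.-2.+1 = 0.
        by rewrite (_ : n.-2.+1 = n.-1) ?gen_csum_last //; move: n2; clear; lia.
      by rewrite e2 /gen_csum big_ord_recr /= addrC => /eqP; rewrite addr_eq0 => /eqP.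
    rewrite mulrN gen_csum_functional // subnn /gen_csum big_ord1 gen_sum0 //.
  have z1 : gen_sum (2 * g).+1 = 0 by apply: gen_sum_ge; rewrite -en leqnSn.
  rewrite z1 sub0r.
  have r0 : 0 < Q ^+ (n./2).-1 by exact: Qexp_gt0.
  have eh : Q ^+ n./2 = Q * Q ^+ (n./2).-1 by rewrite -exprS prednK // half_gt0.
  have ed : Q ^+ n.-2 = Q ^+ (n./2).-1 * Q ^+ (n./2).-1.
    rewrite -exprD; congr (_ ^+ _); move: n_even n2; clear; lia.
  have -> : Q * gen_sum (2 * g).-1 = - (Q ^+ n./2 * N).
    apply: (mulfI (lt0r_neq0 r0)); rewrite mulrCA ea eh ed; ring.
  rewrite opprK sqn -mulrBr normrM ger0_norm ?Qexp_ge0 // distrC ger0_norm //.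
  apply: (@le_trans _ _ (Q ^+ n./2 * (n%:R * sq ^+ n))); first by rewrite ler_wpM2l // Qexp_ge0.
  have -> : Q ^+ n./2 * (n%:R * sq ^+ n) = n%:R * Q ^+ n.
    rewrite sqn mulrCA -exprD addnn even_halfK //.
  by rewrite eQS -!mulrA; nra.
have gn' : (2 * g < n)%N by rewrite ltn_neqAle eq_sym ne.
case: (boolP (odd n)) => n_odd.
  rewrite subr0; apply: le_trans (ler_normB _ _) _.
  have b1 := gen_sum_odd_bound n_odd odd1; have b2 := gen_sum_odd_bound n_odd odd2.
  rewrite normrM ger0_norm ?Q_ge0 // eQS.
  move: b1 b2; set x := `|_|; set y := `|gen_sum (2 * g).-1| => b1 b2; nra.
have gn2 : (2 * g).+1 != n by apply: contraNneq n_odd => <-.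
have gn3 : ((2 * g).+1 < n)%N by rewrite ltn_neqAle gn2.
have gn4 : ((2 * g).-1 < n)%N by apply: leq_ltn_trans (leq_pred _) gn'.
have sqn : sq ^+ n = Q ^+ n./2 by rewrite -(sq_sqr R F) even_halfK.
have b1 := gen_sum_even_bound n_odd odd1 gn3; have b2 := gen_sum_even_bound n_odd odd2 gn4.
have r0 : 0 < Q ^+ n./2 by exact: Qexp_gt0.
rewrite -(ler_pM2l r0) -{1}(ger0_norm (ltW r0)) -normrM sqn opprK.
have eg : Q ^+ (2 * g).+1 = Q * Q ^+ (2 * g) by rewrite exprS.
have eg2 : Q ^+ (2 * g) = Q * Q ^+ (2 * g).-1 by rewrite -exprS prednK // muln_gt0.
have ehh : Q ^+ n./2 * Q ^+ n./2 = Q ^+ n by rewrite -exprD addnn even_halfK.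
have eqn : Q ^+ n = Q * Q ^+ n.-1 by rewrite -exprS prednK.
have -> : Q ^+ n./2 * (gen_sum (2 * g).+1 - Q * gen_sum (2 * g).-1 +
    Q ^+ n./2 * (Q ^+ (2 * g) * (Q - 1))) =
  (Q ^+ n./2 * gen_sum (2 * g).+1 + Q ^+ (2 * g).+1 * N) -
  Q * (Q ^+ n./2 * gen_sum (2 * g).-1 + Q ^+ (2 * g).-1 * N) +
  Q ^+ (2 * g) * (Q - 1) * (Q ^+ n - N).
  by rewrite eg -ehh eg2; ring.
apply: le_trans (ler_normD _ _) _.
have -> : Q ^+ n./2 * (113 * n%:R * Q ^+ n.+1) =
   113 * (n%:R * Q ^+ n./2 * Q ^+ n.+1) by ring.
set X := n%:R * Q ^+ n./2 * Q ^+ n.+1.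
have X0 : 0 <= X by rewrite !mulr_ge0 ?ler0n ?Qexp_ge0.
have eX : X = n%:R * Q ^+ n./2 * (Q * (Q * Q ^+ n.-1)) by rewrite /X eQS eqn.
set Y := n%:R * Q ^+ n./2 * Q ^+ n.-1 in eX.
have Y0 : 0 <= Y by rewrite !mulr_ge0 ?ler0n ?Qexp_ge0.
have eXY : X = Q * (Q * Y) by rewrite /X /Y eQS eqn; ring.
have c1 : `|Q ^+ n./2 * gen_sum (2 * g).+1 + Q ^+ (2 * g).+1 * N| <= 56 * Y.
  by apply: le_trans b1 _; rewrite /Y !mulrA.
have c2 : `|Q * (Q ^+ n./2 * gen_sum (2 * g).-1 + Q ^+ (2 * g).-1 * N)| <= Q * (56 * Y).
  rewrite normrM ger0_norm ?Q_ge0 // ler_wpM2l ?Q_ge0 //.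
  by apply: le_trans b2 _; rewrite /Y !mulrA.
have c3 : `|Q ^+ (2 * g) * (Q - 1) * (Q ^+ n - N)| <= X.
  have Q1 : 0 <= Q - 1 by rewrite subr_ge0 (le_trans _ Q2) // ler1n.
  rewrite ger0_norm; last by rewrite !mulr_ge0 ?Qexp_ge0.
  apply: (@le_trans _ _ (Q ^+ (2 * g) * (Q - 1) * (n%:R * sq ^+ n))).
    by rewrite ler_wpM2l // mulr_ge0 ?Qexp_ge0.
  rewrite /X sqn mulrC ler_wpM2l ?mulr_ge0 ?ler0n ?Qexp_ge0 //.
  rewrite eQS mulrC; apply: ler_pM; rewrite ?Qexp_ge0 //.
    by rewrite gerBl ler01.
  by rewrite ler_weXn2l // (le_trans _ Q2) // ler1n.
have c4 := le_trans (ler_normB (Q ^+ n./2 * gen_sum (2 * g).+1 + Q ^+ (2 * g).+1 * N)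
  (Q * (Q ^+ n./2 * gen_sum (2 * g).-1 + Q ^+ (2 * g).-1 * N))) (lerD c1 c2).
apply: le_trans (lerD c4 c3) _.
by rewrite eXY; apply: scaled_sum_le.
Qed.

End GeneratorTotal.

(** Let e = n/d. If e >= 3 the bound on 2g suffices; if e = 1 the last hypothesis gives 2g > n = d,
    which forces j >= 1. *)
Lemma odd_type_exponents n d g j : (0 < n)%N -> (d %| n)%N -> odd (n %/ d) ->
  (2 * g <= j.*2.+1 * d)%N -> ~~ ((d == n) && (2 * g <= n)%N) ->
  (2 * g + d.*2 <= (j.*2 * d).*2 + n)%N.
Proof.
move=> n0 /dvdnP [e en]; have d0 : (0 < d)%N by move: n0; rewrite en muln_gt0 => /andP [].
rewrite {}en mulnK //; case: e => [|[|[|e]]] // _ h1; last by move=> _; move: h1; clear; nia.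
rewrite mul1n eqxx /= -ltnNge => h2.
by case: j h1 => [|j] h1; move: h1 h2; clear; nia.
Qed.

(** * Contributions of all points *)

Section Total.
Variables (R : realType) (F E : finFieldType) (iota : {rmorphism F -> E}) (n : nat).
Local Notation q := #|F|.
Hypothesis n_gt0 : (0 < n)%N.
Hypothesis card_E : #|E| = (q ^ n)%N.
Hypothesis q_odd : odd q.
Local Notation fdeg := (fdeg n_gt0 card_E).
Local Notation sq := (Num.sqrt (q%:R : R)).
Local Notation gens := (gens n_gt0 card_E).
Local Notation etype := (even_type n_gt0 card_E).
Local Notation Q := (q%:R : R).
Local Notation Qge0 := (Qexp_ge0 R F).
Local Notation Qgt0 := (Qexp_gt0 R F).

(** At most q^d points have degree d, so each degree from 1 to n contributes at most 1. *)
Lemma sum_inv_deg : \sum_(theta : E) (Q ^+ fdeg theta)^-1 <= n%:R.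
Proof.
have fn theta : (fdeg theta < n.+1)%N.
  by rewrite ltnS dvdn_leq // fdeg_dvd_n.
rewrite (partition_big (fun theta => inord (fdeg theta) : 'I_n.+1) (fun d => (0 < d)%N)) /=; last first.
  by move=> theta _; rewrite inordK // fdeg_gt0.
apply: (@le_trans _ _ (\sum_(d < n.+1 | (0 < d)%N) 1)).
  apply: ler_sum => d d0.
  apply: (@le_trans _ _ (\sum_(theta : E | theta ^+ (q ^ d) == theta) (Q ^+ d)^-1)).
    rewrite big_mkcond [X in _ <= X]big_mkcond /=; apply: ler_sum => theta _.
    case: eqP => [e|_].
      have ed : fdeg theta = d by rewrite -[RHS](congr1 (@nat_of_ord _) e) inordK.
      by rewrite -ed frob_fdeg eqxx.
    by case: ifP => // _; rewrite invr_ge0 Qge0.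
  rewrite sumr_const -[X in X *+ _]mul1r -mulrnAr -mulr_natr mul1r.
  rewrite mulrC ler_pdivrMr ?Qgt0 // mul1r -natrX ler_nat.
  apply: leq_trans (card_roots_XqX _ _ d0); apply: subset_leq_card.
  by apply/subsetP => x; rewrite inE.
have c : #|[pred d : 'I_n.+1 | (0 < d)%N]| = n.
  rewrite (eq_card (B := predC1 ord0)) ?cardC1 ?card_ord // => d.
  by rewrite !inE lt0n.
by rewrite sumr_const c.
Qed.

(** The first factor is the number of square-free monic polynomials of degree 2g + 1, and q^d/(q^d +
    1) is the density among them of those not vanishing at theta. *)
Definition main_part g theta : R :=
  if etype theta then (Q ^+ (2 * g).+1 - Q ^+ (2 * g)) * (Q ^+ fdeg theta / (Q ^+ fdeg theta + 1)) else 0.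

Definition err g theta : R := (sqf_sum iota theta (2 * g).+1)%:~R - main_part g theta.

Lemma err_decay g theta : exists j, (2 * g <= j.*2.+1 * fdeg theta)%N /\
  `|err g theta| * Q ^+ (j.*2 * fdeg theta) <= Q ^+ (2 * g).+1.
Proof.
have odd1 : odd (2 * g).+1 by rewrite /= mul2n odd_double.
rewrite /err /main_part; case: (boolP (etype theta)) => et; last first.
  have [j [h1 h2]] := sqf_sum_bound iota q_odd (2 * g).+1 et.
  exists j; split; first by rewrite -ltnS.
  rewrite subr0 -intr_norm -!natrX !(natr_intrE R) -rmorphM ler_int //.
have [j [h1 h2]] := sqf_sum_even_type iota q_odd et odd1.
exists j; split; first by rewrite -ltnS.
set d := fdeg theta in h1 h2 *; set h := sqf_sum _ _ _ in h1 h2 *.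
have p0 : 0 < Q ^+ d + 1 by rewrite addr_gt0 ?Qgt0 // ltr01.
have pN (x : R) : (Q ^+ d + 1) * `|x| = `|(Q ^+ d + 1) * x|.
  by rewrite normrM (ger0_norm (ltW p0)).
rewrite -(ler_pM2l p0) [X in X <= _]mulrA pN.
have -> : (Q ^+ d + 1) * (h%:~R - (Q ^+ (2 * g).+1 - Q ^+ (2 * g)) * (Q ^+ d / (Q ^+ d + 1))) =
  (Q ^+ d + 1) * h%:~R - Q ^+ d * (Q ^+ (2 * g).+1 - Q ^+ (2 * g)).
  by rewrite mulrBr; congr (_ - _); field; rewrite lt0r_neq0.
move: h2; rewrite -(ler_int R) rmorphM [X in _ <= X]rmorphM /= intr_norm rmorphB /=.
rewrite 2!rmorphM rmorphB !rmorphD /= rmorph1.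
rewrite !rmorph_nat !natrX //.
Qed.

(** The weight q^d prepares for [sum_inv_deg]. If 2g + 2d <= 4jd + n the first term on the right
    dominates; otherwise theta is of even type with j = 0, so 2g + d <= n and the second one does.
    Generators with 2g <= n are left out, as they carry a main term of their own. *)
Lemma err_bound g theta : (0 < g)%N -> ~~ ((theta \in gens) && (2 * g <= n)%N) ->
  Q ^+ fdeg theta * `|err g theta| <= Q * (sq ^+ (n + 2 * g) + Q ^+ n).
Proof.
move=> g0 ng; have [j [h1 h2]] := err_decay g theta.
have d0 := fdeg_gt0 n_gt0 card_E theta; have dn := fdeg_dvd_n n_gt0 card_E theta.
have key : Q ^+ (2 * g + fdeg theta) <= Q ^+ (j.*2 * fdeg theta) * (sq ^+ (n + 2 * g) + Q ^+ n).
  have case1 : (2 * g + (fdeg theta).*2 <= (j.*2 * fdeg theta).*2 + n)%N ->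
      Q ^+ (2 * g + fdeg theta) <= Q ^+ (j.*2 * fdeg theta) * (sq ^+ (n + 2 * g) + Q ^+ n).
    move=> h; rewrite mulrDr; apply: ler_wpDr; first by rewrite mulr_ge0 ?Qge0.
    rewrite -!(sq_sqr R F) -exprD; apply: ler_weXn2l; first exact: sq_ge1.
    by move: h; move: (j.*2 * fdeg theta)%N; lia.
  have case2 : (2 * g + fdeg theta <= n)%N ->
      Q ^+ (2 * g + fdeg theta) <= Q ^+ (j.*2 * fdeg theta) * (sq ^+ (n + 2 * g) + Q ^+ n).
    move=> h; apply: (@le_trans _ _ (Q ^+ n)); first by apply: ler_weXn2l => //; exact: q_ge1.
    rewrite -[X in X <= _]mul1r; apply: ler_pM; rewrite ?ler01 ?Qge0 //.
      by apply: exprn_ege1; exact: q_ge1.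
    by rewrite lerDr exprn_ge0 // sqrtr_ge0.
  move: h1 ng d0 dn; rewrite (gensP n_gt0 card_E).
  case: (boolP (etype theta)) => [/andP [n_even dn2]|et].
    move: dn2 case1 case2; move: (fdeg theta) => d dn2 case1 case2 h1 _ d0 _.
    have h2d : (d.*2 <= n)%N.
      by rewrite -geq_half_double dvdn_leq // half_gt0; move: n_even n_gt0; case: (n) => [|[]].
    case: j h1 case1 case2 {h2} => [|j] h1 case1 case2.
      by apply: case2; move: h1 h2d; clear; lia.
    by apply: case1; move: h1 h2d; clear; nia.
  by move=> h1 ng d0 dn; apply: case1; apply: odd_type_exponents => //; exact: odd_type_quotient.
have p0 := Qgt0 (j.*2 * fdeg theta).
rewrite -(ler_pM2r p0) -mulrA.
apply: (@le_trans _ _ (Q ^+ fdeg theta * Q ^+ (2 * g).+1)); first by rewrite ler_wpM2l ?Qge0.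
have -> : Q ^+ fdeg theta * Q ^+ (2 * g).+1 = Q * Q ^+ (2 * g + fdeg theta).
  by rewrite exprS exprD; ring.
rewrite -mulrA ler_wpM2l ?(Q_ge0 R F) //.
by rewrite mulrC.
Qed.

Lemma sum_err_le (A : {pred E}) g : (0 < g)%N ->
  (forall theta, theta \in A -> ~~ ((theta \in gens) && (2 * g <= n)%N)) ->
  `|\sum_(theta in A) err g theta| <= n%:R * (Q * (sq ^+ (n + 2 * g) + Q ^+ n)).
Proof.
move=> g0 hA; set X := Q * _.
have X0 : 0 <= X by rewrite mulr_ge0 ?(Q_ge0 R F) // addr_ge0 ?Qge0 // exprn_ge0 // sqrtr_ge0.
apply: le_trans (ler_norm_sum _ _ _) _.
apply: (@le_trans _ _ (\sum_(theta : E) (Q ^+ fdeg theta)^-1 * X)).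
  rewrite big_mkcond /=; apply: ler_sum => theta _; case: ifP => tA.
    by rewrite mulrC ler_pdivlMr ?Qgt0 // mulrC err_bound // hA.
  by rewrite mulr_ge0 // invr_ge0 Qge0.
by rewrite -mulr_suml ler_wpM2r // sum_inv_deg.
Qed.

Definition total_main g : R := if (2 * g <= n)%N then gen_main R F n g else 0.

Lemma total_bound g : (0 < g)%N ->
  `|(\sum_(theta : E) sqf_sum iota theta (2 * g).+1)%:~R -
     \sum_(theta : E) main_part g theta - total_main g| <=
  (if (2 * g <= n)%N then 113 * n%:R * Q ^+ n.+1 else 0) +
    n%:R * (Q * (sq ^+ (n + 2 * g) + Q ^+ n)).
Proof.
move=> g0.
have -> : (\sum_(theta : E) sqf_sum iota theta (2 * g).+1)%:~R -
    \sum_(theta : E) main_part g theta = \sum_(theta : E) err g theta.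
  by rewrite rmorph_sum -sumrB.
rewrite /total_main; case: ifP => gn; last first.
  rewrite subr0 add0r; apply: (@sum_err_le predT) => // theta _.
  by rewrite gn andbF.
rewrite (bigID (mem gens)) /= addrAC; apply: le_trans (ler_normD _ _) _; apply: lerD.
  rewrite (eq_bigr (fun theta => (sqf_sum iota theta (2 * g).+1)%:~R)) => [|theta tg].
    by rewrite -rmorph_sum /=; exact: gen_total.
  rewrite /err /main_part (_ : etype theta = false) ?subr0 //; apply: negbTE.
  by apply: gen_not_even_type; move: tg; rewrite gensP => /eqP.
apply: (@sum_err_le [pred theta | theta \notin gens]) => // theta; rewrite !inE => /negbTE ->.
by [].
Qed.

End Total.

(** * Primes and Frobenius orbits *)

Section Primes.
Variables (F E : finFieldType) (iota : {rmorphism F -> E}) (n : nat).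
Local Notation q := #|F|.
Hypothesis n_gt0 : (0 < n)%N.
Hypothesis card_E : #|E| = (q ^ n)%N.
Local Notation ev := (ev iota).
Local Notation fdeg := (fdeg n_gt0 card_E).

Lemma minpoly_prime theta : exists P, [/\ prime_poly P, deg P = fdeg theta & ev theta P = 0].
Proof.
have [P [Pm sP PB]] := minpoly_exists iota n_gt0 card_E theta.
have P0 := monic_neq0 Pm; have d0 := fdeg_gt0 n_gt0 card_E theta.
exists P; split; [|by rewrite /deg sP|by apply/eqP; rewrite PB].
split=> //; split; first by rewrite sP ltnS.
move=> r sr rP; have /dvdpP [t et] := rP.
have : ev theta P == 0 by rewrite PB.
rewrite /eqp rP et evM mulf_eq0 -et => /orP []; rewrite PB //.
move=> Pt; exfalso; have t0 : t != 0 by apply: contraNneq P0 => t0; rewrite et t0 mul0r.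
have r0 : r != 0 by apply: contraNneq P0 => r0; rewrite et r0 mulr0.
have := dvdp_leq t0 Pt; rewrite et size_mul //.
move: sr r0; rewrite -size_poly_eq0; move: (size r) (size t); clear; lia.
Qed.

Lemma prime_root P theta : prime_poly P -> ev theta P = 0 ->
  deg P = fdeg theta /\ forall B, (ev theta B == 0) = (P %| B).
Proof.
move=> [Pm [sP1 Pirr]] evP.
have [M [Mm sM MB]] := minpoly_exists iota n_gt0 card_E theta.
have MP : M %| P by rewrite -MB evP.
have eMP : M = P.
  apply/eqP; rewrite -eqp_monic //; apply: Pirr => //.
  by rewrite sM; have := fdeg_gt0 n_gt0 card_E theta; case: (fdeg theta).
by rewrite -eMP /deg sM; split.
Qed.

Lemma poly_expD_cardF_pow k (x y : {poly E}) : (x + y) ^+ (q ^ k) = x ^+ (q ^ k) + y ^+ (q ^ k).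
Proof.
elim: k => [|k IH]; first by rewrite expn0 !expr1.
by rewrite expnSr !exprM IH (poly_expD_cardF iota).
Qed.

Lemma XqX_dvd d k : ('X^(q ^ d) - 'X : {poly E}) %| 'X^(q ^ (d * k)) - 'X.
Proof.
elim: k => [|k IH]; first by rewrite muln0 expn0 expr1 subrr dvdp0.
have -> : 'X^(q ^ (d * k.+1)) - 'X = ('X^(q ^ (d * k)) - 'X) ^+ (q ^ d) + ('X^(q ^ d) - 'X) :> {poly E}.
  have e : ('X^(q ^ (d * k)) - 'X + 'X) ^+ (q ^ d) = 'X^(q ^ (d * k.+1)) :> {poly E}.
    by rewrite subrK -exprM -expnD mulnS addnC.
  by rewrite -e poly_expD_cardF_pow; ring.
apply: dvdp_add => //; apply: (dvdp_trans IH).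
by rewrite -{1}[_ - _]expr1 dvdp_exp2l // expn_gt0 ltnW // card_F_gt1.
Qed.

(** X^#|E| - X is the product of all X - x over E, so a divisor of it splits with simple roots. *)
Lemma card_roots_split (p : {poly E}) : p %| 'X^#|E| - 'X ->
  #|[set x | root p x]| = (size p).-1.
Proof.
rewrite finField_genPoly => /dvdp_prod_XsubC [m pm].
have um : uniq (mask m (index_enum E)) by rewrite mask_uniq // index_enum_uniq.
rewrite (eqp_size pm) size_prod_XsubC /= -(card_uniqP um).
by apply: eq_card => x; rewrite inE (eqp_root pm) root_prod_XsubC.
Qed.

Lemma card_frob_fixed d : (0 < d)%N -> (d %| n)%N ->
  #|[set x : E | x ^+ (q ^ d) == x]| = (q ^ d)%N.
Proof.
move=> d0 /dvdnP [k en]; have s : size ('X^(q ^ d) - 'X : {poly E}) = (q ^ d).+1.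
  by rewrite size_polyDl size_polyXn // size_polyN size_polyX ltnS card_F_exp_gt1.
have := @card_roots_split ('X^(q ^ d) - 'X); rewrite s /= card_E {1}en mulnC => e.
rewrite -[RHS]e; last exact: XqX_dvd.
by apply: eq_card => x; rewrite !inE rootE !hornerE subr_eq0.
Qed.

End Primes.

Section PrimeSum.
Variable F : finFieldType.
Local Notation q := #|F|.

(** In a splitting field of P, a root of P has degree [deg P] and is fixed by the corresponding
    Frobenius power, and P divides every polynomial vanishing at it. *)
Lemma prime_dvd_XqX (P : {poly F}) : prime_poly P -> P %| 'X^(q ^ deg P) - 'X.
Proof.
move=> Pp; have [Pm [sP1 _]] := Pp; have P0 := monic_neq0 Pm.
have [L [zs PL _]] := FinSplittingFieldFor P0.
pose E' := finvect_type L; pose io : {rmorphism F -> E'} := in_alg L.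
have cE : #|E'| = (q ^ \dim {:L})%N by rewrite -(card_vspacef (Vector.on E')) card_vspace.
have n0 : (0 < \dim {:L})%N by exact: adim_gt0.
case: zs PL => [|z zs] PL.
  by have := eqp_size PL; rewrite big_nil size_poly1 size_map_poly => sP; move: sP1; rewrite sP.
have z0 : ev io (z : E') P = 0.
  have : root (map_poly (in_alg L) P) z by rewrite (eqp_root PL) root_prod_XsubC mem_head.
  by move=> /rootP.
have [dP PB] := prime_root n0 cE Pp z0.
rewrite -PB evB ev_exp !evX dP subr_eq0; apply/eqP.
exact: frob_fdeg.
Qed.

Variables (E : finFieldType) (iota : {rmorphism F -> E}) (n : nat).
Hypothesis n_gt0 : (0 < n)%N.
Hypothesis card_E : #|E| = (q ^ n)%N.
Local Notation ev := (ev iota).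
Local Notation fdeg := (fdeg n_gt0 card_E).

Lemma card_prime_roots P : prime_poly P -> (deg P %| n)%N ->
  #|[set theta | ev theta P == 0]| = deg P.
Proof.
move=> Pp /dvdnP [k en].
have := @card_roots_split E (map_poly iota P); rewrite size_map_poly => e.
rewrite -[RHS]e //;
rewrite card_E {1}en mulnC; apply: dvdp_trans (XqX_dvd iota (deg P) k).
have := prime_dvd_XqX Pp; rewrite -(dvdp_map iota) rmorphB rmorphXn /= !map_polyX //.
Qed.

(** The [deg P] roots of P in E share its weight equally, and every theta is a root of exactly one
    prime, its minimal polynomial. *)
Lemma prime_sumE (R : realType) m : (0 < m)%N -> (m %| n)%N ->
  prime_sum F R m = \sum_(theta | (fdeg theta %| m)%N) 1 / ((q ^ fdeg theta)%:R + 1).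
Proof.
move=> m0 mn; rewrite /prime_sum.
pose w d : R := 1 / ((q ^ d)%:R + 1).
transitivity (\sum_(P : {poly_(m.+1) F} | `[< prime_poly P >] && (deg P %| m)%N)
    \sum_(theta : E | ev theta P == 0) w (deg P)).
  apply: eq_bigr => P /andP [/asboolP Pp dP].
  rewrite sumr_const /w -[RHS]mulr_natl mulrA mulr1; congr (_%:R / _).
  rewrite -(card_prime_roots Pp) ?(dvdn_trans dP) //.
  by apply: eq_card => x; rewrite inE.
rewrite (exchange_big_dep xpredT) //= [RHS]big_mkcond /=; apply: eq_bigr => theta _.
case: ifP => dm; last first.
  apply: big_pred0 => P; apply/negbTE/negP => /andP [/andP [/asboolP Pp dP] /eqP e].
  by have [eP _] := prime_root n_gt0 card_E Pp e; rewrite -eP dP in dm.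
have [M [Mp dM evM0]] := minpoly_prime iota n_gt0 card_E theta.
have sM : (size M <= m.+1)%N.
  have := dvdn_leq m0 dm; rewrite -dM /deg; move: (size M); clear; lia.
rewrite (big_pred1 (npolyp m.+1 M)) => [|P].
  by rewrite /w [polyn _]npolypK // dM.
apply/andP/eqP => [[/andP [/asboolP Pp dP] /eqP e]|->].
  apply/val_inj; rewrite /= [RHS]npolypK //.
  have [_ PB] := prime_root n_gt0 card_E Pp e.
  have [_ MB] := prime_root n_gt0 card_E Mp evM0.
  have [Pm _] := Pp; have [Mm _] := Mp.
  by apply/eqP; rewrite -eqp_monic // /eqp -PB evM0 eqxx -MB e eqxx.
by rewrite [polyn _]npolypK // evM0 eqxx dM dm; split=> //; rewrite andbT; apply/asboolP.
Qed.

End PrimeSum.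

(** * The mean trace, its main terms and the final error *)

Section MeanTrace.
Variables (R : realType) (F : finFieldType) (g n : nat).
Local Notation q := #|F|.
Hypothesis q_odd : odd q.
Hypothesis g_gt0 : (0 < g)%N.
Hypothesis n_gt0 : (0 < n)%N.
Local Notation E := (finvect_type (Fext F n)).
Local Notation card_E := (card_Fext F n_gt0).
Let iota : {rmorphism F -> E} := in_alg E.
Local Notation fdeg := (fdeg n_gt0 card_E).
Local Notation sq := (Num.sqrt (q%:R : R)).
Local Notation Q := (q%:R : R).
Local Notation H := (Q ^+ (2 * g).+1 - Q ^+ (2 * g)).

Lemma sum_hyperelliptic (V : nmodType) (f : {poly F} -> V) :
  \sum_(D in hyperelliptic F g) f D = \sum_(D <- sqf F (2 * g).+1) f D.
Proof.
rewrite -big_enum -(big_map (fun D : {poly_((2 * g).+2) F} => D : {poly F}) xpredT f).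
apply: perm_big; apply: uniq_perm; rewrite ?sqf_uniq //.
  by rewrite map_inj_uniq ?enum_uniq //; exact: val_inj.
move=> D; rewrite mem_sqf mem_monics; apply/mapP/idP => [[P]|/and3P [h1 h2 h3]].
  by rewrite mem_enum inE => /and3P [h1 h2 h3] ->; rewrite h2 h3.
exists (npolyp (2 * g).+2 D); rewrite ?mem_enum ?inE; last first.
  by rewrite [RHS]npolypK // (eqP h3).
by rewrite [polyn _]npolypK ?(eqP h3) // h1 h2 eqxx.
Qed.

Lemma card_hyperelliptic : (#|hyperelliptic F g|)%:R = H.
Proof.
have -> : #|hyperelliptic F g| = size (sqf F (2 * g).+1).
  by rewrite -sum1_card (sum_hyperelliptic (fun _ => 1%N)) sum1_size.
have -> : (2 * g)%N = (2 * g).-2.+2 by move: g_gt0; clear; lia.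
by rewrite (natr_intrE R) size_sqfE rmorphB /= !rmorph_nat !natrX.
Qed.

Lemma mean_trace (Theta : forall g : nat, {poly F} -> 'M[R[i]]_(2 * g)) :
  (forall (g : nat) (Q : {poly_((2 * g).+2) F}),
     (1 <= g)%N -> Q \in hyperelliptic F g ->
     unitarized_Frobenius Q (Theta g Q)) ->
  mean g (fun Q => \tr (Theta g Q ^+ n)) =
  (- (\sum_(theta : E) sqf_sum iota theta (2 * g).+1)%:~R / (sq ^+ n * H))%:C.
Proof.
move=> hT; rewrite /mean -(rmorph_nat (@real_complex R)) card_hyperelliptic.
have s0 : (sq%:C ^+ n : R[i]) != 0.
  by rewrite expf_neq0 // fmorph_eq0 sqrtr_eq0 -ltNge Q_gt0.
have -> : \sum_(D in hyperelliptic F g) \tr (Theta g D ^+ n) =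
    (sq%:C ^+ n)^-1 * - (\sum_(D in hyperelliptic F g) char_sum n D)%:~R.
  rewrite rmorph_sum -sumrN mulr_sumr; apply: eq_bigr => D hD.
  apply: (mulfI s0); rewrite mulVKf //; apply: trace_char_sum => //; last exact: hT.
  by move: hD; rewrite inE => /and3P [/eqP].
rewrite sum_hyperelliptic exchange_big /=.
rewrite rmorphM fmorphV rmorphM rmorphXn rmorphN rmorph_int invfM.
by rewrite [RHS]mulrA [X in X / _]mulrC.
Qed.

Local Notation M := (\sum_(theta : E) main_part R n_gt0 card_E g theta).

Lemma card_even_type : ~~ odd n ->
  #|[set theta : E | even_type n_gt0 card_E theta]| = (q ^ n./2)%N.
Proof.
move=> n_even; have h0 : (0 < n./2)%N by rewrite half_gt0; move: n_even n_gt0; case: (n) => [|[]].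
have hn : (n./2 %| n)%N by rewrite -[X in (_ %| X)%N](even_halfK n_even) -muln2 dvdn_mulr.
rewrite -(card_frob_fixed iota card_E h0 hn); apply: eq_card => x.
by rewrite !inE /even_type n_even (fdeg_dvd n_gt0 card_E).
Qed.

(** q^d/(q^d + 1) = 1 - 1/(q^d + 1): the ones count the q^(n/2) points of even type, and the
    remainder is the sum over primes. *)
Lemma sum_main_part : M = even_ind R n * (H * (sq ^+ n - prime_sum F R n./2)).
Proof.
rewrite /even_ind; case: (boolP (odd n)) => [n_odd|n_even].
  by rewrite mul0r big1 // => theta _; rewrite /main_part /even_type n_odd.
have h0 : (0 < n./2)%N by rewrite half_gt0; move: n_even n_gt0; case: (n) => [|[]].
have hn : (n./2 %| n)%N by rewrite -[X in (_ %| X)%N](even_halfK n_even) -muln2 dvdn_mulr.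
rewrite mul1r (prime_sumE iota n_gt0 card_E R h0 hn).
have -> : sq ^+ n = (q ^ n./2)%:R by rewrite natrX -(sq_sqr R F) even_halfK.
rewrite -(card_even_type n_even).
rewrite -sum1_card natr_sum mulrBr !mulr_sumr.
rewrite [X in _ = X - _](eq_bigl (fun theta => (fdeg theta %| n./2)%N)); last first.
  by move=> x; rewrite inE /even_type n_even.
rewrite -sumrB [RHS]big_mkcond; apply: eq_bigr => theta _.
rewrite /main_part /even_type n_even /=; case: ifP => // _.
have p0 : (q ^ fdeg theta)%:R + 1 != 0 :> R by rewrite natr1 pnatr_eq0.
rewrite -[RHS]mulrBr; congr (_ * _); rewrite -natrX; apply: (mulIf p0).
by rewrite mulrBl !divfK // mul1r addrK.
Qed.

(** The points of even type give -1 for n even. The generators cancel it when n > 2g and add -1/(q -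
    1) when n = 2g. *)
Lemma main_termE :
  main_term R q g n + even_ind R n * (1 / sq ^+ n) * prime_sum F R n./2 =
  - ((M + total_main R F n g) / (sq ^+ n * H)).
Proof.
have s0 : sq ^+ n != 0 by rewrite expf_neq0 // sqrtr_eq0 -ltNge Q_gt0.
have Q10 : Q - 1 != 0 by rewrite subr_eq0 pnatr_eq1 gtn_eqF // card_F_gt1.
have Qg0 : Q ^+ (2 * g) != 0 by rewrite expf_neq0 // lt0r_neq0 // Q_gt0.
have eH : H = Q ^+ (2 * g) * (Q - 1) by rewrite exprS mulrBr mulr1 mulrC.
rewrite sum_main_part eH /main_term /total_main /gen_main.
have eQ : n = (2 * g)%N -> Q ^+ n = Q ^+ (2 * g) /\ even_ind R n = 1.
  by move=> h; rewrite /even_ind h mul2n odd_double.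
have e01 : even_ind R n = if odd n then 0 else 1 by rewrite /even_ind; case: odd.
move: eQ s0 Q10 Qg0; move: (sq ^+ n) (prime_sum F R n./2) (Q ^+ (2 * g)) (Q ^+ n) (Q - 1).
move=> s p Qg Qn r eQ s0 r0 Qg0.
case: (ltngtP n (2 * g)%N) => h.
- by rewrite addr0; field; rewrite s0 r0 Qg0.
- by rewrite e01; case: odd; field; rewrite s0 r0 Qg0.
- by have [-> ->] := eQ h; field; rewrite s0 r0 Qg0.
Qed.

(** If 2g <= n, then q^g <= q^(n/2) and the first error term absorbs everything with constant 113 +
    1 + 1 < 120. If n < 2g, then n <= 2g turns the mixed term into a multiple of g / q^g. Of the
    factor q - 1 in the number of curves only q - 1 >= 1 is used. *)
Lemma error_bound :
  ((if (2 * g <= n)%N then 113 * n%:R * Q ^+ n.+1 else 0) +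
    n%:R * (Q * (sq ^+ (n + 2 * g) + Q ^+ n))) / (sq ^+ n * H) <=
  120 * Q * (n%:R * (sq ^+ n / Q ^+ (2 * g)) + g%:R / Q ^+ g).
Proof.
have s0 : 0 < sq ^+ n by rewrite exprn_gt0 // sqrtr_gt0 Q_gt0.
have Q2 := Q_ge2 R F.
have H0 : 0 < Q ^+ (2 * g) * (Q - 1) by rewrite mulr_gt0 ?Qexp_gt0 //; lra.
have eH : H = Q ^+ (2 * g) * (Q - 1) by rewrite exprS mulrBr mulr1 mulrC.
have Qg0 := Qexp_gt0 R F g.
rewrite eH ler_pdivrMr; last exact: mulr_gt0.
have eg : Q ^+ (2 * g) = Q ^+ g * Q ^+ g by rewrite -exprD addnn mul2n.
have en : Q ^+ n = sq ^+ n * sq ^+ n by rewrite -exprD addnn sq_sqr.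
have es : sq ^+ (n + 2 * g) = sq ^+ n * Q ^+ g by rewrite exprD mul2n sq_sqr.
have -> : 120 * Q * (n%:R * (sq ^+ n / Q ^+ (2 * g)) + g%:R / Q ^+ g) *
    (sq ^+ n * (Q ^+ (2 * g) * (Q - 1))) =
  120 * (Q * (n%:R * (sq ^+ n * sq ^+ n) + g%:R * (sq ^+ n * Q ^+ g))) * (Q - 1).
  move: Qg0; rewrite eg; move: (sq ^+ n) (Q ^+ g) (Q - 1) Q => s x r y x0.
  by field; rewrite lt0r_neq0.
have N0 : 0 <= n%:R :> R := ler0n _ _.
have G0 : 0 <= g%:R :> R := ler0n _ _.
rewrite es exprS en.
set a := sq ^+ n * sq ^+ n; set b := sq ^+ n * Q ^+ g.
have a0 : 0 <= a by rewrite mulr_ge0 // ltW.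
have b0 : 0 <= b by rewrite mulr_ge0 // ltW.
have Y0 : 0 <= 120 * (Q * (n%:R * a + g%:R * b)).
  have Q0 := Q_ge0 R F; apply: mulr_ge0; first exact: ler0n.
  by apply: mulr_ge0 => //; apply: addr_ge0; exact: mulr_ge0.
apply: (@le_trans _ _ (120 * (Q * (n%:R * a + g%:R * b)))); last by rewrite ler_peMr //; lra.
have -> : (if (2 * g <= n)%N then 113 * n%:R * (Q * a) else 0) + n%:R * (Q * (b + a)) =
  Q * ((if (2 * g <= n)%N then 113 * (n%:R * a) else 0) + n%:R * b + n%:R * a).
  by case: ifP => _; ring.
rewrite [X in _ <= X]mulrCA; apply: ler_wpM2l; first exact: Q_ge0.
have na0 : 0 <= n%:R * a by rewrite mulr_ge0.
have gb0 : 0 <= g%:R * b by rewrite mulr_ge0.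
case: ifP => hgn.
  have : n%:R * b <= n%:R * a.
    rewrite ler_wpM2l // /a /b ler_wpM2l ?(ltW s0) // -(sq_sqr R F) -mul2n.
    by apply: ler_weXn2l => //; exact: sq_ge1.
  by move=> h; lra.
have : n%:R * b <= 2 * (g%:R * b).
  rewrite mulrA ler_wpM2r // -natrM ler_nat; move: hgn; clear; lia.
by move=> h; lra.
Qed.

End MeanTrace.

Lemma normr_real_complex (R : realType) (x : R) : `|x%:C| = `|x|%:C :> R[i].
Proof. by rewrite normc_def expr0n addr0 sqrtr_sqr. Qed.

Theorem theorem1 (R : realType) (q : nat) (q_odd : odd q) :
  exists K : R, forall F : finFieldType, #|F| = q ->
  forall Theta : (forall g : nat, {poly F} -> 'M[R[i]]_(2 * g)),
  (forall (g : nat) (Q : {poly_((2 * g).+2) F}),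
     (1 <= g)%N -> Q \in hyperelliptic F g ->
     unitarized_Frobenius Q (Theta g Q)) ->
  forall g n : nat, (1 <= g)%N -> (0 < n)%N ->
  `| mean g (fun Q => \tr (Theta g Q ^+ n))
     - (main_term R q g n
        + even_ind R n * (1 / Num.sqrt q%:R ^+ n) * prime_sum F R n./2)%:C |
  <= (K * (n%:R * (Num.sqrt q%:R ^+ n / q%:R ^+ (2 * g))
           + g%:R / q%:R ^+ g))%:C.
Proof.
exists (120 * q%:R) => F cardF Theta hT g n g0 n0; subst q.
pose E := finvect_type (Fext F n).
rewrite (mean_trace q_odd g0 n0 hT) (main_termE R F g n0) -rmorphB normr_real_complex lecR.
apply: le_trans (error_bound R F g n).
set X := Num.sqrt _ ^+ n * _; have X0 : 0 <= X^-1.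
  rewrite invr_ge0 mulr_ge0 ?exprn_ge0 ?sqrtr_ge0 // subr_ge0.
  by apply: ler_weXn2l => //; exact: q_ge1.
rewrite mulNr opprK addrC -mulrBl normrM (ger0_norm X0) ler_wpM2r // distrC opprD addrA.
exact: (total_bound R (in_alg E : {rmorphism F -> E}) n0 (card_Fext F n0) q_odd g0).
Qed.
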